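(* Assume $\mathbb{E}[\gamma^2]<\infty$ and $\mathbb{E}[\xi^2]<\infty$. Let $\{G_n\}_{n\in\mathbb{N}}$ be a sequence of Repeated Configuration Model (RCM) graphs with $|V_n|=n$, with target in-degree variable $\gamma$ and target out-degree variable $\xi$, and let $\alpha,\beta\in\{+,-\}$. Then, as $n\to\infty$, $\rho_\alpha^\beta(G_n)\to0$ in probability, $\overline{\rho}_\alpha^\beta(G_n)\to0$ in probability, and $\tau_\alpha^\beta(G_n)\to0$ in probability.
   Context: Bi-degree sequence. Let $\gamma$ (in-degree) and $\xi$ (out-degree) be random variables with values in $\{0,1,2,\dots\}$, $0<\mathbb{E}[\gamma]=\mathbb{E}[\xi]<\infty$, with $\mathbb{P}(\gamma>x)\le x^{-a}L_-(x)$ and $\mathbb{P}(\xi>x)\le x^{-b}L_+(x)$ for all $x>0$, where $a,b>1$ and $L_\pm$ are slowly varying. Set $\kappa=\min\{1-a^{-1},1-b^{-1},1/2\}$ and fix $0<\delta_0<\kappa$. For a vertex set $V_n$ with $|V_n|=n$: sample i.i.d. copies $(\gamma_v)_{v\in V_n}$ of $\gamma$ and, independently, i.i.d. copies $(\xi_v)_{v\in V_n}$ of $\xi$; put $\Delta_n=\sum_v\gamma_v-\sum_v\xi_v$; resample everything until $|\Delta_n|\le n^{1-\kappa+\delta_0}$; then choose $|\Delta_n|$ vertices uniformly without replacement and add $1$ to $\xi_v$ at the chosen vertices if $\Delta_n\ge0$, or to $\gamma_v$ at the chosen vertices if $\Delta_n<0$. The results are the numbers $\widehat{D}_n^-(v)$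 (from $\gamma_v$) of inbound stubs and $\widehat{D}_n^+(v)$ (from $\xi_v$) of outbound stubs, with equal totals. CM and RCM. A Configuration Model (CM) graph is obtained by matching outbound stubs to inbound stubs by a uniformly random bijection, each matched pair giving a directed edge (self-loops and multiple edges possible). In the RCM the matching is repeated until the graph is simple (no self-loops, no multiple edges); an RCM graph on $n$ vertices is thus distributed as a CM graph conditioned on the event that it is simple. Rank correlations of a directed graph $G=(V,E)$. $D^+(v),D^-(v)$ are the out- and in-degree of $v$; for an edge $e$, $\pi_\ast e$ is its source and $\pi^\ast e$ its target; $\pi$ is either projection. Let $U_e,W_e$, $e\in E$, be i.i.d. uniform on $[0,1)$, independent of $G$, and $R^\alpha\pi_\ast e=\sum_{f\in E}\mathbf{1}\{D^\alpha\pi_\ast f+U_f\ge D^\alpha\pi_\ast e+U_e\}$, $R^\beta\pi^\ast e=\sum_{f\in E}\mathbf{1}\{D^\beta\pi^\ast f+W_f\ge D^\beta\pi^\ast e+W_e\}$, $\overline{R}^\alpha\pi e=\frac12+\sum_{f\in E}\left(\mathbf{1}\{D^\alpha\pi f>D^\alpha\pi e\}+\frac12\mathbf{1}\{D^\alpha\pi f=D^\alpha\pi e\}\right)$, and likewise $\overline{R}^\beta\pi e$ with $\beta$ in place of $\alpha$. Then Spearman's rho with ties resolved uniformly at random is $$\rho_\alpha^\beta(G)=\frac{12\sum_{e\in E}R^\alpha\pi_\ast e\,R^\beta\pi^\ast e-3|E|(|E|+1)^2}{|E|^3-|E|},$$ Spearman's rho with average ranks for ties is $$\overline{\rho}_\alpha^\beta(G)=\frac{4\sum_{e\in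 E}\overline{R}^\alpha\pi_\ast e\,\overline{R}^\beta\pi^\ast e-|E|(|E|+1)^2}{\sqrt{4\sum_{e\in E}(\overline{R}^\alpha\pi_\ast e)^2-|E|(|E|+1)^2}\,\sqrt{4\sum_{e\in E}(\overline{R}^\beta\pi^\ast e)^2-|E|(|E|+1)^2}},$$ and Kendall's tau is $\tau_\alpha^\beta(G)=\dfrac{2(\mathcal{N}_C-\mathcal{N}_D)}{|E|(|E|-1)}$, where $\mathcal{N}_C$ (resp. $\mathcal{N}_D$) is the number of unordered pairs $\{e,f\}$ of edges with $(D^\alpha\pi_\ast e-D^\alpha\pi_\ast f)(D^\beta\pi^\ast e-D^\beta\pi^\ast f)>0$ (resp. $<0$). Each quantity is set to $0$ when its denominator vanishes. *)

(* Defs.v *)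
From HB Require Import structures.
From mathcomp Require Import all_boot all_order all_algebra.
From mathcomp Require Import all_classical all_reals all_analysis.

Set Implicit Arguments.
Unset Strict Implicit.
Unset Printing Implicit Defensive.

Import Order.TTheory GRing.Theory Num.Theory.
Import numFieldNormedType.Exports.

Local Open Scope ring_scope.

(* Directed multigraphs: self-loops and parallel edges are allowed. *)
Record digraph (V : finType) := Digraph {
  edge : finType;
  source : edge -> V;
  target : edge -> V }.

Inductive dir := plus | minus.

Section Digraphs.
Variable V : finType.
Implicit Types (H : digraph V) (v : V) (s : dir) (A : {set V * V}).

Definition deg s H v : nat :=
  match s with
  | plus => #|[pred e : edge H | source e == v]|
  | minus => #|[pred e : edge H | target e == v]|
  end.

Definition endpoints H (e : edge H) : V * V := (source e, target e).

Definition arcs H : {set V * V} := [set endpoints e | e : edge H]%SET.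

Definition simple H : bool :=
  [forall e : edge H, source e != target e] && injectiveb (@endpoints H).

(* A simple directed graph is determined by its set of arcs. *)
Definition digraph_of A : digraph V :=
  Digraph (fun e : {e : V * V | e \in A} => (val e).1)
          (fun e : {e : V * V | e \in A} => (val e).2).

End Digraphs.

(* In the three statistics below, a vanishing denominator gives the value 0,
   since x / 0 = 0. *)
Section RankCorrelations.
Variables (R : realType) (V : finType) (H : digraph V).
Variables (alpha beta : dir).
Implicit Types (d : edge H -> nat) (U W : edge H -> R) (e f : edge H).

Let E : R := #|edge H|%:R.

Definition src_deg e : nat := deg alpha H (source e).
Definition tgt_deg e : nat := deg beta H (target e).

Definition tie_rank d U e : R :=
  \sum_(f : edge H) ((d f)%:R + U f >= (d e)%:R + U e)%R%:R.

Definition avg_rank d e : R :=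
  2^-1 + \sum_(f : edge H) ((d e < d f)%N%:R + 2^-1 * (d f == d e)%:R).

Definition spearman U W : R :=
  (12 * (\sum_(e : edge H) tie_rank src_deg U e * tie_rank tgt_deg W e)
     - 3 * E * (E + 1) ^+ 2) / (E ^+ 3 - E).

Definition spearman_avg : R :=
  (4 * (\sum_(e : edge H) avg_rank src_deg e * avg_rank tgt_deg e)
     - E * (E + 1) ^+ 2) /
  (Num.sqrt (4 * (\sum_(e : edge H) avg_rank src_deg e ^+ 2)
               - E * (E + 1) ^+ 2) *
   Num.sqrt (4 * (\sum_(e : edge H) avg_rank tgt_deg e ^+ 2)
               - E * (E + 1) ^+ 2)).

Definition concordance e f : int :=
  ((src_deg e)%:Z - (src_deg f)%:Z) * ((tgt_deg e)%:Z - (tgt_deg f)%:Z).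

(* Unordered pairs are two-element sets; e = f has concordance 0 and hence is
   excluded from both counts. *)
Definition n_concordant : nat :=
  #|[set [set p.1; p.2] | p : edge H * edge H & 0 < concordance p.1 p.2]%SET|.
Definition n_discordant : nat :=
  #|[set [set p.1; p.2] | p : edge H * edge H & concordance p.1 p.2 < 0]%SET|.

Definition kendall : R :=
  2 * (n_concordant%:R - n_discordant%:R) / (E * (E - 1)).

End RankCorrelations.

Section ConfigurationModel.
Variables (R : realType) (V : finType).

(* A bi-degree sequence: first the in-degrees, then the out-degrees. *)
Definition bidegree := ({ffun V -> nat} * {ffun V -> nat})%type.
Implicit Types (D : bidegree) (S : {set V}).

Definition imbalance D : int := (\sum_v D.1 v)%:Z - (\sum_v D.2 v)%:Z.

Definition balance D S : bidegree :=
  if 0 <= imbalance D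
  then (D.1, [ffun v => (D.2 v + (v \in S))%N])
  else ([ffun v => (D.1 v + (v \in S))%N], D.2).

Definition in_stub D : finType := {v : V & 'I_(D.1 v)}.
Definition out_stub D : finType := {v : V & 'I_(D.2 v)}.

Definition matchings D : {set {ffun out_stub D -> in_stub D}} :=
  [set m : {ffun out_stub D -> in_stub D} |
    injectiveb m && [forall s, s \in codom m]]%SET.

(* One edge for each matched pair of stubs, indexed by its outbound stub. *)
Definition matched_graph D (m : {ffun out_stub D -> in_stub D}) : digraph V :=
  Digraph (fun s : out_stub D => tag s) (fun s : out_stub D => tag (m s)).

(* [p] and [q] are the probability mass functions of the in- and out-degree
   variables, and [t] is the acceptance threshold for |imbalance|. *)
Variables (p q : nat -> R) (t : R).

Definition iid_pmf D : R := (\prod_v p (D.1 v)) * (\prod_v q (D.2 v)).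

Definition accepted D : bool := `|imbalance D|%:~R <= t.

Definition accepted_pmf D : R :=
  (accepted D)%:R * iid_pmf D /
  fine (\esum_(D' in [set D' | accepted D']%classic) (iid_pmf D')%:E).

Definition balanced_pmf D : R :=
  fine (\esum_(D' in [set: bidegree]%classic)
    (accepted_pmf D' *
     (#|[set S : {set V} | (#|S| == `|imbalance D'|%N) &&
                           (balance D' S == D)]%SET|%:R
        / 'C(#|V|, `|imbalance D'|%N)%:R))%:E).

Definition cm_prob (B : digraph V -> bool) : R :=
  fine (\esum_(D in [set: bidegree]%classic)
    (balanced_pmf D *
     (#|[set m in matchings D | B (matched_graph m)]%SET|%:R
        / #|matchings D|%:R))%:E).

(* Law of the arc set of the CM graph conditioned on the CM graph being
   simple. *)
Definition rcm_pmf (A : {set V * V}) : R :=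
  cm_prob (fun H => simple H && (arcs H == A)) / cm_prob (@simple V).

End ConfigurationModel.

Section RandomGraphs.
Local Open Scope classical_set_scope.
Context (R : realType) (d : measure_display) (T : measurableType d)
  (P : probability T R).

Definition pmf_nat (X : {RV P >-> nat}) (k : nat) : R :=
  fine (P (X @^-1` [set k])).

(* The random element G of a finite type is measurable and has the probability
   mass function f. *)
Definition has_pmf (X : finType) (G : T -> X) (f : X -> R) : Prop :=
  forall x, measurable (G @^-1` [set x]) /\ P (G @^-1` [set x]) = (f x)%:E.

(* The U i and W i are i.i.d. uniform on [0, 1), and jointly independent of
   the finitely-valued G: the joint law is the product law. *)
Definition iid_uniform_indep (I X : finType) (U W : I -> {RV P >-> R})
    (G : T -> X) : Prop :=
  forall (x : X) (B C : I -> set R),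
    (forall i, measurable (B i)) -> (forall i, measurable (C i)) ->
    P (G @^-1` [set x] `&`
       [set w | forall i, B i (U i w) /\ C i (W i w)]) =
    (P (G @^-1` [set x]) *
     ((\prod_(i : I) lebesgue_measure (B i `&` `[0%R, 1%R[)) *
      (\prod_(i : I) lebesgue_measure (C i `&` `[0%R, 1%R[))))%E.

End RandomGraphs.

Section Asymptotics.
Local Open Scope classical_set_scope.
Variable R : realType.

(* Karamata's notion, for functions on (0, +oo); values of L at other points
   are irrelevant. *)
Definition slowly_varying (L : R -> R) : Prop :=
  [/\ measurable_fun (`]0, +oo[ : set R) L,
      forall x, 0 < x -> 0 < L x &
      forall s, 0 < s -> L (s * x) / L x @[x --> +oo] --> (1 : R)].

(* The variables may live on different probability spaces. *)
Definition tends_to_0_in_probability (d : nat -> measure_display)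
    (T : forall n, measurableType (d n)) (P : forall n, probability (T n) R)
    (X : forall n, T n -> R) : Prop :=
  forall eps : R, 0 < eps ->
    P n [set w | eps < `|X n w|] @[n --> \oo] --> 0%E.

End Asymptotics.

(* Main.v *)
(** Fix a balanced bidegree sequence with E stubs on each side.  Swapping the
    partners of two outbound stubs s and k acts on matchings; if the sum of the
    degrees over any set of at most [max degree] vertices is o(E), then for a
    simple matching and any s all but o(E) choices of k keep it simple.  This one
    fact is used three times.

    (1) Adding the outbound stubs one at a time, it shows that a uniform matching
    is simple with probability bounded below, so that events of small probability
    for the degree sequence stay negligible after conditioning on simplicity.

    (2) Let Y(m) = sum_s a(s) b(m(s)) with a centered.  A swap changes Y by
    -(a(s) - a(k)) (b(m s) - b(m k)), while the sum over all s, k of the latter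
    products is 2 E Y(m).  Hence E[Y^2] = o(sum a^2 * sum b^2) over simple
    matchings.  Both versions of Spearman's rho are such bilinear forms in the
    centered ranks; the L2 normalization of the bound matters for average ranks,
    whose variance may degenerate.

    (3) Kendall's tau is a double sum of products of two antisymmetric kernels, and
    a swap changes the sign of the corresponding summand.

    The hypotheses on the degree sequence hold with high probability by Markov's
    inequality for the sum of squares and for the variance of the sum. *)

Require Import Defs.
From HB Require Import structures.
From mathcomp Require Import all_boot all_order all_algebra.
From mathcomp Require Import all_classical all_reals all_analysis.
From mathcomp Require Import perm finmap measurable_realfun ring lra zify.

Set Implicit Arguments.
Unset Strict Implicit.
Unset Printing Implicit Defensive.

Import Order.TTheory GRing.Theory Num.Theory.
Import numFieldNormedType.Exports.

Local Open Scope classical_set_scope.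
Local Open Scope ring_scope.

(** * Switching stubs in matchings *)

(** Conditioning on simplicity destroys the exact uniformity of a matching; swaps that keep it
    simple restore near-uniformity of a single partner and cancellation in second moments, up to a
    relative error of order B / E. Only bounds on the degree sequence enter, never a limit of the
    empirical degrees: at least c n edges, sums of squares at most C n, all degrees at most delta n.
    The degree sum over [Delta] vertices is then at most K delta n + C n / K, where K is taken large
    first and delta small afterwards. Markov's inequality bounds the probability that a sum of
    squares exceeds C n only by a multiple of 1 / C. Tameness is therefore used with two sets of
    constants: one that holds with probability at least 1/2 and fixes a lower bound for the
    probability of simplicity, then one whose exceptional probability is small compared with that
    bound. The continuous marks that break ties are replaced by the indices of small cells of [0,
    1), so that they too are handled by counting. *)

Section Switching.
Local Open Scope nat_scope.
Local Open Scope set_scope.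
Variables (V S T : finType) (u : S -> V) (v : T -> V).
Implicit Types (m : {ffun S -> T}) (s k i j : S) (t : T) (J : {set S}).
Implicit Types (X : {set V}) (x y : V).

Definition bijections : {set {ffun S -> T}} :=
  [set m : {ffun S -> T} | injectiveb m && [forall t, t \in codom m]]%SET.

Definition outdeg x := #|[pred s | u s == x]|.
Definition indeg x := #|[pred t | v t == x]|.

Definition swap m s k : {ffun S -> T} := [ffun x => m (tperm s k x)].

Lemma swapK s k : involutive (fun m => swap m s k).
Proof. by move=> m; apply/ffunP => x; rewrite !ffunE tpermK. Qed.

Lemma swapC m s k : swap m s k = swap m k s.
Proof. by apply/ffunP => x; rewrite !ffunE tpermC. Qed.

Lemma swapL m s k : swap m s k s = m k.
Proof. by rewrite ffunE tpermL. Qed.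

Lemma swapR m s k : swap m s k k = m s.
Proof. by rewrite ffunE tpermR. Qed.

Lemma swapD m s k i : i != s -> i != k -> swap m s k i = m i.
Proof. by move=> si ki; rewrite ffunE tpermD// eq_sym. Qed.

Lemma bijections_inj m : m \in bijections -> injective m.
Proof. by rewrite inE => /andP[/injectiveP]. Qed.

Lemma bijections_surj m t : m \in bijections -> exists s, m s = t.
Proof.
by rewrite inE => /andP[_ /forallP/(_ t)/codomP[s ->]]; exists s.
Qed.

Lemma swap_bij m s k : (swap m s k \in bijections) = (m \in bijections).
Proof.
have H m' : m' \in bijections -> swap m' s k \in bijections.
  move=> mb; rewrite inE; apply/andP; split.
    by apply/injectiveP => i j; rewrite !ffunE => /(bijections_inj mb)/perm_inj.
  apply/forallP => t; have [i <-] := bijections_surj t mb.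
  by apply/codomP; exists (tperm s k i); rewrite ffunE tpermK.
by apply/idP/idP => /H; rewrite ?swapK.
Qed.

Lemma bijections_bij m : m \in bijections -> bijective m.
Proof.
move=> mb; have inj := bijections_inj mb.
apply: (inj_card_bij (inj)).
rewrite -(fintype.card_codom inj) subset_leq_card//; apply/fintype.subsetP => t _.
by move: mb; rewrite inE => /andP[_ /forallP].
Qed.

(** The diagonal case is a self-loop at the stub [i], the other case a pair of parallel edges, so
    that simplicity becomes a single condition on pairs of stubs. *)
Definition conflict m i j :=
  if i == j then u i == v (m i) else (u i == u j) && (v (m i) == v (m j)).

Lemma conflictC m i j : conflict m i j = conflict m j i.
Proof.
rewrite /conflict [j == i]eq_sym; case: eqP => [->//|_].
by rewrite eq_sym [v _ == _]eq_sym.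
Qed.

(** Interpolates between all matchings (empty [J]) and the simple ones (full [J]), which lets stubs
    be added one at a time. *)
Definition simple_on J : {set {ffun S -> T}} :=
  [set m in bijections | [forall i in J, forall j in J, ~~ conflict m i j]]%SET.

Lemma simple_onP J m :
  reflect (m \in bijections /\ {in J &, forall i j, ~~ conflict m i j})
          (m \in simple_on J).
Proof.
rewrite [m \in simple_on J]inE; apply: (iffP andP) => -[mb H]; split=> //.
  by move=> i j iJ jJ; move/forall_inP/(_ i iJ)/forall_inP/(_ j jJ): H.
by apply/forall_inP => i iJ; apply/forall_inP => j jJ; apply: H.
Qed.

Lemma simple_on0 : simple_on finset.set0 = bijections.
Proof.
apply/finset.setP => m; apply/simple_onP/idP => [[]//|mb]; split=> // i j.
by rewrite inE.
Qed.

Lemma simple_on_sub J J' : J \subset J' -> simple_on J' \subset simple_on J.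
Proof.
move=> /fintype.subsetP JJ; apply/fintype.subsetP => m /simple_onP[mb H].
by apply/simple_onP; split=> // i j /JJ ? /JJ ?; apply: H.
Qed.

Lemma card_bij_preim m X : m \in bijections ->
  #|[set k | v (m k) \in X]| = \sum_(x in X) indeg x.
Proof.
move=> mb.
have -> : #|[set k | v (m k) \in X]| = #|[set t | v t \in X]|.
  rewrite -(card_imset _ (bijections_inj mb)); apply: eq_card => t.
  rewrite inE; apply/imsetP/idP => [[s]|tX]; first by rewrite inE => H ->.
  by have [s st] := bijections_surj t mb; exists s; rewrite ?inE st.
rewrite -sum1_card (eq_bigl (fun t => v t \in X)); last by move=> t; rewrite inE.
rewrite (partition_big v (mem X))//=; apply: eq_bigr => x xX.
rewrite /indeg -sum1_card; apply: eq_bigl => t; rewrite inE.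
by case: eqP => [->|]; rewrite ?andbF// xX.
Qed.

Lemma card_src_preim X : #|[set k | u k \in X]| = \sum_(x in X) outdeg x.
Proof.
rewrite -sum1_card (eq_bigl (fun k => u k \in X)); last by move=> k; rewrite inE.
rewrite (partition_big u (mem X))//=; apply: eq_bigr => x xX.
rewrite /outdeg -sum1_card; apply: eq_bigl => k; rewrite inE.
by case: eqP => [->|]; rewrite ?andbF// xX.
Qed.

Lemma card_fiber_bij m y : m \in bijections ->
  #|[set i | v (m i) == y]| = indeg y.
Proof.
move=> mb; rewrite -(big_set1 addn y indeg) -(card_bij_preim _ mb).
by apply: eq_card => i; rewrite !inE.
Qed.

Definition bad J m s := [set k | swap m s k \notin simple_on (s |: J)].

Variables (Delta B0 : nat).
Hypotheses (outdegD : forall x, outdeg x <= Delta)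
  (indegD : forall x, indeg x <= Delta)
  (outdegB : forall X, #|X| <= Delta -> \sum_(x in X) outdeg x <= B0)
  (indegB : forall X, #|X| <= Delta -> \sum_(x in X) indeg x <= B0).

Let Delta_gt0 s : 0 < Delta.
Proof.
by apply: leq_trans (outdegD (u s)); apply/card_gt0P; exists s; rewrite inE.
Qed.

(** The swap creates edges from [u s] to [v (m k)] and from [u k] to [v (m s)]. [A1] and [A3]
    contain the [k] that give a loop, [A2] and [A4] those that may give an edge parallel to an old
    one, and [A5] excludes [u k = u s], which keeps the two new edges from being parallel. Each set
    lies over at most [Delta] vertices, hence has at most [B0] elements. *)
Lemma card_bad J m s : m \in simple_on J -> #|bad J m s| <= 5 * B0.
Proof.
move=> /simple_onP[mb mJ].
pose N := [set v (m i) | i in [set i | u i == u s]].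
pose N' := [set u i | i in [set i | v (m i) == v (m s)]].
pose A1 := [set k | v (m k) \in [set u s]].
pose A2 := [set k | v (m k) \in N].
pose A3 := [set k | u k \in [set v (m s)]].
pose A4 := [set k | u k \in N'].
pose A5 := [set k | u k \in [set u s]].
have sub : bad J m s \subset A1 :|: A2 :|: A3 :|: A4 :|: A5.
  apply/fintype.subsetP => k; rewrite inE; apply: contraNT;
    rewrite !finset.in_setU !negb_or.
  rewrite ![_ \in A1]inE ![_ \in A2]inE ![_ \in A3]inE ![_ \in A4]inE.
  rewrite ![_ \in A5]inE !finset.in_set1 -!andbA => /and5P[h1 h2 h3 h4 h5].
  have ks : k != s by apply: contraNneq h5 => ->.
  have sk : s != k by rewrite eq_sym.
  have Nk i : u i == u s -> (v (m k) == v (m i)) = false.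
    move=> ui; apply: contraNF h2 => /eqP ->.
    by apply/imsetP; exists i => //; rewrite inE.
  have Nk' i : v (m i) == v (m s) -> (u k == u i) = false.
    move=> ui; apply: contraNF h4 => /eqP ->.
    by apply/imsetP; exists i => //; rewrite inE.
  apply/simple_onP; split; first by rewrite swap_bij.
  have cs j : ~~ conflict (swap m s k) s j.
    rewrite /conflict; case: (eqVneq s j) => [_|sj].
      by rewrite swapL eq_sym.
    rewrite swapL; case: (eqVneq j k) => [->|jk].
      by rewrite eq_sym (negPf h5).
    rewrite swapD//; last by rewrite eq_sym.
    case: (boolP (u s == u j)) => //= uj.
    by rewrite Nk// eq_sym.
  have ck j : ~~ conflict (swap m s k) k j.
    case: (eqVneq j s) => [->|js]; first by rewrite conflictC.
    rewrite /conflict; case: (eqVneq k j) => [_|kj]; first by rewrite swapR.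
    rewrite swapR swapD//; last by rewrite eq_sym.
    case: (boolP (v (m s) == v (m j))) => [vj|]; last by rewrite andbF.
    by rewrite Nk'// eq_sym.
  move=> i j; case: (eqVneq i s) => [->//|si]; case: (eqVneq i k) => [->//|ki].
  case: (eqVneq j s) => [->|sj]; first by rewrite conflictC.
  case: (eqVneq j k) => [->|kj]; first by rewrite conflictC.
  rewrite !finset.in_setU1 (negPf si) (negPf sj) => /= iJ jJ.
  by have := mJ _ _ iJ jJ; rewrite /conflict !swapD.
apply: leq_trans (subset_leq_card sub) _.
have le1 x : #|[set x]| <= Delta by rewrite cards1; exact: Delta_gt0 s.
have h1 : #|A1| <= B0 by rewrite card_bij_preim// indegB.
have h2 : #|A2| <= B0.
  rewrite card_bij_preim// indegB//; apply: leq_trans (leq_imset_card _ _) _.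
  rewrite (leq_trans _ (outdegD (u s)))// subset_leq_card//.
  by apply/fintype.subsetP => i; rewrite !inE.
have h3 : #|A3| <= B0 by rewrite card_src_preim outdegB.
have h4 : #|A4| <= B0.
  rewrite card_src_preim outdegB//; apply: leq_trans (leq_imset_card _ _) _.
  by rewrite card_fiber_bij.
have h5 : #|A5| <= B0 by rewrite card_src_preim outdegB.
have cU (A B : {set S}) a b : #|A| <= a -> #|B| <= b -> #|A :|: B| <= a + b.
  move=> ha hb; apply: leq_trans (leq_add ha hb).
  by rewrite cardsU leq_subr.
have -> : 5 * B0 = B0 + B0 + B0 + B0 + B0 by lia.
by do 4! apply: (cU) => //.
Qed.

End Switching.

Section SwitchingCounts.
Local Open Scope nat_scope.
Local Open Scope set_scope.
Variables (V S T : finType) (u : S -> V) (v : T -> V).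
Implicit Types (m : {ffun S -> T}) (s k i j : S) (t : T) (J : {set S}).

Variables (Delta B0 : nat).
Hypotheses (outdegD : forall x, outdeg u x <= Delta)
  (indegD : forall x, indeg v x <= Delta)
  (outdegB : forall X : {set V}, #|X| <= Delta -> \sum_(x in X) outdeg u x <= B0)
  (indegB : forall X : {set V}, #|X| <= Delta -> \sum_(x in X) indeg v x <= B0).

Notation "'bij" := (@bijections S T).
Notation simp := (simple_on u v).
Let E := #|S|.
Let B := 5 * B0.

Lemma sum_bijective m (F : T -> nat) : m \in 'bij ->
  \sum_s F (m s) = \sum_t F t.
Proof.
by move=> /bijections_bij bm; rewrite [RHS](reindex m (onW_bij _ bm)).
Qed.

Lemma card_good J m s : m \in simp J ->
  E - B <= #|[set k | swap m s k \in simp (s |: J)]|.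
Proof.
move=> mJ; rewrite leq_subLR /E.
have -> : [set k | swap m s k \in simp (s |: J)] = ~: bad u v J m s.
  by apply/finset.setP => k; rewrite !inE negbK.
rewrite /E -(cardsC (bad u v J m s)) leq_add2r.
exact: (card_bad outdegD).
Qed.

(** Double counting of the pairs of a matching in [A] and a good [k]: a swap is an involution, so
    the pairs can be listed from the swapped matching instead. *)
Lemma sum_good J (A : {set {ffun S -> T}}) s : A \subset simp J ->
  (E - B) * #|A| <=
  \sum_k #|[set m | (swap m s k \in A) && (m \in simp (s |: J))]|.
Proof.
move=> /fintype.subsetP AJ.
rewrite mulnC -sum_nat_const.
apply: (@leq_trans (\sum_(m in A) \sum_k (swap m s k \in simp (s |: J) : nat))).
  apply: leq_sum => m mA; apply: leq_trans (card_good s (AJ _ mA)) _.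
  by rewrite -sum1dep_card big_mkcond.
rewrite exchange_big /=; apply: leq_sum => k _.
rewrite -sum1dep_card -big_mkcondr/=.
rewrite (reindex_inj (can_inj (swapK s k)))/=.
by under eq_bigl => m do rewrite swapK.
Qed.

(** A swap moves the prescribed partner [t] from [s] to [k], and a given matching has exactly one
    [k] with [m k = t], so it is reached at most once. Thus the partner of [s] is nearly uniform. *)
Lemma card_prescribed J s t :
  (E - B) * #|[set m in simp J | m s == t]| <= #|simp J|.
Proof.
have sub : [set m in simp J | m s == t] \subset simp J.
  by apply/fintype.subsetP => m; rewrite inE => /andP[].
apply: leq_trans (sum_good s sub) _.
apply: (@leq_trans (\sum_k \sum_(m in simp J) (m k == t : nat))).
  apply: leq_sum => k _; rewrite -big_mkcondr sum1dep_card subset_leq_card//.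
  apply/fintype.subsetP => m; rewrite 2!finset.in_set [in X in _ ->
    X]finset.in_set swapL.
  move=> /andP[/andP[_ ->]]; rewrite andbT.
  exact: (fintype.subsetP (simple_on_sub _ _ (finset.subsetU1 s J))).
rewrite exchange_big/= -sum1_card; apply: leq_sum => m /simple_onP[mb _].
rewrite (sum_bijective (fun t' => t' == t) mb) (bigD1 t)//= eqxx big1//.
by move=> t' /negPf ->.
Qed.

Lemma sum_prescribed J s (F : T -> nat) :
  (E - B) * \sum_(m in simp J) F (m s) <= (\sum_t F t) * #|simp J|.
Proof.
rewrite (partition_big (fun m => m s) predT)//= big_distrr big_distrl/=.
apply: leq_sum => t _.
rewrite (eq_bigr (fun=> F t)); last by move=> m /andP[_ /eqP ->].
rewrite sum_nat_cond_const mulnA [leqLHS]mulnC leq_mul2l.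
apply/orP; right; apply: leq_trans (card_prescribed J s t).
by rewrite leq_mul2l subset_leq_card ?orbT//; apply/fintype.subsetP => m;
  rewrite !inE.
Qed.

Let Qm := \sum_x indeg v x ^ 2.

Lemma sum_indeg_sq : \sum_t indeg v (v t) = Qm.
Proof.
rewrite (partition_big v predT)//=; apply: eq_bigr => x _.
rewrite (eq_bigr (fun=> indeg v x)); last by move=> t /eqP ->.
rewrite sum_nat_cond_const -mulnn; congr (_ * _)%N.
by apply: eq_card => t; rewrite inE.
Qed.

(* A matching that is simple on [J] but not on [s |: J] is repaired by most swaps
   at [s]; conversely such a swap damages a repaired matching only if the new
   partner of [s] sits at [u s] or at a vertex already joined to [u s]. *)
Lemma simple_on_step J s :
  (E - B) ^ 2 * #|simp J :\: simp (s |: J)| <=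
  #|simp (s |: J)| * ((E - B) * indeg v (u s) + outdeg u (u s) * Qm).
Proof.
set A := simp J :\: _; set J' := s |: J.
have sub : A \subset simp J by exact: finset.subsetDl.
have h m k : swap m s k \in A -> m \in simp J' ->
    (v (m k) == u s) || [exists i, (u i == u s) && (v (m k) == v (m i))].
  move=> + /simple_onP[mb mJ].
  rewrite inE => /andP[+ /simple_onP[_ mJ0]].
  apply: contraR; rewrite negb_or => /andP[h1 /existsPn h2].
  have h3 i : u i == u s -> v (m k) != v (m i).
    by move=> ui; have := h2 i; rewrite ui.
  have ks : k != s by apply: contraNneq (h3 s (eqxx _)) => ->.
  apply/simple_onP; split; first by rewrite swap_bij.
  have cs j : j \in J' -> ~~ conflict u v (swap m s k) s j.
    rewrite /conflict; case: (eqVneq s j) => [_ _|sj jJ].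
      by rewrite swapL eq_sym.
    rewrite swapL; case: (eqVneq j k) => [jk|jk].
      rewrite jk swapR; case: (boolP (u s == u k)) => //= usk.
      exact: h3.
    rewrite swapD//; last by rewrite eq_sym.
    case: (boolP (u s == u j)) => //= uj.
    by rewrite h3// eq_sym.
  move=> i j; case: (eqVneq i s) => [->_|si]; first exact: cs.
  case: (eqVneq j s) => [->|sj]; first by move=> iJ _; rewrite conflictC cs.
  by rewrite !finset.in_setU1 (negPf si) (negPf sj)/=; exact: mJ0.
apply: (@leq_trans ((E - B) * \sum_(m in simp J') (indeg v (u s) +
   \sum_(i | u i == u s) indeg v (v (m i))))).
  rewrite expnS expn1 -mulnA leq_mul2l; apply/orP; right.
  apply: leq_trans (sum_good s sub) _.
  rewrite (eq_bigr (fun k => \sum_(m in simp J') (swap m s k \in A : nat))).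
    rewrite exchange_big/=; apply: leq_sum => m mJ'.
    have mb : m \in 'bij by case/simple_onP: (mJ').
    apply: (@leq_trans (\sum_k ((v (m k) == u s) +
        \sum_(i | u i == u s) (v (m k) == v (m i))))).
      apply: leq_sum => k _; case: (boolP (swap m s k \in A)) => //= kA.
      have /orP[->//|/existsP[i /andP[ui ki]]] := h _ _ kA mJ'.
      by rewrite (bigD1 i)//= ki addnCA.
    rewrite big_split/= exchange_big/=; apply: leq_add.
      rewrite (sum_bijective (fun t => v t == u s) mb) /indeg -sum1_card.
      rewrite [leqRHS]big_mkcond; apply: leq_sum => t _.
      by rewrite inE; case: eqP.
    apply: leq_sum => i _.
    rewrite (sum_bijective (fun t => v t == v (m i)) mb) /indeg -sum1_card.
    rewrite [leqRHS]big_mkcond; apply: leq_sum => t _.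
    by rewrite inE; case: eqP.
  by move=> k _; rewrite -big_mkcondr/= sum1dep_card; apply: eq_card => m;
    rewrite !inE andbC.
rewrite big_split/= sum_nat_const mulnDr mulnDr.
apply: leq_add; first by rewrite mulnCA.
rewrite exchange_big/= big_distrr/=.
have -> : outdeg u (u s) = \sum_(i | u i == u s) 1 by rewrite sum1_card.
rewrite big_distrl big_distrr/=.
(* Since the partner of [i] is nearly uniform, the mean in-degree at the other end of its edge is at
   most [Qm] over [E - B]. *)
apply: leq_sum => i _; rewrite mul1n -sum_indeg_sq [leqRHS]mulnC.
exact: (sum_prescribed J' i (fun t => indeg v (v t))).
Qed.

End SwitchingCounts.

(** * Lower bound for the proportion of simple matchings *)

Section SwitchingEstimates.
Local Open Scope set_scope.
Local Open Scope ring_scope.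
Variables (R : realType) (V S T : finType) (u : S -> V) (v : T -> V).
Implicit Types (m : {ffun S -> T}) (s k i j : S) (t : T) (J : {set S}).

Variables (Delta B0 : nat).
Hypotheses (outdegD : forall x, (outdeg u x <= Delta)%N)
  (indegD : forall x, (indeg v x <= Delta)%N)
  (outdegB : forall X : {set V}, (#|X| <= Delta)%N ->
     (\sum_(x in X) outdeg u x <= B0)%N)
  (indegB : forall X : {set V}, (#|X| <= Delta)%N ->
     (\sum_(x in X) indeg v x <= B0)%N).

Notation "'bij" := (@bijections S T).
Notation simp := (simple_on u v).
Let B := (5 * B0)%N.
Let E : R := #|S|%:R.
Hypotheses (S_gt0 : (0 < #|S|)%N) (B_le : (2 * B <= #|S|)%N).

Let E_gt0 : 0 < E. Proof. by rewrite ltr0n. Qed.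
Let F : R := (#|S| - B)%:R.
Let F_ge : E / 2 <= F.
Proof.
rewrite ler_pdivrMr// -natrM ler_nat mulnBl -/B; move: B_le; lia.
Qed.
Let F_gt0 : 0 < F. Proof. by apply: lt_le_trans F_ge; rewrite divr_gt0. Qed.

Let Qm : R := \sum_x (indeg v x)%:R ^+ 2.
Let Qp : R := \sum_x (outdeg u x)%:R ^+ 2.

Let Qm_ge0 : 0 <= Qm. Proof. by apply: sumr_ge0 => x _; rewrite sqr_ge0. Qed.

(** Replacing the denominator [E - B] of [simple_on_step] by the smaller E / 2 costs the factors 2
    and 4. *)
Lemma card_simple_on_step J s :
  #|simp J|%:R <= (1 + (2 / E * (indeg v (u s))%:R +
     4 / E ^+ 2 * Qm * (outdeg u (u s))%:R)) * #|simp (s |: J)|%:R :> R.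
Proof.
have -> : #|simp J|%:R = #|simp J :\: simp (s |: J)|%:R + #|simp (s |: J)|%:R :> R.
  rewrite -natrD -(cardsID (simp (s |: J)) (simp J)) addnC.
  congr (_ + _)%:R; apply: eq_card => m; rewrite finset.in_setI.
  case: (boolP (m \in simp (s |: J))) => mJ; rewrite ?andbF// andbT.
  by rewrite (fintype.subsetP (simple_on_sub _ _ (finset.subsetU1 s J))).
rewrite [leRHS]mulrDl mul1r [leRHS]addrC lerD2r.
set a := #|_ :\: _|%:R; set b := #|simp _|%:R; set i := (indeg _ _)%:R;
  set o := (outdeg _ _)%:R.
have H : F ^+ 2 * a <= b * (F * i + o * Qm).
  have := simple_on_step outdegD indegD outdegB indegB J s.
  rewrite -(ler_nat R) [in X in X <= _]natrM natrX.
  rewrite [in X in _ <= X]natrM natrD 2!natrM natr_sum.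
  by under eq_bigr do rewrite natrX.
have b0 : 0 <= b by rewrite ler0n.
have i0 : 0 <= i by rewrite ler0n.
have o0 : 0 <= o by rewrite ler0n.
have {H} : a <= b * (i / F + o * Qm / F ^+ 2).
  rewrite -(ler_pM2l (exprn_gt0 2 F_gt0)); apply: le_trans H _.
  by rewrite le_eqVlt; apply/orP; left; apply/eqP; field; rewrite gt_eqF.
move=> /le_trans; apply; rewrite mulrC ler_wpM2r//.
have FV : F^-1 <= 2 / E.
  by rewrite -[2 / E]invf_div lef_pV2 ?posrE ?divr_gt0.
have -> : 2 / E * i + 4 / E ^+ 2 * Qm * o = i * (2 / E) + o * Qm * (2 / E) ^+ 2.
  by field; rewrite gt_eqF.
apply: lerD; first by rewrite ler_wpM2l.
by rewrite ler_wpM2l ?mulr_ge0// -exprVn ler_sqr// nnegrE ?invr_ge0 ?divr_ge0// ltW.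
Qed.

(** The steps multiply to a product of factors 1 + [w s], at most the exponential of the sum of the
    [w s]. That sum is controlled by second moments: the out-degrees of the sources add up to [Qp],
    the in-degrees of the sources to a sum of products of in- and out-degrees, at most (Qp + Qm) /
    2. With finite second moments the exponent stays bounded. *)
Lemma card_bijections_le :
  #|'bij|%:R <= expR ((Qp + Qm) / E +
    4 * Qp * Qm / E ^+ 2) * #|simp [set: S]%SET|%:R.
Proof.
pose w s : R := 2 / E * (indeg v (u s))%:R + 4 / E ^+ 2 * Qm * (outdeg u (u s))%:R.
have w0 s : 0 <= w s by rewrite addr_ge0 ?mulr_ge0 ?mulr_ge0 ?mulr_ge0 ?invr_ge0
  ?exprn_ge0 ?ler0n ?(ltW E_gt0).
have H r : #|'bij|%:R <= \prod_(s <- r) (1 + w s) * #|simp [set s in r]%SET|%:R.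
  elim: r => [|s r IH].
    have -> : [set s in ([::] : seq S)]%SET = finset.set0.
      by apply/finset.setP => s; rewrite !inE.
    by rewrite big_nil mul1r simple_on0.
  apply: le_trans IH _; rewrite big_cons [(1 + w s) * _]mulrC -mulrA ler_wpM2l//.
    by apply: prodr_ge0 => i _; rewrite addr_ge0.
  apply: le_trans (card_simple_on_step _ s) _.
  rewrite -/(w s) (ler_wpM2l (addr_ge0 ler01 (w0 s)))// ler_nat subset_leq_card//.
  apply: simple_on_sub; apply/fintype.subsetP => i.
  by rewrite !inE.
apply: le_trans (H (enum S)) _.
rewrite (_ : [set s in enum S]%SET = [set: S]%SET); last first.
  by apply/finset.setP => s; rewrite !inE mem_enum.
rewrite ler_wpM2r// (@le_trans _ _ (\prod_(s <- enum S) expR (w s)))//.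
  rewrite ler_prod// => s _; rewrite expR_ge1Dx addr_ge0//.
rewrite -expR_sum ler_expR big_enum/= big_split/= -!mulr_sumr.
have -> : \sum_s (outdeg u (u s))%:R = Qp.
  rewrite (partition_big u predT)//=; apply: eq_bigr => x _.
  rewrite (eq_bigr (fun=> (outdeg u x)%:R)); last by move=> s /eqP ->.
  by rewrite sumr_const -[LHS]mulr_natr.
have : 2 * \sum_s (indeg v (u s))%:R <= Qp + Qm.
  rewrite (partition_big u predT)//= mulr_sumr -big_split/=; apply: ler_sum => x _.
  rewrite (eq_bigr (fun=> (indeg v x)%:R)); last by move=> s /eqP ->.
  rewrite sumr_const -mulr_natr -/(outdeg u x).
  by have := sqr_ge0 ((outdeg u x)%:R - (indeg v x)%:R : R); nra.
move=> h; apply: lerD; last first.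
  by rewrite le_eqVlt; apply/orP; left; apply/eqP; field; rewrite gt_eqF.
by rewrite mulrAC ler_wpM2r// invr_ge0 ltW.
Qed.

Notation Sim := (simp [set: S]%SET).

Lemma sum_prescribed_le s (f : T -> R) : (forall t, 0 <= f t) ->
  \sum_(m in Sim) f (m s) <= 2 / E * (\sum_t f t) * #|Sim|%:R.
Proof.
move=> f0; rewrite (partition_big (fun m => m s) predT)//= mulr_sumr mulr_suml.
apply: ler_sum => t _.
rewrite (eq_bigr (fun=> f t)); last by move=> m /andP[_ /eqP ->].
rewrite sumr_const -[leLHS]mulr_natr [2 / E * _]mulrC -mulrA ler_wpM2l//.
have := card_prescribed outdegD indegD outdegB indegB [set: S]%SET s t.
rewrite -(ler_nat R) natrM -/F -/B => h.
rewrite -(ler_pM2l F_gt0) [leRHS]mulrA.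
set c := #|Sim|%:R in h *.
have c0 : 0 <= c by [].
have hF : 1 <= F * (2 / E).
  rewrite mulrA ler_pdivlMr// mul1r; move: F_ge; rewrite ler_pdivrMr//.
apply: le_trans (ler_peMl c0 hF).
apply: le_trans h; rewrite ler_pM2l// ler_nat.
rewrite subset_leq_card//; apply/fintype.subsetP => m.
by rewrite [in X in _ -> X]finset.in_set.
Qed.

End SwitchingEstimates.

(** Lagrange's identity: the double sum of the squares of x_i y_j - x_j y_i is twice the difference
    of the two sides. *)
Lemma sum_Cauchy_Schwarz (R : realDomainType) (I : finType) (P : pred I)
    (x y : I -> R) :
  (\sum_(i | P i) x i * y i) ^+ 2 <=
  (\sum_(i | P i) x i ^+ 2) * (\sum_(i | P i) y i ^+ 2).
Proof.
have : 0 <= \sum_(i | P i) \sum_(j | P j) (x i * y j - x j * y i) ^+ 2.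
  by apply: sumr_ge0 => i _; apply: sumr_ge0 => j _; exact: sqr_ge0.
set X := \sum_(i | P i) x i ^+ 2; set Y := \sum_(i | P i) y i ^+ 2.
set Z := \sum_(i | P i) x i * y i.
have -> : \sum_(i | P i) \sum_(j | P j) (x i * y j - x j * y i) ^+ 2 =
    \sum_(i | P i) (x i ^+ 2 * Y + y i ^+ 2 * X - 2 * (x i * y i) * Z).
  apply: eq_bigr => i _; rewrite !mulr_sumr -big_split -sumrB/=.
  by apply: eq_bigr => j _; ring.
rewrite sumrB big_split/= -!mulr_suml -mulr_sumr -/X -/Y -/Z => h.
nra.
Qed.

(** * Second moments of bilinear forms and kernel sums over simple matchings *)

Section SwitchingVariance.
Local Open Scope set_scope.
Local Open Scope ring_scope.
Variables (R : realType) (V S T : finType) (u : S -> V) (v : T -> V).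
Implicit Types (m : {ffun S -> T}) (s k i j : S) (t : T) (J : {set S}).

Variables (Delta B0 : nat).
Hypotheses (outdegD : forall x, (outdeg u x <= Delta)%N)
  (indegD : forall x, (indeg v x <= Delta)%N)
  (outdegB : forall X : {set V}, (#|X| <= Delta)%N ->
     (\sum_(x in X) outdeg u x <= B0)%N)
  (indegB : forall X : {set V}, (#|X| <= Delta)%N ->
     (\sum_(x in X) indeg v x <= B0)%N).

Notation Sim := (simple_on u v [set: S]%SET).
Let B : R := (5 * B0)%:R.
Let E : R := #|S|%:R.
Hypotheses (S_gt0 : (0 < #|S|)%N) (B0_gt0 : (0 < B0)%N)
  (B_le : (2 * (5 * B0) <= #|S|)%N).

Let E_gt0 : 0 < E. Proof. by rewrite ltr0n. Qed.
Let B_gt0 : 0 < B. Proof. by rewrite ltr0n muln_gt0. Qed.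

Lemma sum_bijection m (f : T -> R) : m \in Sim -> \sum_s f (m s) = \sum_t f t.
Proof.
move=> /simple_onP[/bijections_bij bm _].
by rewrite [RHS](reindex m (onW_bij _ bm)).
Qed.

(** Being a bad pair is symmetric and each stub has at most [B] bad partners, so after (x - y)^2 <=
    2 x^2 + 2 y^2 each square is counted at most [B] times in either coordinate. *)
Lemma sum_bad_sqr m (f : S -> R) : m \in Sim ->
  \sum_(p : S * S | swap m p.1 p.2 \notin Sim) (f p.1 - f p.2) ^+ 2 <=
  4 * B * \sum_s f s ^+ 2.
Proof.
move=> mS.
have h : \sum_(p : S * S | swap m p.1 p.2 \notin Sim) f p.1 ^+ 2 <=
  B * \sum_s f s ^+ 2.
  rewrite -(pair_big_dep predT (fun s k => swap m s k \notin Sim)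
    (fun s k => f s ^+ 2))/= mulr_sumr; apply: ler_sum => s _.
  rewrite sumr_const -mulr_natl ler_wpM2r ?sqr_ge0// ler_nat.
  apply: leq_trans (card_bad outdegD indegD outdegB indegB s mS).
  rewrite subset_leq_card//; apply/fintype.subsetP => k.
  by rewrite [in X in _ -> X]finset.in_set finset.setUT.
have h' : \sum_(p : S * S | swap m p.1 p.2 \notin Sim) f p.2 ^+ 2 <=
  B * \sum_s f s ^+ 2.
  rewrite (reindex_inj (h := fun p : S * S => (p.2, p.1)))/=.
    by under eq_bigl => p do rewrite swapC.
  by move=> [? ?] [? ?] [-> ->].
apply: (@le_trans _ _ (\sum_(p : S * S | swap m p.1 p.2 \notin Sim)
    (2 * f p.1 ^+ 2 + 2 * f p.2 ^+ 2))).
  apply: ler_sum => p _; have := sqr_ge0 (f p.1 + f p.2); nra.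
by rewrite big_split/= -!mulr_sumr; nra.
Qed.

Section Bilinear.
Variables (a : S -> R) (b : T -> R).
Hypothesis a0 : \sum_s a s = 0.
Let Y m := \sum_s a s * b (m s).
Let da s k := a s - a k.
Let db m s k := b (m s) - b (m k).

Lemma bilinear_swap m s k : Y (swap m s k) = Y m - da s k * db m s k.
Proof.
apply/eqP; rewrite eq_sym subr_eq addrC -subr_eq; apply/eqP.
rewrite /Y -sumrB; case: (eqVneq s k) => [<-|sk].
  rewrite /da subrr mul0r big1// => i _.
  by rewrite ffunE tperm1 perm1 subrr.
rewrite (bigD1 s)//= (bigD1 k)/=; last by rewrite eq_sym.
rewrite big1; last by move=> i /andP[h1 h2]; rewrite swapD// subrr.
by rewrite swapL swapR /da /db; ring.
Qed.

(** Exchanging a matching with its swap preserves the range of summation, negates the product of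
    [da] and [db], and lowers [Y] by that product. Adding the sum to its reindexed copy leaves only
    squares. *)
Lemma sum_good_bilinear s k :
  2 * \sum_(m in Sim | swap m s k \in Sim) da s k * db m s k * Y m =
  \sum_(m in Sim | swap m s k \in Sim) (da s k * db m s k) ^+ 2.
Proof.
rewrite mulrDl mul1r; set X := \sum_(m in _ | _) _.
rewrite {1}/X (reindex_inj (can_inj (swapK s k)))/=.
rewrite (eq_bigl (fun m => (m \in Sim) && (swap m s k \in Sim))); last first.
  by move=> m; rewrite swapK andbC.
rewrite -big_split/=; apply: eq_bigr => m _.
by rewrite bilinear_swap /db swapL swapR; ring.
Qed.

Lemma sum_pairs_bilinear m : m \in Sim ->
  \sum_s \sum_k da s k * db m s k = 2 * E * Y m.
Proof.
move=> mS.
rewrite (eq_bigr (fun s => E * (a s * b (m s)) - a s * (\sum_k b (m k)) -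
    (\sum_k a k) * b (m s) + Y m)); last first.
  move=> s _; rewrite /E -sum1_card natr_sum !mulr_suml mulr_sumr.
  rewrite -!sumrB -big_split/=; apply: eq_bigr => k _.
  by rewrite /da /db; ring.
rewrite big_split/= !sumrB sumr_const -!mulr_sumr -mulr_suml -/(Y m).
by rewrite a0 !mul0r !subr0 -[_ *+ #|_|]mulr_natl -/E; ring.
Qed.

(** Writing one factor of 2 E Y^2 as the sum over all pairs of stubs, the pairs whose swap stays
    simple contribute at most 12 A C per matching, the others at most 4 B A C. Division by 2 E gives
    (6 + 2 B) / E. *)
Lemma sum_bilinear_sqr :
  \sum_(m in Sim) Y m ^+ 2 <=
  #|Sim|%:R * ((6 + 2 * B) / E * ((\sum_s a s ^+ 2) * (\sum_t b t ^+ 2))).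
Proof.
set A := \sum_s _; set C := \sum_t _.
have A0 : 0 <= A by apply: sumr_ge0 => s _; exact: sqr_ge0.
have C0 : 0 <= C by apply: sumr_ge0 => s _; exact: sqr_ge0.
have hC m : m \in Sim -> \sum_s b (m s) ^+ 2 = C.
  exact: (sum_bijection (fun t => b t ^+ 2)).
pose Z m := \sum_(p : S * S | swap m p.1 p.2 \notin Sim) da p.1 p.2 * db m p.1 p.2.
have split_ : 2 * E * \sum_(m in Sim) Y m ^+ 2 =
    \sum_s \sum_k \sum_(m in Sim | swap m s k \in Sim) da s k * db m s k * Y m
    + \sum_(m in Sim) Z m * Y m.
  under [X in _ = X + _]eq_bigr => s _.
    under eq_bigr => k _ do rewrite big_mkcondr/=.
    rewrite exchange_big/=. over.
  rewrite exchange_big/= -big_split/= mulr_sumr; apply: eq_bigr => m mS.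
  rewrite expr2 mulrA -sum_pairs_bilinear// /Z.
  rewrite -(pair_big_dep predT (fun s k => swap m s k \notin Sim)
    (fun s k => da s k * db m s k))/= !mulr_suml -big_split/=;
      apply: eq_bigr => s _.
  rewrite [X in _ = _ + X * _]big_mkcond/= !mulr_suml -big_split/=;
    apply: eq_bigr => k _.
  by case: ifP; rewrite /= ?mul0r ?addr0 ?add0r.
have good : \sum_s \sum_k \sum_(m in Sim | swap m s k \in Sim) da s k * db m s k
  * Y m
    <= #|Sim|%:R * (12 * (A * C)).
  apply: (@le_trans _ _ (\sum_(m in Sim) (4 * E * (\sum_s a s ^+ 2 * b (m s) ^+
    2) + 4 * (A * C)))).
    apply: (@le_trans _ _ (\sum_s \sum_k \sum_(m in Sim)
        (2 * (a s ^+ 2 + a k ^+ 2) * (b (m s) ^+ 2 + b (m k) ^+ 2)))).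
      apply: ler_sum => s _; apply: ler_sum => k _.
      rewrite -(ler_pM2l (ltr0n R 2)) sum_good_bilinear big_mkcondr/= mulr_sumr.
      apply: ler_sum => m _.
      have h (x y : R) : (x - y) ^+ 2 <= 2 * (x ^+ 2 + y ^+ 2).
        by have := sqr_ge0 (x + y); nra.
      apply: (@le_trans _ _ ((da s k * db m s k) ^+ 2)).
        by case: ifP; rewrite // sqr_ge0.
      rewrite exprMn; apply: le_trans (ler_pM _ _ (h _ _) (h _ _)) _;
        rewrite ?sqr_ge0//.
      by rewrite le_eqVlt; apply/orP; left; apply/eqP; ring.
    under eq_bigr => s _ do rewrite exchange_big/=.
    rewrite exchange_big/=; apply: ler_sum => m mS.
    rewrite (eq_bigr (fun s => 2 * (E * (a s ^+ 2 * b (m s) ^+ 2) + a s ^+ 2 * C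
        + A * b (m s) ^+ 2 + \sum_k a k ^+ 2 * b (m k) ^+ 2))); last first.
      move=> s _; rewrite /E -sum1_card natr_sum /A !mulr_suml.
      rewrite -(hC _ mS) mulr_sumr.
      rewrite -!big_split/= mulr_sumr; apply: eq_bigr => k _.
      by ring.
    rewrite -mulr_sumr !big_split/= sumr_const -[_ *+ #|_|]mulr_natl -/E
      -!mulr_sumr -mulr_suml.
    rewrite (hC _ mS) -/A.
    by rewrite le_eqVlt; apply/orP; left; apply/eqP; ring.
  rewrite big_split/= sumr_const -mulr_sumr exchange_big/=.
  (* For a single matching this diagonal sum can be of order A C. Averaging over matchings gains the
     factor 2 / E that compensates the prefactor 4 E; the resulting 8 and the remaining 4 make
     12. *)
  have : \sum_s \sum_(m in Sim) a s ^+ 2 * b (m s) ^+ 2 <=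
    2 / E * (A * C) * #|Sim|%:R.
    rewrite /A mulr_suml mulr_sumr mulr_suml; apply: ler_sum => s _.
    rewrite -mulr_sumr [leRHS](_ : _ = a s ^+ 2 * (2 / E * C * #|Sim|%:R));
      last by ring.
    rewrite ler_wpM2l ?sqr_ge0//.
    exact: (sum_prescribed_le outdegD indegD outdegB indegB S_gt0 B_le s
      (fun t => sqr_ge0 (b t))).
  rewrite -(ler_pM2l (_ : 0 < 4 * E)); last by rewrite mulr_gt0.
  move=> h; rewrite -[_ *+ #|_|]mulr_natl; apply: le_trans (lerD h (lexx _)) _.
  by rewrite le_eqVlt; apply/orP; left; apply/eqP; field; rewrite gt_eqF.
have badb : \sum_(m in Sim) Z m * Y m <= #|Sim|%:R * (4 * B * (A * C)).
  rewrite [leRHS]mulr_natl -sumr_const; apply: ler_sum => m mS.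
  have hY : Y m ^+ 2 <= A * C.
    apply: le_trans (sum_Cauchy_Schwarz _ _ _) _.
    by rewrite (hC _ mS).
  have hZ : Z m ^+ 2 <= (4 * B * A) * (4 * B * C).
    apply: le_trans (sum_Cauchy_Schwarz _ _ _) _; apply: ler_pM.
    - by apply: sumr_ge0 => p _; exact: sqr_ge0.
    - by apply: sumr_ge0 => p _; exact: sqr_ge0.
    - exact: sum_bad_sqr.
    - rewrite -(hC _ mS).
      exact: (sum_bad_sqr (fun s => b (m s))).
  (* Both factors are bounded through their squares; completing the square in Z - 4 B Y avoids
     square roots. *)
  have : 8 * B * (Z m * Y m) <= 8 * B * (4 * B * (A * C)).
    have := sqr_ge0 (Z m - 4 * B * Y m).
    have : 16 * B ^+ 2 * Y m ^+ 2 <= 16 * B ^+ 2 * (A * C).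
      by rewrite ler_wpM2l// mulr_ge0 ?sqr_ge0.
    nra.
  by rewrite ler_pM2l// mulr_gt0.
have : 2 * E * \sum_(m in Sim) Y m ^+ 2 <=
  2 * E * (#|Sim|%:R * ((6 + 2 * B) / E * (A * C))).
  rewrite split_; apply: le_trans (lerD good badb) _.
  by rewrite le_eqVlt; apply/orP; left; apply/eqP; field; rewrite gt_eqF.
by rewrite ler_pM2l// mulr_gt0.
Qed.

End Bilinear.

Section Kernel.
Variables (K : S -> S -> R) (L : T -> T -> R).
Hypotheses (K1 : forall s k, `|K s k| <= 1) (L1 : forall t t', `|L t t'| <= 1).
Hypothesis L_anti : forall t t', L t t' = - L t' t.
Let X m := \sum_s \sum_k K s k * L (m s) (m k).

Lemma kernel_abs m : `|X m| <= E ^+ 2.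
Proof.
apply: le_trans (ler_norm_sum _ _ _) _.
rewrite expr2 mulr_natl -sumr_const; apply: ler_sum => s _.
apply: le_trans (ler_norm_sum _ _ _) _.
rewrite /E -sum1_card natr_sum; apply: ler_sum => k _.
by rewrite normrM mulr_ile1.
Qed.

(** Only the terms with an index among [s] and [k] change, each by at most 2. The weight [c i + c j]
    is at least 1 on them, and its sum over all pairs is 4 E. *)
Lemma kernel_swap m s k : `|X m - X (swap m s k)| <= 8 * E.
Proof.
pose c i : R := (i == s)%:R + (i == k)%:R.
have c0 i : 0 <= c i by rewrite addr_ge0.
rewrite /X -sumrB; apply: le_trans (ler_norm_sum _ _ _) _.
apply: (@le_trans _ _ (\sum_i \sum_j 2 * (c i + c j))).
  apply: ler_sum => i _; rewrite -sumrB; apply: le_trans (ler_norm_sum _ _ _) _.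
  apply: ler_sum => j _; rewrite -mulrBr normrM.
  apply: (@le_trans _ _ `|L (m i) (m j) - L (swap m s k i) (swap m s k j)|).
    by rewrite ler_piMl.
  have h2 : `|L (m i) (m j) - L (swap m s k i) (swap m s k j)| <= 2.
    by apply: le_trans (ler_normB _ _) _; rewrite lerD.
  case: (boolP ((i \in [:: s; k]) || (j \in [:: s; k]))) => h.
    apply: le_trans h2 _; rewrite ler_peMr// /c.
    move: h; rewrite !inE => /orP[]/orP[]/eqP ->; rewrite eqxx;
      do ?case: (_ == _) => //=; lra.
  move: h; rewrite !inE !negb_or => /andP[/andP[h1 h2'] /andP[h3 h4]].
  by rewrite !swapD// subrr normr0 mulr_ge0// addr_ge0.
have sc : \sum_i c i = 2.
  rewrite big_split/= (bigD1 s)//= eqxx big1 ?addr0; last by move=> i /negPf ->.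
  by rewrite (bigD1 k)//= eqxx big1 ?addr0// => i /negPf ->.
rewrite (eq_bigr (fun i => 2 * (E * c i + 2))).
  rewrite -mulr_sumr big_split/= -mulr_sumr sc sumr_const -[_ *+ #|_|]mulr_natl -/E.
  by rewrite le_eqVlt; apply/orP; left; apply/eqP; ring.
by move=> i _; rewrite -mulr_sumr big_split/= sc sumr_const -[_ *+ #|_|]mulr_natl.
Qed.

(** For a pair whose swap stays simple, antisymmetry of [L] turns twice the sum into one against
    [X m - X (swap m s k)], which gains an order of E over the trivial bound E^2 on [X]. The at most
    B E other pairs are bounded trivially. *)
Lemma sum_kernel_sqr :
  \sum_(m in Sim) X m ^+ 2 <= #|Sim|%:R * ((4 + B) * E ^+ 3).
Proof.
have split_ : \sum_(m in Sim) X m ^+ 2 =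
    \sum_s \sum_k \sum_(m in Sim | swap m s k \in Sim) K s k * L (m s) (m k) * X m
    + \sum_(m in Sim) \sum_s \sum_(k | swap m s k \notin Sim) K s k * L (m s) (m
      k) * X m.
  under [X in _ = X + _]eq_bigr => s _.
    under eq_bigr => k _ do rewrite big_mkcondr/=.
    rewrite exchange_big/=. over.
  rewrite exchange_big/= -big_split/=; apply: eq_bigr => m mS.
  rewrite expr2 {1}/X mulr_suml -big_split/=; apply: eq_bigr => s _.
  rewrite [X in _ = _ + X]big_mkcond/= mulr_suml -big_split/=;
    apply: eq_bigr => k _.
  by case: ifP; rewrite /= ?addr0 ?add0r.
have good s k : \sum_(m in Sim | swap m s k \in Sim) K s k * L (m s) (m k) * X m
    <= #|Sim|%:R * (4 * E).
  have : 2 * \sum_(m in Sim | swap m s k \in Sim) K s k * L (m s) (m k) * X m =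
      \sum_(m in Sim | swap m s k \in Sim) K s k * L (m s) (m k) * (X m - X (swap
        m s k)).
    rewrite mulrDl mul1r; set W := \sum_(m in _ | _) _.
    rewrite {1}/W (reindex_inj (can_inj (swapK s k)))/=.
    rewrite (eq_bigl (fun m => (m \in Sim) && (swap m s k \in Sim))); last first.
      by move=> m; rewrite swapK andbC.
    rewrite -big_split/=; apply: eq_bigr => m _.
    by rewrite swapL swapR L_anti; ring.
  move=> h; rewrite -(ler_pM2l (ltr0n R 2)) h big_mkcondr/=.
  rewrite mulrCA [leRHS]mulr_natl -sumr_const; apply: ler_sum => m _.
  have e8 : 2 * (4 * E) = 8 * E by ring.
  rewrite e8; case: ifP => _; last by rewrite mulr_ge0// ltW.
  apply: le_trans (ler_norm _) _; rewrite normrM -[leRHS]mul1r.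
  by rewrite ler_pM// ?kernel_swap// normrM mulr_ile1.
have badb : \sum_(m in Sim) \sum_s \sum_(k | swap m s k \notin Sim)
    K s k * L (m s) (m k) * X m <= #|Sim|%:R * (B * E ^+ 3).
  rewrite [leRHS]mulr_natl -sumr_const; apply: ler_sum => m mS.
  rewrite (_ : B * _ = E * (B * E ^+ 2)); last by ring.
  rewrite [leRHS]mulr_natl -sumr_const; apply: ler_sum => s _.
  apply: (@le_trans _ _ (\sum_(k | swap m s k \notin Sim) E ^+ 2)).
    apply: ler_sum => k _.
    apply: le_trans (ler_norm _) _; rewrite normrM -[leRHS]mul1r.
    by rewrite ler_pM// ?kernel_abs// normrM mulr_ile1.
  rewrite sumr_const -[leLHS]mulr_natl ler_wpM2r ?sqr_ge0// ler_nat.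
  apply: leq_trans (card_bad outdegD indegD outdegB indegB s mS).
  rewrite subset_leq_card//; apply/fintype.subsetP => k.
  by rewrite [in X in _ -> X]finset.in_set finset.setUT.
rewrite split_ mulrDl mulrDr; apply: lerD badb.
apply: (@le_trans _ _ (\sum_s \sum_k #|Sim|%:R * (4 * E))).
  by apply: ler_sum => s _; apply: ler_sum => k _; exact: good.
rewrite !sumr_const -[X in X *+ _ <= _]mulr_natl -[X in X <= _]mulr_natl -/E.
by rewrite le_eqVlt; apply/orP; left; apply/eqP; ring.
Qed.

End Kernel.
End SwitchingVariance.

(** * Ranks as sums of signs *)

Section Ranks.
Local Open Scope ring_scope.
Variables (R : realType) (I : finType).
Implicit Types (x y : I -> R).

(* Twice the rank of [e] in decreasing order of [x], centered. *)
Definition spread x e : R := \sum_f Num.sg (x f - x e).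

Lemma sum_spread x : \sum_e spread x e = 0.
Proof.
have : \sum_e spread x e = - \sum_e spread x e.
  transitivity (\sum_f \sum_e Num.sg (x f - x e)); first exact: exchange_big.
  rewrite -sumrN; apply: eq_bigr => e _; rewrite /spread -sumrN.
  by apply: eq_bigr => f _; rewrite -sgrN opprB.
lra.
Qed.

Lemma spread_abs x e : `|spread x e| <= #|I|%:R.
Proof.
apply: le_trans (ler_norm_sum _ _ _) _.
rewrite -sum1_card natr_sum; apply: ler_sum => f _.
by rewrite normr_sg; case: (_ != 0).
Qed.

Lemma spread_sqr_sum x : \sum_e spread x e ^+ 2 <= #|I|%:R ^+ 3.
Proof.
rewrite exprS [leRHS]mulr_natl -sumr_const; apply: ler_sum => e _.
by rewrite -real_normK ?num_real// ler_sqr ?nnegrE// spread_abs.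
Qed.

(** The term E (E + 1)^2 subtracted in Spearman's rho is the contribution of the mean ranks; what
    remains is the bilinear form in the centered spreads. *)
Lemma sum_rank_product (E : R) x y :
  #|I|%:R = E ->
  4 * \sum_e ((E + 1 + spread x e) / 2) * ((E + 1 + spread y e) / 2) =
  \sum_e spread x e * spread y e + E * (E + 1) ^+ 2.
Proof.
move=> IE; rewrite mulr_sumr.
rewrite (eq_bigr (fun e => spread x e * spread y e + (E + 1) ^+ 2 +
    (E + 1) * spread x e + (E + 1) * spread y e)); last by move=> e _; field.
rewrite !big_split/= -!mulr_sumr !sum_spread !mulr0 !addr0 sumr_const.
by rewrite -[_ *+ #|_|]mulr_natl IE; ring.
Qed.

End Ranks.

Section Statistics.
Local Open Scope ring_scope.
Variables (R : realType) (V : finType) (H : digraph V) (alpha beta : dir).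
Implicit Types (d : edge H -> nat) (U W : edge H -> R).
Let E : R := #|edge H|%:R.
Let x (e : edge H) : R := (src_deg alpha e)%:R.
Let y (e : edge H) : R := (tgt_deg beta e)%:R.

(** Without ties each other edge contributes (1 + sign) / 2. The edge itself is counted fully
    although its sign is 0, which gives the extra 1. *)
Lemma tie_rank_spread d U e : injective (fun f => (d f)%:R + U f) ->
  tie_rank d U e = (E + 1 + spread (fun f => (d f)%:R + U f) e) / 2.
Proof.
move=> inj; rewrite /tie_rank; set z := fun f => (d f)%:R + U f : R.
rewrite (eq_bigr (fun f => (1 + (f == e)%:R + Num.sg (z f - z e)) / 2)).
  rewrite -mulr_suml !big_split/= sumr_const -/E; congr ((_ + _ + _) / 2).
  by rewrite (bigD1 e)//= eqxx big1 ?addr0// => f /negPf ->.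
move=> f _; rewrite -/(z e) -/(z f); have [->|fe] := eqVneq f e.
  by rewrite subrr sgr0 lexx addr0 /=; field.
case: ltrgtP => [lt|lt|/inj ef]; last by rewrite ef eqxx in fe.
- by rewrite gtr0_sg ?subr_gt0//= addr0; field.
- by rewrite ltr0_sg ?subr_lt0//= addr0 subrr mul0r.
Qed.

(** Ties are harmless here: a tie has sign 0 and counts one half. The edge itself also counts one
    half, and the initial 1/2 supplies the rest of the 1. *)
Lemma avg_rank_spread d e :
  avg_rank R d e = (E + 1 + spread (fun f => (d f)%:R) e) / 2.
Proof.
rewrite /avg_rank (eq_bigr (fun f => (1 + Num.sg ((d f)%:R - (d e)%:R)) / 2)).
  rewrite -mulr_suml !big_split/= sumr_const -/E /spread.
  by field.
move=> f _; case: ltngtP => lt.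
- by rewrite gtr0_sg ?subr_gt0 ?ltr_nat//= mulr0 addr0; field.
- by rewrite ltr0_sg ?subr_lt0 ?ltr_nat//= mulr0 addr0 subrr mul0r.
- by rewrite lt subrr sgr0 addr0 add0r mulr1 mul1r.
Qed.

Lemma spearman_spread U W :
  injective (fun e => x e + U e) -> injective (fun e => y e + W e) ->
  spearman alpha beta U W = 3 * (\sum_e spread (fun e => x e + U e) e *
    spread (fun e => y e + W e) e) / (E ^+ 3 - E).
Proof.
move=> iU iW; rewrite /spearman -/E; congr (_ / _).
under eq_bigr do rewrite !tie_rank_spread//.
have := sum_rank_product (fun e => x e + U e) (fun e => y e + W e) (erefl E).
rewrite /x /y; lra.
Qed.

Lemma spearman_avg_spread :
  spearman_avg R H alpha beta = (\sum_e spread x e * spread y e) /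
    (Num.sqrt (\sum_e spread x e ^+ 2) * Num.sqrt (\sum_e spread y e ^+ 2)).
Proof.
have h (p q : edge H -> nat) : 4 * (\sum_e avg_rank R p e * avg_rank R q e)
    - E * (E + 1) ^+ 2 = \sum_e spread (fun e => (p e)%:R) e * spread (fun e =>
      (q e)%:R) e.
  under eq_bigr do rewrite !avg_rank_spread//.
  by rewrite sum_rank_product// addrK.
rewrite /spearman_avg -/E; congr (_ / (Num.sqrt _ * Num.sqrt _)).
- exact: h.
- by under eq_bigr do rewrite expr2; rewrite h.
- by under eq_bigr do rewrite expr2; rewrite h.
Qed.

(** Over an unordered pair lie exactly its two orderings, distinct because [r] is irreflexive. *)
Lemma card_unordered (r : rel (edge H)) : irreflexive r -> ssrbool.symmetric r ->
  (2 * #|[set [set p.1; p.2]%SET | p : edge H * edge H & r p.1 p.2]%SET|)%N =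
  #|[set p : edge H * edge H | r p.1 p.2]%SET|.
Proof.
move=> irr sym; set A := [set p | _]%SET;
  set f := fun p : edge H * edge H => [set p.1; p.2]%SET.
rewrite -[RHS]sum1_card (partition_big f (mem (f @: A)%SET))/=; last first.
  by move=> p pA; apply: imset_f.
rewrite (eq_bigr (fun=> 2)); first by rewrite sum_nat_const mulnC.
move=> X /imsetP[[e g]]; rewrite inE /= => reg ->.
have ge : g != e by apply: contraTneq reg => ->; rewrite irr.
rewrite sum1dep_card (_ : finset _ = [set (e, g); (g, e)]%SET).
  by rewrite cards2 xpair_eqE negb_and [e == g]eq_sym ge.
apply/finset.setP => -[e' g']; rewrite !inE/= !xpair_eqE.
apply/andP/orP => [[r' /eqP h]|[]/andP[/eqP -> /eqP ->]]; last 2 first.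
- by split.
- by rewrite sym /f/= finset.setUC.
have e'g' : e' != g' by apply: contraTneq r' => ->; rewrite irr.
have : e' \in f (e, g) by rewrite -h !inE eqxx.
have : g' \in f (e, g) by rewrite -h !inE eqxx orbT.
rewrite !inE/= => /orP[]/eqP hg /orP[]/eqP he; move: e'g'; rewrite hg he ?eqxx//.
- by right.
- by left.
Qed.

Lemma kendall_sum :
  kendall R H alpha beta =
  (\sum_e \sum_f Num.sg (x e - x f) * Num.sg (y e - y f)) / (E * (E - 1)).
Proof.
rewrite /kendall -/E; congr (_ / _); rewrite mulrBr -!natrM.
have cC e f : concordance alpha beta e f = concordance alpha beta f e.
  by rewrite /concordance; ring.
have c0 e : concordance alpha beta e e = 0 by rewrite /concordance !subrr mul0r.
rewrite /n_concordant /n_discordant.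
rewrite (card_unordered (r := fun e f => 0 < concordance alpha beta e f));
  last 2 first.
- by move=> e; rewrite c0 ltxx.
- by move=> e f; rewrite cC.
rewrite (card_unordered (r := fun e f => concordance alpha beta e f < 0));
  last 2 first.
- by move=> e; rewrite c0 ltxx.
- by move=> e f; rewrite cC.
rewrite pair_big/= -!sum1_card !natr_sum !(big_mkcond (fun p => p \in _))/= -sumrB.
apply: eq_bigr => -[e f] _; rewrite !inE/= -sgrM.
have -> : (x e - x f) * (y e - y f) = (concordance alpha beta e f)%:~R.
  by rewrite /concordance rmorphM !rmorphB.
case: (ltrgtP 0 (concordance alpha beta e f)) => [h|h|<-].
- by rewrite subr0 gtr0_sg ?ltr0z.
- by rewrite sub0r ltr0_sg ?ltrz0.
- by rewrite subrr sgr0.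
Qed.

End Statistics.

(** * Invariance of the statistics under isomorphism of multigraphs *)

Section Isomorphism.
Local Open Scope ring_scope.
Variables (R : realType) (V : finType) (H H' : digraph V).
Variable phi : edge H -> edge H'.
Hypotheses (phi_bij : bijective phi)
  (phi_src : forall e, source (phi e) = source e)
  (phi_tgt : forall e, target (phi e) = target e).

Lemma deg_iso s x : deg s H' x = deg s H x.
Proof.
case: s => /=; rewrite -!sum1_card (reindex phi (onW_bij _ phi_bij))/=;
  by apply: eq_bigl => e; rewrite !inE ?phi_src ?phi_tgt.
Qed.

Lemma card_edge_iso : #|edge H'| = #|edge H|.
Proof. by rewrite (bij_eq_card phi_bij). Qed.

Lemma src_deg_iso alpha e : src_deg alpha (phi e) = src_deg alpha e.
Proof. by rewrite /src_deg deg_iso phi_src. Qed.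

Lemma tgt_deg_iso beta e : tgt_deg beta (phi e) = tgt_deg beta e.
Proof. by rewrite /tgt_deg deg_iso phi_tgt. Qed.

Let reindex_phi (F : edge H' -> R) : \sum_e F e = \sum_e F (phi e).
Proof. exact: (reindex phi (onW_bij _ phi_bij)). Qed.

Lemma spearman_iso alpha beta (U W : edge H' -> R) :
  spearman alpha beta U W = spearman alpha beta (U \o phi) (W \o phi).
Proof.
rewrite /spearman card_edge_iso reindex_phi; congr ((12 * _ - _) / _).
apply: eq_bigr => e _; rewrite /tie_rank !reindex_phi.
congr (_ * _); apply: eq_bigr => f _; first by rewrite !src_deg_iso.
by rewrite !tgt_deg_iso.
Qed.

Lemma spearman_avg_iso alpha beta :
  spearman_avg R H' alpha beta = spearman_avg R H alpha beta.
Proof.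
rewrite !spearman_avg_spread !reindex_phi.
have hx e : spread (fun e => (src_deg alpha e)%:R :
  R) (phi e) = spread (fun e => (src_deg alpha e)%:R) e.
  by rewrite /spread reindex_phi; apply: eq_bigr => f _; rewrite !src_deg_iso.
have hy e : spread (fun e => (tgt_deg beta e)%:R :
  R) (phi e) = spread (fun e => (tgt_deg beta e)%:R) e.
  by rewrite /spread reindex_phi; apply: eq_bigr => f _; rewrite !tgt_deg_iso.
congr (_ / (Num.sqrt _ * Num.sqrt _)); apply: eq_bigr => e _; by rewrite ?hx ?hy.
Qed.

Lemma kendall_iso alpha beta : kendall R H' alpha beta = kendall R H alpha beta.
Proof.
rewrite !kendall_sum card_edge_iso reindex_phi; congr (_ / _).
apply: eq_bigr => e _; rewrite reindex_phi; apply: eq_bigr => f _.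
by rewrite !src_deg_iso !tgt_deg_iso.
Qed.

End Isomorphism.

(** * Matchings of a bidegree sequence *)

Section Matchings.
Local Open Scope set_scope.
Local Open Scope ring_scope.
Variables (R : realType) (V : finType) (D : bidegree V).
Implicit Types (m : {ffun out_stub D -> in_stub D}) (s : out_stub D).

Definition src_stub (s : out_stub D) : V := tag s.
Definition tgt_stub (t : in_stub D) : V := tag t.

Lemma card_tag_fiber (n : V -> nat) x :
  #|[pred s : {y : V & 'I_(n y)} | tag s == x]| = n x.
Proof.
rewrite -[RHS]card_ord -(card_codom (f := fun i :
  'I_(n x) => Tagged (fun y => 'I_(n y)) i)).
  apply: eq_card => s; rewrite inE; apply/eqP/codomP => [|[i ->]//].
  by case: s => y i /= yx; move: i; rewrite yx => i; exists i.
by move=> i j /eqP; rewrite eq_Tagged => /eqP.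
Qed.

Lemma outdeg_stub x : outdeg src_stub x = D.2 x.
Proof. exact: (card_tag_fiber D.2). Qed.

Lemma indeg_stub x : indeg tgt_stub x = D.1 x.
Proof. exact: (card_tag_fiber D.1). Qed.

Lemma card_out_stub : #|out_stub D| = (\sum_x D.2 x)%N.
Proof.
rewrite -sum1_card (partition_big src_stub predT)//=; apply: eq_bigr => x _.
by rewrite -[RHS]outdeg_stub /outdeg -sum1_card.
Qed.

Lemma card_in_stub : #|in_stub D| = (\sum_x D.1 x)%N.
Proof.
rewrite -sum1_card (partition_big tgt_stub predT)//=; apply: eq_bigr => x _.
by rewrite -[RHS]indeg_stub /indeg -sum1_card.
Qed.

Lemma card_matchings_gt0 : (\sum_x D.1 x = \sum_x D.2 x)%N ->
  (0 < #|matchings D|)%N.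
Proof.
move=> e; have eqS : #|out_stub D| =
  #|in_stub D| by rewrite card_out_stub card_in_stub.
pose f (s : out_stub D) : in_stub D := enum_val (cast_ord eqS (enum_rank s)).
have inj : injective f.
  by move=> s s' /enum_val_inj/cast_ord_inj/enum_rank_inj.
apply/card_gt0P; exists (finfun f); rewrite inE; apply/andP; split.
  by apply/injectiveP => s s'; rewrite !ffunE => /inj.
apply/forallP => t; apply/codomP.
exists (enum_val (cast_ord (esym eqS) (enum_rank t))).
by rewrite ffunE /f enum_valK cast_ordKV enum_rankK.
Qed.

Definition simple_matchings := simple_on src_stub tgt_stub [set: out_stub D]%SET.

Lemma simple_matchingsE m :
  (m \in simple_matchings) = (m \in matchings D) && simple (matched_graph m).
Proof.
apply/simple_onP/andP => -[mb H]; split=> //.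
  apply/andP; split.
    apply/forallP => s; have := H s s (finset.in_setT _) (finset.in_setT _).
    by rewrite /conflict eqxx.
  apply/injectiveP => s s' [e1 e2]; apply/eqP; apply: contraT => ss'.
  have := H s s' (finset.in_setT _) (finset.in_setT _).
  by rewrite /conflict (negPf ss') /src_stub /tgt_stub e1 e2 !eqxx.
case/andP: H => /forallP loop /injectiveP inj s s' _ _.
rewrite /conflict; case: eqVneq => [_|ss']; first exact: loop.
apply: contra ss' => /andP[/eqP e1 /eqP e2]; apply/eqP/inj.
by rewrite /endpoints /= -/(src_stub s) e1 -/(tgt_stub (m s)) e2.
Qed.

Section Arcs.
Variable m : {ffun out_stub D -> in_stub D}.
Hypothesis mS : m \in simple_matchings.

Lemma endpoints_inj : injective (@endpoints V (matched_graph m)).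
Proof.
by move: mS; rewrite simple_matchingsE => /andP[_ /andP[_ /injectiveP]].
Qed.

Lemma endpoints_arcs (s : edge (matched_graph m)) :
  endpoints s \in arcs (matched_graph m).
Proof. exact: imset_f. Qed.

Definition arc_of (s : edge (matched_graph m)) :
  edge (digraph_of (arcs (matched_graph m))) :=
  exist _ (endpoints s) (endpoints_arcs s).

(** The law of the random graph is given on arc sets, while switching acts on stubs; this bijection
    carries the statistics across. Injectivity is the absence of parallel edges. *)
Lemma arc_of_bij : bijective arc_of.
Proof.
apply: inj_card_bij; first by move=> s s' /(congr1 val) /= /endpoints_inj.
rewrite card_sig; apply: leq_trans (leq_imset_card _ _) _.
by rewrite max_card.
Qed.

Definition stub_deg (a : dir) x := if a is plus then D.2 x else D.1 x.

Lemma deg_matched (a : dir) x : deg a (matched_graph m) x = stub_deg a x.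
Proof.
case: a => /=; first by rewrite -outdeg_stub.
have /simple_onP[mb _] := mS.
rewrite -indeg_stub -(card_fiber_bij _ _ mb).
by apply: eq_card => s; rewrite !inE.
Qed.

Lemma kendall_arcs alpha beta :
  kendall R (digraph_of (arcs (matched_graph m))) alpha beta =
  kendall R (matched_graph m) alpha beta.
Proof. exact: (kendall_iso _ arc_of_bij). Qed.

Lemma spearman_avg_arcs alpha beta :
  spearman_avg R (digraph_of (arcs (matched_graph m))) alpha beta =
  spearman_avg R (matched_graph m) alpha beta.
Proof. exact: (spearman_avg_iso _ arc_of_bij). Qed.

Lemma spearman_arcs alpha beta (U W : V * V -> R) :
  spearman (H := digraph_of (arcs (matched_graph m))) alpha beta
    (fun e => U (val e)) (fun e => W (val e)) =
  spearman (H := matched_graph m) alpha beta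
    (fun s => U (@endpoints V (matched_graph m) s))
    (fun s => W (@endpoints V (matched_graph m) s)).
Proof. exact: (spearman_iso arc_of_bij). Qed.

End Arcs.
End Matchings.

(** * Tame degree sequences and small exceedance probabilities *)

Section Tame.
Local Open Scope set_scope.
Local Open Scope ring_scope.
Variable R : realType.

Definition tame (V : finType) (C c delta : R) (D : bidegree V) : bool :=
  let n : R := #|V|%:R in
  [&& (\sum_x D.1 x == \sum_x D.2 x)%N,
      c * n <= (\sum_x D.2 x)%:R,
      \sum_x (D.1 x)%:R ^+ 2 <= C * n,
      \sum_x (D.2 x)%:R ^+ 2 <= C * n,
      [forall x, (D.1 x)%:R <= delta * n] &
      [forall x, (D.2 x)%:R <= delta * n]].

Definition switchable (V : finType) (D : bidegree V) (Delta B0 : nat) : Prop :=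
  [/\ forall x, (outdeg (@src_stub V D) x <= Delta)%N,
      forall x, (indeg (@tgt_stub V D) x <= Delta)%N,
      forall X : {set V}, (#|X| <= Delta)%N ->
        (\sum_(x in X) outdeg (@src_stub V D) x <= B0)%N &
      forall X : {set V}, (#|X| <= Delta)%N ->
        (\sum_(x in X) indeg (@tgt_stub V D) x <= B0)%N].

(* [f <= K + f^2 / K] *)
Lemma sum_deg_bound (V : finType) (f : V -> nat) (K Delta Q : nat) (X : {set V}) :
  (0 < K)%N -> (\sum_x f x ^ 2 <= Q)%N -> (#|X| <= Delta)%N ->
  (\sum_(x in X) f x <= (K ^ 2 * Delta + Q) %/ K)%N.
Proof.
move=> K0 fQ XD; rewrite leq_divRL// big_distrl/=.
apply: (@leq_trans (\sum_(x in X) (K ^ 2 + f x ^ 2))).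
  apply: leq_sum => x _; nia.
rewrite big_split/= sum_nat_const mulnC leq_add ?leq_mul2l ?XD ?orbT//.
by apply: leq_trans fQ; rewrite [leqRHS](bigID (mem X))/= leq_addr.
Qed.

(** The quantity 6 + 2 (5 [B0]) is the numerator of the bound in [sum_bilinear_sqr], and it also
    dominates what the other switching estimates require. *)
Lemma tame_switchable (C c eta : R) : 0 < C -> 0 < c -> 0 < eta ->
  exists delta : R, exists N : nat, 0 < delta /\
  forall (V : finType) (D : bidegree V), (N <= #|V|)%N -> tame C c delta D ->
  exists Delta B0 : nat,
    [/\ switchable D Delta B0, (0 < B0)%N &
      6 + 2 * (5 * B0)%:R <= eta * #|out_stub D|%:R].
Proof.
move=> C0 c0 e0.
(* Budget in units of eta c n: the squares cost at most 1/80 through [K], the degrees at most 1/40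
   through delta, and the factor 10 makes this 3/8. The constant 16, namely 6 plus 10 for the
   successor in [B0], is at most 1/2 through [N]. *)
pose K := (Num.truncn (80 * C / (eta * c))).+1.
have ec0 : 0 < eta * c by rewrite mulr_gt0.
have hK : 80 * C <= K%:R * (eta * c).
  by rewrite -ler_pdivrMr// ltW// /K; exact: truncnS_gt.
have K0 : 0 < K%:R :> R by rewrite ltr0n.
pose N := (Num.truncn (32 / (eta * c))).+1.
have hN : 32 <= N%:R * (eta * c).
  by rewrite -ler_pdivrMr// ltW// /N; exact: truncnS_gt.
exists (eta * c / (40 * K%:R)), N; split; first by rewrite divr_gt0// mulr_gt0.
move=> V D NV /and5P[/eqP bal hE Q1 Q2 /andP[/forallP d1 /forallP d2]].
set n : R := #|V|%:R in hE Q1 Q2 d1 d2.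
have hn : 32 <= n * (eta * c).
  by apply: le_trans hN _; rewrite ler_pM2r// ler_nat.
have n0 : 0 < n by rewrite ltr0n; apply: leq_trans NV.
pose Delta := \max_x maxn (D.1 x) (D.2 x).
pose Q := (maxn (\sum_x D.1 x ^ 2) (\sum_x D.2 x ^ 2))%N.
exists Delta, ((K ^ 2 * Delta + Q) %/ K).+1; split=> //.
  split.
  - by move=> x; rewrite outdeg_stub (leq_trans _ (leq_bigmax x))// leq_maxr.
  - by move=> x; rewrite indeg_stub (leq_trans _ (leq_bigmax x))// leq_maxl.
  - move=> X XD; rewrite leqW//; under eq_bigr do rewrite outdeg_stub.
    by apply: sum_deg_bound => //; rewrite leq_maxr.
  - move=> X XD; rewrite leqW//; under eq_bigr do rewrite indeg_stub.
    by apply: sum_deg_bound => //; rewrite leq_maxl.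
have hD : Delta%:R <= eta * c / (40 * K%:R) * n.
  rewrite /Delta; elim/big_ind: _ => [|x y hx hy|x _].
  - by rewrite mulr_ge0 ?divr_ge0 ?mulr_ge0 ?ltW.
  - by rewrite /maxn; case: ifP.
  - by rewrite /maxn; case: ifP.
have hQ : Q%:R <= C * n.
  rewrite /Q /maxn; case: ifP => _; rewrite natr_sum;
    by under eq_bigr do rewrite natrX.
have hB : ((K ^ 2 * Delta + Q) %/ K)%:R * K%:R <= K%:R ^+ 2 * Delta%:R + Q%:R :> R.
  by rewrite -natrM -natrX -natrM -natrD ler_nat leq_trunc_div.
rewrite card_out_stub -addn1 natrM natrD.
set b := (_ %/ _)%:R in hB *.
have {}hB : b <= K%:R * Delta%:R + Q%:R / K%:R.
  rewrite -(ler_pM2r K0) (le_trans hB)// le_eqVlt; apply/orP; left.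
  by apply/eqP; field; rewrite gt_eqF.
have h1 : K%:R * Delta%:R <= eta * c * n / 40.
  apply: le_trans (ler_wpM2l (ltW K0) hD) _; rewrite le_eqVlt; apply/orP; left.
  by apply/eqP; field; rewrite gt_eqF.
have h2 : Q%:R / K%:R <= eta * c * n / 80.
  rewrite ler_pdivrMr//; apply: le_trans hQ _.
  have := ler_wpM2r (ltW n0) hK; lra.
have h3 : eta * (c * n) <= eta * (\sum_x D.2 x)%:R by rewrite ler_wpM2l// ltW.
lra.
Qed.

Lemma tame_simple (C c : R) : 0 < C -> 0 < c ->
  exists c0 delta : R, exists N : nat, [/\ 0 < c0, 0 < delta &
  forall (V : finType) (D : bidegree V), (N <= #|V|)%N -> tame C c delta D ->
  c0 * #|matchings D|%:R <= #|@simple_matchings V D|%:R].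
Proof.
move=> C0 c0; have [delta [N [d0 H]]] := tame_switchable C0 c0 (@ltr01 R).
(* The exponent of [card_bijections_le] when both sums of squares are at most C / c times the number
   of edges. *)
pose M : R := 2 * C / c + 4 * C ^+ 2 / c ^+ 2.
exists (expR (- M)), delta, N; split=> //; first exact: expR_gt0.
move=> V D NV tD; have [Delta [B0 [[h1 h2 h3 h4] B00 hB]]] := H V D NV tD.
have hB' : (6 + 2 * (5 * B0) <= #|out_stub D|)%N.
  by rewrite -(ler_nat R) natrD natrM -[leRHS]mul1r.
have S0 : (0 < #|out_stub D|)%N by lia.
have B2 : (2 * (5 * B0) <= #|out_stub D|)%N by lia.
have := card_bijections_le R h1 h2 h3 h4 S0 B2.
rewrite -/(matchings D) -/(simple_matchings D) => h.
have -> : #|@simple_matchings V D|%:R =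
  expR (- M) * (expR M * #|@simple_matchings V D|%:R) :> R.
  by rewrite mulrA -expRD addNr expR0 mul1r.
rewrite ler_pM2l ?expR_gt0//; apply: le_trans h _.
rewrite ler_wpM2r// ler_expR.
move: tD => /and5P[/eqP bal hE Q1 Q2 _].
under eq_bigr do rewrite outdeg_stub.
under [X in (_ + X) / _ + _]eq_bigr do rewrite indeg_stub.
under [X in _ + _ * X / _]eq_bigr do rewrite indeg_stub.
set Qp := \sum_x (D.2 x)%:R ^+ 2 in Q2 *; set Qm := \sum_x (D.1 x)%:R ^+ 2 in Q1 *.
rewrite card_out_stub; set n : R := #|V|%:R in hE Q1 Q2.
set E : R := (\sum_x D.2 x)%:R in hE *.
have E0 : 0 < E by rewrite ltr0n -card_out_stub.
have Qm0 : 0 <= Qm by apply: sumr_ge0 => x _; rewrite sqr_ge0.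
have Qp0 : 0 <= Qp by apply: sumr_ge0 => x _; rewrite sqr_ge0.
have n0 : 0 <= n by [].
have hn : n <= E / c by rewrite ler_pdivlMr// mulrC.
have bnd Q : Q <= C * n -> Q / E <= C / c.
  move=> hQ; rewrite ler_pdivrMr//; apply: le_trans hQ _.
  by rewrite -mulrA ler_pM2l// mulrC.
have -> : 4 * Qp * Qm / E ^+ 2 = 4 * ((Qp / E) * (Qm / E)).
  by field; rewrite gt_eqF.
have -> : M = (C / c + C / c) + 4 * ((C / c) * (C / c)).
  by rewrite /M; field; rewrite gt_eqF.
rewrite mulrDl; apply: lerD; first by rewrite lerD ?bnd.
by rewrite ler_pM2l// ler_pM ?bnd// divr_ge0// ltW.
Qed.

Lemma tame_bilinear (C c eta : R) : 0 < C -> 0 < c -> 0 < eta ->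
  exists delta : R, exists N : nat, 0 < delta /\
  forall (V : finType) (D : bidegree V), (N <= #|V|)%N -> tame C c delta D ->
  (6 <= #|out_stub D|)%N /\
  forall (a : out_stub D -> R) (b : in_stub D -> R), \sum_s a s = 0 ->
  \sum_(m in simple_matchings D) (\sum_s a s * b (m s)) ^+ 2 <=
  #|simple_matchings D|%:R * (eta * ((\sum_s a s ^+ 2) * (\sum_t b t ^+ 2))).
Proof.
move=> C0 c0 e0.
(* The bound by 1 provides 10 [B0] <= E, which the switching lemmas assume, and E >= 6, which keeps
   the denominators of the statistics positive. *)
have e10 : 0 < Num.min eta 1 by rewrite lt_min e0 ltr01.
have [delta [N [d0 H]]] := tame_switchable C0 c0 e10.
exists delta, N; split=> // V D NV tD.
have [Delta [B0 [[h1 h2 h3 h4] B00 hB]]] := H V D NV tD.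
have hBe x : Num.min eta 1 <= x -> 6 + 2 * (5 * B0)%:R <= x * #|out_stub D|%:R.
  by move=> hx; apply: le_trans hB _; rewrite ler_wpM2r.
have hB' : (6 + 2 * (5 * B0) <= #|out_stub D|)%N.
  by rewrite -(ler_nat R) natrD natrM -[leRHS]mul1r hBe// ge_min lexx orbT.
have S0 : (0 < #|out_stub D|)%N by lia.
have B2 : (2 * (5 * B0) <= #|out_stub D|)%N by lia.
split; first lia.
move=> a b a0; apply: le_trans (sum_bilinear_sqr h1 h2 h3 h4 S0 B00 B2 b a0) _.
rewrite ler_wpM2l// ler_wpM2r//.
  by rewrite mulr_ge0// sumr_ge0// => i _; rewrite sqr_ge0.
by rewrite ler_pdivrMr ?ltr0n// hBe// ge_min lexx.
Qed.

Lemma tame_kernel (C c eta : R) : 0 < C -> 0 < c -> 0 < eta ->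
  exists delta : R, exists N : nat, 0 < delta /\
  forall (V : finType) (D : bidegree V), (N <= #|V|)%N -> tame C c delta D ->
  (6 <= #|out_stub D|)%N /\
  forall (K : out_stub D -> out_stub D -> R) (L : in_stub D -> in_stub D -> R),
  (forall s k, `|K s k| <= 1) -> (forall t t', `|L t t'| <= 1) ->
  (forall t t', L t t' = - L t' t) ->
  \sum_(m in simple_matchings D) (\sum_s \sum_k K s k * L (m s) (m k)) ^+ 2 <=
  #|simple_matchings D|%:R * (eta * #|out_stub D|%:R ^+ 4).
Proof.
move=> C0 c0 e0.
have e10 : 0 < Num.min eta 1 by rewrite lt_min e0 ltr01.
have [delta [N [d0 H]]] := tame_switchable C0 c0 e10.
exists delta, N; split=> // V D NV tD.
have [Delta [B0 [[h1 h2 h3 h4] B00 hB]]] := H V D NV tD.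
have hBe x : Num.min eta 1 <= x -> 6 + 2 * (5 * B0)%:R <= x * #|out_stub D|%:R.
  by move=> hx; apply: le_trans hB _; rewrite ler_wpM2r.
have hB' : (6 + 2 * (5 * B0) <= #|out_stub D|)%N.
  by rewrite -(ler_nat R) natrD natrM -[leRHS]mul1r hBe// ge_min lexx orbT.
have S0 : (0 < #|out_stub D|)%N by lia.
have B2 : (2 * (5 * B0) <= #|out_stub D|)%N by lia.
split; first lia.
move=> K L K1 L1 La.
apply: le_trans (sum_kernel_sqr h1 h2 h3 h4 K1 L1 La) _.
rewrite ler_wpM2l// [_ ^+ 4]exprS mulrA ler_wpM2r ?exprn_ge0//.
apply: le_trans (hBe eta _); last by rewrite ge_min lexx.
have : 0 <= (5 * B0)%:R :> R by []; lra.
Qed.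

Lemma finite_Markov (I : finType) (A : {set I}) (P : pred I) (X :
  I -> R) (theta kappa : R) :
  0 < theta -> (forall i, P i -> theta <= X i ^+ 2) ->
  \sum_(i in A) X i ^+ 2 <= #|A|%:R * (kappa * theta) ->
  \sum_(i in A) (P i)%:R <= kappa * #|A|%:R.
Proof.
move=> t0 h hX; rewrite -(ler_pM2r t0) mulr_suml.
apply: (@le_trans _ _ (\sum_(i in A) X i ^+ 2)).
  apply: ler_sum => i _; case: (boolP (P i)) => [/h|]; first by rewrite mul1r.
  by rewrite mul0r sqr_ge0.
by apply: le_trans hX _; rewrite mulrCA mulrA.
Qed.

Lemma tame_kendall (C c eta eps : R) alpha beta :
  0 < C -> 0 < c -> 0 < eta -> 0 < eps ->
  exists delta : R, exists N : nat, 0 < delta /\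
  forall (V : finType) (D : bidegree V), (N <= #|V|)%N -> tame C c delta D ->
  \sum_(m in simple_matchings D)
     (eps < `|kendall R (matched_graph m) alpha beta|)%R%:R <=
  eta * #|simple_matchings D|%:R.
Proof.
move=> C0 c0 e0 p0.
(* The 4 is the square of the 2 in E (E - 1) >= E^2 / 2. *)
have e1 : 0 < eta * (eps ^+ 2 / 4) by rewrite mulr_gt0// divr_gt0// exprn_gt0.
have [delta [N [d0 H]]] := tame_kernel C0 c0 e1.
exists delta, N; split=> // V D NV tD; have [E6 {}H] := H V D NV tD.
pose x (s : out_stub D) : R := (stub_deg D alpha (tag s))%:R.
pose y (t : in_stub D) : R := (stub_deg D beta (tag t))%:R.
pose E : R := #|out_stub D|%:R.
have E2 : 2 <= E by rewrite ler_nat; lia.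
have E0 : 0 < E by lra.
(* [finite_Markov] asks for the lower bound at every index in the event, simple or not; the dummy
   value outside the simple matchings satisfies it. *)
apply: (@finite_Markov _ _ _ (fun m :
  {ffun out_stub D -> in_stub D} => if m \in simple_matchings D then
   \sum_s \sum_k Num.sg (x s - x k) * Num.sg (y (m s) - y (m k)) else eps * E ^+ 2)
   (eps ^+ 2 / 4 * E ^+ 4)).
- by rewrite mulr_gt0 ?(exprn_gt0 _ E0)// divr_gt0// exprn_gt0.
- move=> m; case: ifP => [mS|_ _]; last first.
    rewrite exprMn -exprM ler_wpM2r ?(exprn_ge0 _ (ltW E0))//.
    by have := exprn_gt0 2 p0; lra.
  rewrite kendall_sum.
  set W := \sum_e _; set Z := \sum_s _.
  have -> : W = Z.
    apply: eq_bigr => s _; apply: eq_bigr => k _.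
    by rewrite /src_deg /tgt_deg !deg_matched.
  rewrite -[#|_|%:R]/E normrM normrV; last first.
    by rewrite unitfE mulf_neq0// gt_eqF//; lra.
  have EE : 0 < E * (E - 1) by rewrite mulr_gt0//; lra.
  rewrite (gtr0_norm EE) ltr_pdivlMr// => h.
  have h2 : eps * (E ^+ 2 / 2) <= `|Z|.
    apply: le_trans (ltW h); rewrite ler_pM2l//.
    by rewrite expr2 -mulrA ler_pM2l; lra.
  rewrite -[leRHS]real_normK ?num_real//.
  have -> : eps ^+ 2 / 4 * E ^+ 4 = (eps * (E ^+ 2 / 2)) ^+ 2 by field.
  by rewrite ler_sqr ?nnegrE// mulr_ge0 ?divr_ge0 ?(exprn_ge0 _ (ltW E0))// ltW.
- rewrite (eq_bigr (fun m : {ffun out_stub D -> in_stub D} => (\sum_s \sum_k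
      Num.sg (x s - x k) * Num.sg (y (m s) - y (m k))) ^+ 2)); last by move=> m ->.
  rewrite [eta * (_ * _)]mulrA; apply: (H (fun s k =>
    Num.sg (x s - x k)) (fun s k => Num.sg (y s - y k))).
  + by move=> s k; rewrite normr_sg; case: (_ != 0).
  + by move=> s k; rewrite normr_sg; case: (_ != 0).
  + by move=> s k; rewrite -sgrN opprB.
Qed.

Lemma tame_spearman_avg (C c eta eps : R) alpha beta :
  0 < C -> 0 < c -> 0 < eta -> 0 < eps ->
  exists delta : R, exists N : nat, 0 < delta /\
  forall (V : finType) (D : bidegree V), (N <= #|V|)%N -> tame C c delta D ->
  \sum_(m in simple_matchings D)
     (eps < `|spearman_avg R (matched_graph m) alpha beta|)%R%:R <=
  eta * #|simple_matchings D|%:R.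
Proof.
move=> C0 c0 e0 p0.
have e1 : 0 < eta * eps ^+ 2 by rewrite mulr_gt0// exprn_gt0.
have [delta [N [d0 H]]] := tame_bilinear C0 c0 e1.
exists delta, N; split=> // V D NV tD; have [E6 {}H] := H V D NV tD.
pose x (s : out_stub D) : R := (stub_deg D alpha (tag s))%:R.
pose y (t : in_stub D) : R := (stub_deg D beta (tag t))%:R.
pose a := spread x; pose b := spread y.
pose A := \sum_s a s ^+ 2; pose B := \sum_t b t ^+ 2.
have A0 : 0 <= A by apply: sumr_ge0 => i _; rewrite sqr_ge0.
have B0 : 0 <= B by apply: sumr_ge0 => i _; rewrite sqr_ge0.
(* The denominator depends on the degree sequence alone, because a matching merely permutes the
   spreads of the target degrees. *)
have key m : m \in simple_matchings D ->
  spearman_avg R (matched_graph m) alpha beta =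
    (\sum_s a s * b (m s)) / (Num.sqrt A * Num.sqrt B).
  move=> mS; rewrite spearman_avg_spread.
  have ha s : spread (fun e : edge (matched_graph m) => (src_deg alpha e)%:R :
    R) s = a s.
    by rewrite /a /spread; apply: eq_bigr => k _; rewrite /src_deg !deg_matched.
  have hb s : spread (fun e : edge (matched_graph m) => (tgt_deg beta e)%:R :
    R) s = b (m s).
    rewrite /b /spread -(sum_bijection (fun t => Num.sg (y t - y (m s))) mS).
    by apply: eq_bigr => k _; rewrite /tgt_deg !deg_matched.
  congr (_ / (Num.sqrt _ * Num.sqrt _)).
  - by apply: eq_bigr => s _; rewrite ha hb.
  - by apply: eq_bigr => s _; rewrite ha.
  - rewrite /B -(sum_bijection (fun t => b t ^+ 2) mS).
    by apply: eq_bigr => s _; rewrite hb.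
(* If the spreads on one side all vanish, the statistic is 0 by the convention on denominators.
   Otherwise no lower bound on A B is needed, since it cancels against the bound on the second
   moment. *)
have [AB0|AB0] := eqVneq (A * B) 0.
  rewrite big1 ?mulr_ge0// ?ltW// => m mS;
    rewrite key// -sqrtrM// AB0 sqrtr0 invr0 mulr0.
  by rewrite normr0 ltNge ltW.
have AB : 0 < A * B by rewrite lt_def AB0 mulr_ge0.
apply: (@finite_Markov _ _ _ (fun m :
  {ffun out_stub D -> in_stub D} => if m \in simple_matchings D then
   \sum_s a s * b (m s) else eps * Num.sqrt (A * B)) (eps ^+ 2 * (A * B))).
- by rewrite mulr_gt0 ?exprn_gt0.
- move=> m; case: ifP => [mS|_ _]; last by rewrite exprMn sqr_sqrtr// ltW.
  rewrite key// -sqrtrM// normrM normrV ?unitfE ?gt_eqF ?sqrtr_gt0//.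
  rewrite (gtr0_norm (x := Num.sqrt _)) ?sqrtr_gt0// ltr_pdivlMr ?sqrtr_gt0// => h.
  rewrite -[leRHS]real_normK ?num_real//.
  have -> : eps ^+ 2 * (A * B) = (eps * Num.sqrt (A * B)) ^+ 2.
    by rewrite exprMn sqr_sqrtr// ltW.
  have hp : 0 <= eps * Num.sqrt (A * B) by rewrite mulr_ge0 ?sqrtr_ge0// ltW.
  by rewrite ler_sqr ?nnegrE// ltW.
- rewrite (eq_bigr (fun m : {ffun out_stub D -> in_stub D} =>
    (\sum_s a s * b (m s)) ^+ 2)); last by move=> m ->.
  by rewrite [eta * (_ * _)]mulrA; apply: H; exact: sum_spread.
Qed.

(** Target marks sit on inbound stubs, so the ranks on both sides are fixed functions of stubs and
    only their pairing depends on the matching. *)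
Lemma tame_spearman (C c eta eps : R) alpha beta :
  0 < C -> 0 < c -> 0 < eta -> 0 < eps ->
  exists delta : R, exists N : nat, 0 < delta /\
  forall (V : finType) (D : bidegree V), (N <= #|V|)%N -> tame C c delta D ->
  forall (U : out_stub D -> R) (W : in_stub D -> R),
  injective (fun s => (stub_deg D alpha (tag s))%:R + U s) ->
  injective (fun t => (stub_deg D beta (tag t))%:R + W t) ->
  \sum_(m in simple_matchings D)
     (eps < `|spearman (H := matched_graph m) alpha beta U (W \o m)|)%R%:R <=
  eta * #|simple_matchings D|%:R.
Proof.
move=> C0 c0 e0 p0.
(* With E^3 - E >= E^3 / 2 and the prefactor 3, a value above eps forces a bilinear form of at least
   eps E^3 / 6. *)
have e1 : 0 < eta * (eps ^+ 2 / 36) by rewrite mulr_gt0// divr_gt0// exprn_gt0.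
have [delta [N [d0 H]]] := tame_bilinear C0 c0 e1.
exists delta, N; split=> // V D NV tD U W iU iW; have [E6 {}H] := H V D NV tD.
pose x (s : out_stub D) : R := (stub_deg D alpha (tag s))%:R + U s.
pose y (t : in_stub D) : R := (stub_deg D beta (tag t))%:R + W t.
pose a := spread x; pose b := spread y.
pose E : R := #|out_stub D|%:R.
have E2 : 2 <= E by rewrite ler_nat; lia.
have E0 : 0 < E by lra.
have bal : #|in_stub D| = #|out_stub D|.
  by rewrite card_in_stub card_out_stub; case/and5P: tD => /eqP.
have key m : m \in simple_matchings D ->
    spearman (H := matched_graph m) alpha beta U (W \o m) =
    3 * (\sum_s a s * b (m s)) / (E ^+ 3 - E).
  move=> mS; have mi : injective m by case/simple_onP: mS => /bijections_inj.
  have hx (s : edge (matched_graph m)) : (src_deg alpha s)%:R + U s = x s.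
    by rewrite /src_deg deg_matched.
  have hy (s : edge (matched_graph m)) : (tgt_deg beta s)%:R + (W \o m) s = y (m s).
    by rewrite /tgt_deg deg_matched.
  rewrite spearman_spread; last 2 first.
  - by move=> s k; rewrite !hx; exact: iU.
  - by move=> s k; rewrite !hy => /iW/mi.
  congr (3 * _ / _); apply: eq_bigr => s _; congr (_ * _).
    by rewrite /a /spread; apply: eq_bigr => k _; rewrite !hx.
  rewrite /b /spread -(sum_bijection (fun t => Num.sg (y t - y (m s))) mS).
  by apply: eq_bigr => k _; rewrite !hy.
have EE : 0 < E ^+ 3 - E.
  by rewrite (_ : _ - _ = E * (E ^+ 2 - 1)); [rewrite mulr_gt0//; nra|ring].
have hE3 : E ^+ 3 / 2 <= E ^+ 3 - E.
  rewrite -subr_ge0 (_ : _ - _ = E * (E ^+ 2 - 2) / 2); last by field.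
  by rewrite divr_ge0// mulr_ge0//; nra.
apply: (@finite_Markov _ _ _ (fun m :
  {ffun out_stub D -> in_stub D} => if m \in simple_matchings D then
   \sum_s a s * b (m s) else eps * E ^+ 3) (eps ^+ 2 / 36 * E ^+ 6)).
- by rewrite mulr_gt0 ?(exprn_gt0 _ E0)// divr_gt0// exprn_gt0.
- move=> m; case: ifP => [mS|_ _]; last first.
    rewrite exprMn -exprM ler_wpM2r ?(exprn_ge0 _ (ltW E0))//.
    by have := exprn_gt0 2 p0; lra.
  rewrite key// !normrM normrV ?unitfE ?gt_eqF// (gtr0_norm EE) ltr_pdivlMr//.
  rewrite (gtr0_norm (x := 3))//; set Z := \sum_s _ => h.
  have h2 : eps * (E ^+ 3 / 6) <= `|Z|.
    have := ler_wpM2l (ltW p0) hE3; lra.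
  rewrite -[leRHS]real_normK ?num_real//.
  have -> : eps ^+ 2 / 36 * E ^+ 6 = (eps * (E ^+ 3 / 6)) ^+ 2 by field.
  by rewrite ler_sqr ?nnegrE// mulr_ge0 ?divr_ge0 ?(exprn_ge0 _ (ltW E0))// ltW.
- rewrite (eq_bigr (fun m : {ffun out_stub D -> in_stub D} =>
    (\sum_s a s * b (m s)) ^+ 2)); last by move=> m ->.
  apply: le_trans (H a b (sum_spread x)) _;
    rewrite ler_wpM2l// [eta * (_ / _ * _)]mulrA (ler_wpM2l (ltW e1))//.
  rewrite (_ : E ^+ 6 = E ^+ 3 * E ^+ 3); last by rewrite -exprD.
  rewrite ler_pM ?spread_sqr_sum// ?sumr_ge0// => [i _|i _|]; rewrite ?sqr_ge0//.
  by rewrite /E -bal spread_sqr_sum.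
Qed.

End Tame.

(** * Sums over countable types *)

Section DiscreteSums.
Local Open Scope ring_scope.
Variable R : realType.
Implicit Types (X Y : choiceType).

Lemma esumZl X (c : R) (f : X -> \bar R) : 0 <= c -> (forall x, 0 <= f x)%E ->
  (\esum_(x in [set: X]) (c%:E * f x) = c%:E * \esum_(x in [set: X]) f x)%E.
Proof.
have le (c' : R) (g : X -> \bar R) : 0 <= c' -> (forall x, 0 <= g x)%E ->
    (\esum_(x in [set: X]) (c'%:E * g x) <= c'%:E * \esum_(x in [set: X]) g x)%E.
  move=> c0 g0; apply: ge_ereal_sup => _ [A [finA _] <-].
  rewrite -ge0_mule_fsumr//; apply: lee_wpmul2l; first by rewrite lee_fin.
  by apply: ereal_sup_ubound; exists A.
move=> c0 f0; apply/eqP; rewrite eq_le le//=.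
have [->|cn0] := eqVneq c 0.
  by rewrite mul0e esum_ge0// => x _; rewrite mul0e.
have c_gt0 : 0 < c by rewrite lt_def cn0.
have h : (\esum_(x in [set: X]) f x =
          \esum_(x in [set: X]) (c^-1%:E * (c%:E * f x)))%E.
  by apply: eq_esum => x _; rewrite muleA -EFinM mulVf// mul1e.
rewrite {1}h; apply: (@le_trans _ _ (c%:E * (c^-1%:E * \esum_(x in [set: X])
  (c%:E * f x)))%E).
  apply: lee_wpmul2l; first by rewrite lee_fin.
  by apply: le => [|x]; rewrite ?invr_ge0// mule_ge0.
by rewrite muleA -EFinM divff// mul1e.
Qed.

Lemma exchange_esum X Y (a : X -> Y -> \bar R) : (forall x y, 0 <= a x y)%E ->
  (\esum_(x in [set: X]) \esum_(y in [set: Y]) a x y =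
   \esum_(y in [set: Y]) \esum_(x in [set: X]) a x y)%E.
Proof.
move=> a0; rewrite !esum_esum//.
rewrite (reindex_esum ([set: Y] `*`` (fun=> [set: X])) _ (fun z => (z.2, z.1)))//.
split=> //=; first by move=> [? ?] [? ?] /= _ _ [-> ->].
by move=> [x y] _; exists (y, x).
Qed.

Lemma esum_pair X Y (a : X * Y -> \bar R) : (forall z, 0 <= a z)%E ->
  (\esum_(z in [set: X * Y]) a z =
   \esum_(x in [set: X]) \esum_(y in [set: Y]) a (x, y))%E.
Proof.
move=> a0; rewrite esum_esum; last by move=> *; apply: a0.
have -> : [set: X] `*`` (fun=> [set: Y]) = [set: X * Y] by apply/seteqP; split.
by apply: eq_esum => -[].
Qed.

Lemma esum_pair_left X Y (f : X -> R) (g : Y -> R) :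
  (forall x, 0 <= f x) -> (forall y, 0 <= g y) ->
  (\esum_(y in [set: Y]) (g y)%:E = 1)%E ->
  (\esum_(z in [set: X * Y]) (f z.1 * g z.2)%:E = \esum_(x in [set: X]) (f x)%:E)%E.
Proof.
move=> f0 g0 g1; rewrite esum_pair/=; last by move=> z; rewrite lee_fin mulr_ge0.
apply: eq_esum => x _; under eq_esum do rewrite EFinM.
by rewrite esumZl// g1 mule1.
Qed.

Lemma esum_pair_right X Y (f : X -> R) (g : Y -> R) :
  (forall x, 0 <= f x) -> (forall y, 0 <= g y) ->
  (\esum_(x in [set: X]) (f x)%:E = 1)%E ->
  (\esum_(z in [set: X * Y]) (f z.1 * g z.2)%:E = \esum_(y in [set: Y]) (g y)%:E)%E.
Proof.
move=> f0 g0 f1; rewrite esum_pair/=; last by move=> z; rewrite lee_fin mulr_ge0.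
rewrite exchange_esum; last by move=> x y; rewrite lee_fin mulr_ge0.
apply: eq_esum => y _; under eq_esum do rewrite mulrC EFinM.
by rewrite esumZl// f1 mule1.
Qed.

Lemma partial_sum_le_esum (g : nat -> R) (c : R) N : (forall k, 0 <= g k) ->
  (\esum_(k in [set: nat]) (g k)%:E = c%:E)%E -> \sum_(k < N) g k <= c.
Proof.
move=> g0 gc; rewrite -lee_fin -gc -nneseries_esumT; last by move=> k;
  rewrite lee_fin.
rewrite -sumEFin -(big_mkord xpredT (fun k => (g k)%:E)).
by apply: nneseries_lim_ge => k _; rewrite lee_fin.
Qed.

Lemma cvg_partial_sum (g : nat -> R) (c : R) : (forall k, 0 <= g k) ->
  (\esum_(k in [set: nat]) (g k)%:E = c%:E)%E ->
  (\sum_(k < N) g k) @[N --> \oo] --> c.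
Proof.
move=> g0 gc; have h : (\sum_(0 <= k < N) (g k)%:E)%E @[N --> \oo] --> c%:E.
  rewrite -gc -nneseries_esumT; last by move=> k; rewrite lee_fin.
  by apply: is_cvg_nneseries => k _ _; rewrite lee_fin.
apply: cvg_trans (fine_cvg h); apply: near_eq_cvg; near=> N.
by rewrite /= sumEFin/= big_mkord.
Unshelve. all: by end_near. Qed.

(** Takes the place of a product measure for the i.i.d. degrees. The product of the partial sums up
    to N is the sum over functions with values below N; every finite set of functions lies in such a
    box, and the products of partial sums converge. *)
Lemma esum_prod_ffun (V : finType) (g : V -> nat -> R) (c : V -> R) :
  (forall v k, 0 <= g v k) ->
  (forall v, \esum_(k in [set: nat]) (g v k)%:E = (c v)%:E)%E ->
  (\esum_(D in [set: {ffun V -> nat}]) (\prod_v g v (D v))%:E = (\prod_v c v)%:E)%E.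
Proof.
move=> g0 gc.
pose P N : R := \prod_v \sum_(k < N) g v k.
have PE N : P N = \sum_(f : {ffun V -> 'I_N}) \prod_v g v (f v).
  exact: bigA_distr_bigA.
pose emb N (f : {ffun V -> 'I_N}) : {ffun V -> nat} := [ffun v => f v : nat].
have emb_inj N : injective (@emb N).
  by move=> f f' /ffunP h; apply/ffunP => v; have := h v;
    rewrite !ffunE => /val_inj.
have prod0 (D : {ffun V -> nat}) : 0 <= \prod_v g v (D v) by exact: prodr_ge0.
apply/eqP; rewrite eq_le; apply/andP; split.
  apply: ge_ereal_sup => _ [A [finA _] <-].
  rewrite fsbig_finite//=.
  rewrite sumEFin lee_fin.
  have := fset_uniq (fset_set A); move: (enum_fset (fset_set A)) => r r_uniq.
  pose N := (\max_(D <- r) \max_v D v)%N.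
  have bnd D v : D \in r -> (D v <= N)%N.
    move=> DA; apply: leq_trans (leq_bigmax v) _.
    exact: (@leq_bigmax_seq _ r xpredT (fun D : {ffun V -> nat} => \max_v D v)%N).
  apply: (@le_trans _ _ (P N.+1)); last first.
    by apply: ler_prod => v _; rewrite sumr_ge0//= partial_sum_le_esum.
  pose res (D : {ffun V -> nat}) : {ffun V -> 'I_N.+1} := [ffun v => inord (D v)].
  have resK D : D \in r -> emb _ (res D) = D.
    by move=> DA; apply/ffunP => v; rewrite !ffunE inordK// ltnS bnd.
  have ur : uniq [seq res D | D <- r].
    rewrite map_inj_in_uniq // => D D' DA D'A e.
    by rewrite -(resK D DA) -(resK D' D'A) e.
  rewrite big_seq (eq_bigr (fun D => \prod_v g v (emb _ (res D) v))); last first.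
    by move=> D DA; rewrite resK.
  rewrite -big_seq -(big_map res xpredT (fun f =>
    \prod_v g v (emb _ f v))) big_uniq//=.
  rewrite PE [leRHS](bigID [in [seq res D | D <- r]])/= -[leLHS]addr0.
  rewrite lerD ?sumr_ge0// => [|f _]; last exact: prodr_ge0.
  by apply: ler_sum => f _; under eq_bigr do rewrite ffunE.
have PN N : ((P N)%:E <= \esum_(D in [set: {ffun V ->
  nat}]) (\prod_v g v (D v))%:E)%E.
  rewrite PE; apply: esum_ge; exists [set` [fset emb N f | f in {ffun V ->
    'I_N}]%fset].
    by split => //; exact: finite_fset.
  rewrite fsbig_finite//= set_fsetK big_imfset/=; last by move=> ? ? _ _;
    apply: emb_inj.
  rewrite big_enum/= sumEFin lee_fin.
  by apply: ler_sum => f _; under [leRHS]eq_bigr do rewrite ffunE.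
have Pc : P N @[N --> \oo] --> \prod_v c v.
  rewrite /P; elim: (index_enum V) => [|v r IH].
    by rewrite big_nil; under eq_fun do rewrite big_nil; exact: cvg_cst.
  rewrite big_cons; under eq_fun do rewrite big_cons.
  by apply: cvgM IH; exact: cvg_partial_sum.
move: PN; case: (\esum_(D in _) _)%E => [r| |] PN; rewrite ?leey//.
  by rewrite lee_fin; apply: cvgr_to_le Pc _; apply: nearW => N; rewrite -lee_fin.
by have := PN 0%N; rewrite leeNy_eq.
Qed.

End DiscreteSums.

(** * Moments of i.i.d. degree sequences *)

Section IidMoments.
Local Open Scope ring_scope.
Variables (R : realType) (V : finType) (p : nat -> R).
Hypotheses (p0 : forall k, 0 <= p k)
  (p1 : (\esum_(k in [set: nat]) (p k)%:E = 1)%E).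
Variables (mu m2 : R).
Hypotheses (p_mu : (\esum_(k in [set: nat]) (p k * k%:R)%:E = mu%:E)%E)
  (p_m2 : (\esum_(k in [set: nat]) (p k * k%:R ^+ 2)%:E = m2%:E)%E).
Implicit Types D : {ffun V -> nat}.

Definition iid_weight D : R := \prod_v p (D v).
Notation w := iid_weight.
Let n : R := #|V|%:R.

Lemma iid_weight_ge0 D : 0 <= w D. Proof. exact: prodr_ge0. Qed.
Hint Resolve iid_weight_ge0 : core.

Lemma iid_total : (\esum_(D in [set: {ffun V -> nat}]) (w D)%:E = 1)%E.
Proof. by rewrite (@esum_prod_ffun _ _ (fun=> p) (fun=> 1))// big1_eq. Qed.

(** Absorbing [f] into the factor at [v0] leaves a product over the coordinates. *)
Lemma iid_coord v0 (f : nat -> R) c : (forall k, 0 <= f k) ->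
  (\esum_(k in [set: nat]) (p k * f k)%:E = c%:E)%E ->
  (\esum_(D in [set: {ffun V -> nat}]) (w D * f (D v0))%:E = c%:E)%E.
Proof.
move=> f0 fc.
pose g v k : R := if v == v0 then p k * f k else p k.
rewrite -[c](_ : \prod_v (if v == v0 then c else 1) = c); last first.
  by rewrite (bigD1 v0)//= eqxx big1 ?mulr1// => v /negPf ->.
rewrite -(@esum_prod_ffun _ V g).
- apply: eq_esum => D _; rewrite /w (bigD1 v0)//= [in RHS](bigD1 v0)//= /g eqxx.
  congr EFin; rewrite mulrAC; congr (_ * _); apply: eq_bigr => v /negPf ->//.
- by move=> v k; rewrite /g; case: ifP => _//; rewrite mulr_ge0.
- by move=> v; rewrite /g; case: ifP.
Qed.

Lemma iid_coord2 v0 v1 : v0 != v1 ->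
  (\esum_(D in [set: {ffun V -> nat}]) (w D * ((D v0)%:R * (D v1)%:R))%:E =
   (mu * mu)%:E)%E.
Proof.
move=> v01; have v10 : v1 != v0 by rewrite eq_sym.
pose g v k : R := if (v == v0) || (v == v1) then p k * k%:R else p k.
rewrite -[mu * mu](_ : \prod_v (if (v == v0) || (v == v1) then mu else 1) = _);
  last first.
  rewrite (bigD1 v0)//= (bigD1 v1)//= !eqxx orbT big1 ?mulr1// => v.
  by move=> /andP[/negPf -> /negPf ->].
rewrite -(@esum_prod_ffun _ V g).
- apply: eq_esum => D _; rewrite /w (bigD1 v0)//= (bigD1 v1)//=.
  rewrite [in RHS](bigD1 v0)//= [in RHS](bigD1 v1)//= /g !eqxx orbT /=.
  rewrite [in RHS](eq_bigr (fun v => p (D v))); last first.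
    by move=> v /andP[/negPf -> /negPf ->].
  by congr EFin; ring.
- by move=> v k; rewrite /g; case: ifP => _//; rewrite mulr_ge0.
- by move=> v; rewrite /g; case: ifP.
Qed.

Lemma esum_iid_sum (I : finType) (F : I -> {ffun V -> nat} -> R) :
  (forall i D, 0 <= F i D) ->
  (\esum_(D in [set: {ffun V -> nat}]) (w D * \sum_i F i D)%:E =
   \sum_i \esum_(D in [set: {ffun V -> nat}]) (w D * F i D)%:E)%E.
Proof.
move=> F0; rewrite -esum_sum; last by move=> D i _ _; rewrite lee_fin mulr_ge0.
by apply: eq_esum => D _; rewrite mulr_sumr -sumEFin.
Qed.

Lemma iid_sum_sqr :
  (\esum_(D in [set: {ffun V -> nat}]) (w D * \sum_v (D v)%:R ^+ 2)%:E =
   (n * m2)%:E)%E.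
Proof.
rewrite (esum_iid_sum (F := fun v D => (D v)%:R ^+ 2)); last by move=> v D;
  rewrite sqr_ge0.
rewrite (eq_bigr (fun=> m2%:E)); last first.
  by move=> v _; rewrite (@iid_coord v (fun k => k%:R ^+ 2) m2).
by rewrite sumEFin sumr_const -mulr_natl.
Qed.

Lemma iid_sum :
  (\esum_(D in [set: {ffun V -> nat}]) (w D * \sum_v (D v)%:R)%:E = (n * mu)%:E)%E.
Proof.
rewrite (esum_iid_sum (F := fun v D => (D v)%:R))//.
rewrite (eq_bigr (fun=> mu%:E)); last first.
  by move=> v _; rewrite (@iid_coord v (fun k => k%:R) mu).
by rewrite sumEFin sumr_const -mulr_natl.
Qed.

Let mu0 : 0 <= mu.
Proof.
rewrite -lee_fin -p_mu; apply: esum_ge0 => k _.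
by rewrite lee_fin mulr_ge0.
Qed.

Lemma iid_sqr_sum_le :
  (\esum_(D in [set: {ffun V -> nat}]) (w D * (\sum_v (D v)%:R) ^+ 2)%:E <=
   (n ^+ 2 * mu ^+ 2 + n * m2)%:E)%E.
Proof.
under eq_esum => D _.
  rewrite expr2 mulr_suml; under eq_bigr do rewrite mulr_sumr.
  rewrite pair_big/=; over.
rewrite (esum_iid_sum (F := fun (i : V * V) D => (D i.1)%:R * (D i.2)%:R));
  last first.
  by move=> i D; rewrite mulr_ge0.
apply: (@le_trans _ _ (\sum_(i : V * V) (mu ^+ 2 + (i.1 == i.2)%:R * m2)%:E)%E).
  apply: lee_sum => -[v v'] _ /=; have [<-|vv'] := eqVneq v v'.
    under eq_esum do rewrite -expr2.
    rewrite (@iid_coord v (fun k => k%:R ^+ 2) m2)//.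
    by rewrite lee_fin /= mul1r lerDr sqr_ge0.
  by rewrite iid_coord2// lee_fin /= mul0r addr0 expr2.
rewrite sumEFin lee_fin big_split/= sumr_const card_prod -mulr_suml.
have -> : \sum_(i : V * V) (i.1 == i.2)%:R = n.
  rewrite -(pair_bigA _ (fun v v' => (v == v')%:R : R))/= /n -sum1_card natr_sum.
  apply: eq_bigr => v _; rewrite (bigD1 v)//= eqxx big1 ?addr0// => v' /negPf.
  by rewrite eq_sym => ->.
by rewrite -[_ *+ (_ * _)]mulr_natl natrM expr2.
Qed.

Lemma iid_variance_le :
  (\esum_(D in [set: {ffun V -> nat}]) (w D * (\sum_v (D v)%:R - n * mu) ^+ 2)%:E <=
   (n * m2)%:E)%E.
Proof.
have n0 : 0 <= n by [].
pose S D : R := \sum_v (D v)%:R.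
have S0 D : 0 <= S D by exact: sumr_ge0.
set L := (X in (X <= _)%E).
(* The cross term of the square is moved to the left, so that all sums have nonnegative terms. *)
have hL : (L + (2 * (n * mu))%:E * (n * mu)%:E =
   \esum_(D in [set: {ffun V -> nat}]) (w D * S D ^+ 2)%:E + ((n * mu) ^+ 2)%:E)%E.
  rewrite -iid_sum -esumZl; last 2 first.
  - by rewrite mulr_ge0 ?mulr_ge0.
  - by move=> D; rewrite lee_fin mulr_ge0// sumr_ge0.
  have -> : (((n * mu) ^+ 2)%:E =
      \esum_(D in [set: {ffun V -> nat}]) (((n * mu) ^+ 2)%:E * (w D)%:E))%E.
    rewrite esumZl ?sqr_ge0//; last by move=> D; rewrite lee_fin.
    by rewrite iid_total mule1.
  have nm0 : 0 <= n * mu by rewrite mulr_ge0.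
  rewrite /L -!esumD; do ?by move=> D _; rewrite -?EFinM lee_fin !mulr_ge0 ?sqr_ge0.
  - by apply: eq_esum => D _; rewrite -!EFinM -!EFinD -/(S D); congr EFin; ring.
  - by move=> D _; rewrite lee_fin mulr_ge0// sqr_ge0.
  - move=> D _; rewrite mule_ge0// lee_fin; first by rewrite mulr_ge0.
    by rewrite mulr_ge0// S0.
have : (L + (2 * (n * mu) * (n * mu))%:E <=
    (n ^+ 2 * mu ^+ 2 + n * m2 + (n * mu) ^+ 2)%:E)%E.
  by rewrite EFinM hL EFinD leeD2r// iid_sqr_sum_le.
rewrite -leeBrDr// -EFinB => /le_trans; apply; rewrite lee_fin.
by rewrite le_eqVlt; apply/orP; left; apply/eqP; ring.
Qed.

End IidMoments.

(** * The law of the repeated configuration model *)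

Section RcmLaw.
Local Open Scope ring_scope.
Variables (R : realType) (V : finType) (p q : nat -> R) (t : R).
Hypotheses (p0 : forall k, 0 <= p k) (q0 : forall k, 0 <= q k)
  (p1 : (\esum_(k in [set: nat]) (p k)%:E = 1)%E)
  (q1 : (\esum_(k in [set: nat]) (q k)%:E = 1)%E).
Variables (mu mp mq : R).
Hypotheses (p_mu : (\esum_(k in [set: nat]) (p k * k%:R)%:E = mu%:E)%E)
  (q_mu : (\esum_(k in [set: nat]) (q k * k%:R)%:E = mu%:E)%E)
  (p_m2 : (\esum_(k in [set: nat]) (p k * k%:R ^+ 2)%:E = mp%:E)%E)
  (q_m2 : (\esum_(k in [set: nat]) (q k * k%:R ^+ 2)%:E = mq%:E)%E).
Implicit Types D : bidegree V.
Let n : R := #|V|%:R.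
Let iid D : R := iid_pmf p q D.

Lemma iid_pmf_ge0 D : 0 <= iid D.
Proof. by rewrite mulr_ge0 ?prodr_ge0. Qed.
Hint Resolve iid_pmf_ge0 : core.

(** A test function for Markov's inequality: with weights suited to an event it is at least 1 there,
    while its mean is at most (A + B) n times the sum of the second moments. *)
Definition deviation (A B : R) D : R :=
  A * (\sum_v (D.1 v)%:R ^+ 2 + \sum_v (D.2 v)%:R ^+ 2) +
  B * ((\sum_v (D.1 v)%:R - n * mu) ^+ 2 + (\sum_v (D.2 v)%:R - n * mu) ^+ 2).

Lemma iid_pmf_total : (\esum_(D in [set: bidegree V]) (iid D)%:E = 1)%E.
Proof.
rewrite (esum_pair_left (f := iid_weight p) (g := iid_weight q)).
- exact: iid_total.
- exact: iid_weight_ge0.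
- exact: iid_weight_ge0.
- exact: iid_total.
Qed.

Lemma iid_deviation (A B : R) : 0 <= A -> 0 <= B ->
  (\esum_(D in [set: bidegree V]) (iid D * deviation A B D)%:E <=
   ((A + B) * (n * (mp + mq)))%:E)%E.
Proof.
move=> A0 B0.
pose f (D : {ffun V -> nat}) : R := A * (\sum_v (D v)%:R ^+ 2) +
  B * (\sum_v (D v)%:R - n * mu) ^+ 2.
have f0 x : 0 <= f x.
  rewrite addr_ge0// mulr_ge0 ?sqr_ge0// sumr_ge0// => v _; exact: sqr_ge0.
have wp := iid_weight_ge0 (V := V) p0; have wq := iid_weight_ge0 (V := V) q0.
have one (r : nat -> R) (m2 : R) :
  (forall k, 0 <= r k) -> (\esum_(k in [set: nat]) (r k)%:E = 1)%E ->
    (\esum_(k in [set: nat]) (r k * k%:R)%:E = mu%:E)%E ->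
    (\esum_(k in [set: nat]) (r k * k%:R ^+ 2)%:E = m2%:E)%E ->
    (\esum_(x in [set: {ffun V -> nat}]) (iid_weight r x * f x)%:E <=
      ((A + B) * (n * m2))%:E)%E.
  move=> r0 r1 rmu rm2; have wr := iid_weight_ge0 (V := V) r0.
  have -> : (\esum_(x in [set: {ffun V -> nat}]) (iid_weight r x * f x)%:E =
     A%:E * (\esum_(x in [set: {ffun V ->
       nat}]) (iid_weight r x * \sum_v (x v)%:R ^+ 2)%:E) +
     B%:E * (\esum_(x in [set: {ffun V ->
       nat}]) (iid_weight r x * (\sum_v (x v)%:R - n * mu) ^+ 2)%:E))%E.
    have h1 (x : {ffun V -> nat}) : 0 <= iid_weight r x * \sum_v (x v)%:R ^+ 2.
      by rewrite mulr_ge0// sumr_ge0// => v _; exact: sqr_ge0.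
    have h2 (x : {ffun V -> nat}) : 0 <=
      iid_weight r x * (\sum_v (x v)%:R - n * mu) ^+ 2.
      by rewrite mulr_ge0// sqr_ge0.
    rewrite -!esumZl//.
    rewrite -esumD; last 2 first.
    - by move=> x _; apply: mule_ge0; rewrite ?lee_fin ?h1.
    - by move=> x _; apply: mule_ge0; rewrite ?lee_fin ?h2.
    by apply: eq_esum => x _; rewrite -!EFinM -EFinD; congr EFin; rewrite /f; ring.
  rewrite (iid_sum_sqr V r0 r1 rm2) mulrDl EFinD EFinM leeD//.
  rewrite EFinM lee_wpmul2l ?lee_fin//.
  exact: (iid_variance_le V r0 r1 rmu rm2).
have -> : (\esum_(D in [set: bidegree V]) (iid D * deviation A B D)%:E =
   (\esum_(D in [set: bidegree V]) ((iid_weight p D.1 * f D.1) * iid_weight q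
     D.2)%:E) +
   \esum_(D in [set: bidegree V]) (iid_weight p D.1 * (iid_weight q D.2 * f
     D.2))%:E)%E.
  rewrite -esumD; do ?by move=> D _; rewrite lee_fin !mulr_ge0.
  apply: eq_esum => D _; rewrite -EFinD; congr EFin.
  by rewrite /deviation /f /iid /iid_pmf /iid_weight; ring.
rewrite (esum_pair_left (f := fun x => iid_weight p x * f x) (g :=
  iid_weight q)); last 3 first.
- by move=> D; rewrite mulr_ge0.
- by [].
- exact: iid_total.
rewrite (esum_pair_right (f := iid_weight p) (g :=
  fun x => iid_weight q x * f x)); last 3 first.
- by [].
- by move=> D; rewrite mulr_ge0.
- exact: iid_total.
rewrite mulrDr mulrDr EFinD leeD// one//.
Qed.

Lemma iid_event (A B : R) (P : pred (bidegree V)) : 0 <= A -> 0 <= B ->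
  (forall D, P D -> 1 <= deviation A B D) ->
  (\esum_(D in [set: bidegree V]) (iid D * (P D)%:R)%:E <=
   ((A + B) * (n * (mp + mq)))%:E)%E.
Proof.
move=> A0 B0 PD; apply: le_trans (iid_deviation A0 B0).
apply: le_esum => D _; rewrite lee_fin ler_wpM2l//.
case: (boolP (P D)) => [/PD//|_].
by rewrite /deviation addr_ge0// mulr_ge0// addr_ge0 ?sqr_ge0//;
  rewrite sumr_ge0// => v _; exact: sqr_ge0.
Qed.

Let acc_esum : \bar R := (\esum_(D in [set D | accepted t D]%classic) (iid D)%:E)%E.
Let Z : R := fine acc_esum.

Let acc_esumE : acc_esum = (\esum_(D in [set: bidegree V]) (iid D * (accepted t
  D)%:R)%:E)%E.
Proof.
rewrite /acc_esum esum_mkcond; apply: eq_esum => D _;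
  have [a|a] := boolP (accepted t D).
  by rewrite mem_set// mulr1.
by rewrite memNset ?mulr0//=; exact/negP.
Qed.

Let acc_le1 : (acc_esum <= 1)%E.
Proof.
rewrite acc_esumE -iid_pmf_total; apply: le_esum => D _; rewrite lee_fin.
by rewrite ler_piMr//; case: (accepted t D).
Qed.

Let acc_fin : Z%:E = acc_esum.
Proof.
rewrite fineK// fin_numElt (le_lt_trans acc_le1) ?ltry// andbT.
by apply: (@lt_le_trans _ _ 0%E) => //; apply: esum_ge0 => D _; rewrite lee_fin.
Qed.

(** Chebyshev's inequality for the imbalance: the common mean cancels, and (x - y)^2 is at most
    twice the sum of the two squared deviations from it. *)
Lemma accepted_total_ge : 0 < t -> 1 - 2 / t ^+ 2 * (n * (mp + mq)) <= Z.
Proof.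
move=> t0; rewrite -lee_fin acc_fin EFinB leeBlDr//.
rewrite -iid_pmf_total.
have -> : (\esum_(D in [set: bidegree V]) (iid D)%:E =
  acc_esum + \esum_(D in [set: bidegree V]) (iid D * (~~ accepted t D)%:R)%:E)%E.
  rewrite acc_esumE -esumD; do ?by move=> D _; rewrite lee_fin mulr_ge0.
  apply: eq_esum => D _; rewrite -EFinD -mulrDr.
  by case: (accepted t D); rewrite /= ?addr0 ?add0r mulr1.
rewrite leeD2l//; have := @iid_event 0 (2 / t ^+ 2) (fun D => ~~ accepted t D).
rewrite add0r; apply => //; first by rewrite divr_ge0// sqr_ge0.
move=> D; rewrite /accepted -ltNge /imbalance /deviation mul0r add0r.
rewrite intr_norm rmorphB/= -!pmulrn !natr_sum.
set x := \sum_v _; set y := \sum_v _ => h.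
rewrite mulrAC ler_pdivlMr ?exprn_gt0// mul1r.
have : t ^+ 2 < (x - y) ^+ 2.
  by rewrite -[ltRHS]real_normK ?num_real// ltr_sqr ?nnegrE// ltW.
have := sqr_ge0 ((x - n * mu) + (y - n * mu)); nra.
Qed.

Hypothesis Z_ge : 2^-1 <= Z.
Let Z_gt0 : 0 < Z. Proof. by apply: lt_le_trans Z_ge; rewrite invr_gt0. Qed.
Let acc D : R := accepted_pmf p q t D.

Let accE D : acc D = Z^-1 * (iid D * (accepted t D)%:R).
Proof. by rewrite /acc /accepted_pmf -/acc_esum -/Z mulrC [_%:R * _]mulrC. Qed.

Let acc_ge0 D : 0 <= acc D.
Proof. by rewrite accE mulr_ge0 ?invr_ge0 ?(ltW Z_gt0)//
  (mulr_ge0 (iid_pmf_ge0 D)). Qed.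
Hint Resolve acc_ge0 : core.

Lemma accepted_pmf_total : (\esum_(D in [set: bidegree V]) (acc D)%:E = 1)%E.
Proof.
under eq_esum do rewrite accE EFinM.
rewrite esumZl; last 2 first.
- by rewrite invr_ge0 ltW.
- by move=> D; rewrite lee_fin mulr_ge0.
by rewrite -acc_esumE -acc_fin -EFinM mulVf// gt_eqF.
Qed.

(** Acceptance has probability at least 1/2, so conditioning on it at most doubles probabilities. *)
Lemma accepted_event (A B : R) (P : pred (bidegree V)) : 0 <= A -> 0 <= B ->
  (forall D, P D -> 1 <= deviation A B D) ->
  (\esum_(D in [set: bidegree V]) (acc D * (P D)%:R)%:E <=
   (2 * ((A + B) * (n * (mp + mq))))%:E)%E.
Proof.
move=> A0 B0 PD.
apply: (@le_trans _ _ (\esum_(D in [set: bidegree V]) (2%:E * (iid D * (P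
  D)%:R)%:E))%E).
  apply: le_esum => D _; rewrite -EFinM lee_fin accE.
  rewrite -mulrA; apply: ler_pM; rewrite ?invr_ge0 ?(ltW Z_gt0)//.
  - by rewrite (mulr_ge0 (mulr_ge0 (iid_pmf_ge0 D) _)).
  - by rewrite -[2]invrK lef_pV2// posrE invr_gt0.
  - by rewrite -mulrA ler_wpM2l// ler_piMl//; case: (accepted t D).
rewrite esumZl//; last by move=> D; rewrite lee_fin mulr_ge0.
by rewrite EFinM lee_wpmul2l ?lee_fin// iid_event.
Qed.

Let bal D : R := balanced_pmf p q t D.
Let k D := `|imbalance D|%N.
Let sub_sets D : {set {set V}} := [set S : {set V} | #|S| == k D]%SET.

(** Mean of [phi] over the random choice of the vertices that receive a stub; it is 0 when more
    vertices are required than exist. *)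
Definition balance_avg (phi : bidegree V -> R) D : R :=
  (\sum_(S in sub_sets D) phi (balance D S)) / 'C(#|V|, k D)%:R.

Lemma esum_point (T : choiceType) (f : T -> R) (b : T) : 0 <= f b ->
  (\esum_(x in [set: T]) (f x * (b == x)%:R)%:E = (f b)%:E)%E.
Proof.
move=> fb; rewrite -(@esum_set1 _ _ b (fun x => (f x)%:E)) ?lee_fin//.
rewrite [RHS]esum_mkcond; apply: eq_esum => x _.
have [<-|bx] := eqVneq b x; first by rewrite mem_set ?mulr1.
by rewrite memNset ?mulr0//= => xb; rewrite xb eqxx in bx.
Qed.

Let ratio D' D : R := #|[set S : {set V} | (#|S| == k D') &&
  (balance D' S == D)]%SET|%:R / 'C(#|V|, k D')%:R.

Let ratioE D' D : ratio D' D = balance_avg (fun D'' => (D'' == D)%:R) D'.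
Proof.
rewrite /ratio /balance_avg; congr (_ / _).
rewrite -sum1_card natr_sum big_mkcond [RHS]big_mkcond/=; apply: eq_bigr => S _.
by rewrite !inE; case: (_ == k D') => //=; case: (_ == D).
Qed.

Let ratio_ge0 D' D : 0 <= ratio D' D. Proof. exact: divr_ge0. Qed.

Let ratio_le1 D' D : ratio D' D <= 1.
Proof.
rewrite /ratio; have [->|C0] := eqVneq 'C(#|V|, k D')%:R (0 : R).
  by rewrite invr0 mulr0.
rewrite ler_pdivrMr ?mul1r; last by rewrite lt_def C0 ler0n.
rewrite ler_nat -card_draws subset_leq_card//; apply/fintype.subsetP => S.
by rewrite !inE => /andP[].
Qed.

Let balE D : (bal D)%:E = (\esum_(D' in [set: bidegree V]) (acc D' * ratio D'
  D)%:E)%E.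
Proof.
rewrite /bal /balanced_pmf fineK// fin_numElt; apply/andP; split.
  apply: (@lt_le_trans _ _ 0%E) => //; apply: esum_ge0 => D' _.
  by rewrite lee_fin (mulr_ge0 (acc_ge0 _) (ratio_ge0 _ _)).
apply: (@le_lt_trans _ _ 1%E); last exact: ltry.
rewrite -accepted_pmf_total; apply: le_esum => D' _; rewrite lee_fin ler_piMr//.
exact: ratio_le1.
Qed.

Let bal_ge0 D : 0 <= bal D.
Proof.
by rewrite -lee_fin balE esum_ge0// => D' _; rewrite lee_fin mulr_ge0// ratio_ge0.
Qed.
Hint Resolve bal_ge0 : core.

(** Change of variables: the balanced law is the image of the accepted one under a random map, and
    the sums over sequences before and after balancing are exchanged. *)
Lemma esum_balanced (phi : bidegree V -> R) : (forall D, 0 <= phi D) ->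
  (\esum_(D in [set: bidegree V]) (bal D * phi D)%:E =
   \esum_(D' in [set: bidegree V]) (acc D' * balance_avg phi D')%:E)%E.
Proof.
move=> phi0.
transitivity (\esum_(D in [set: bidegree V]) \esum_(D' in [set: bidegree V])
    (phi D * (acc D' * ratio D' D))%:E)%E.
  apply: eq_esum => D _; rewrite EFinM balE muleC -esumZl//.
  by move=> D'; rewrite lee_fin mulr_ge0// ratio_ge0.
rewrite exchange_esum; last first.
  by move=> D D'; rewrite lee_fin (mulr_ge0 (phi0 _) (mulr_ge0 (acc_ge0 _)
    (ratio_ge0 _ _))).
apply: eq_esum => D' _; set C : R := 'C(#|V|, k D')%:R.
transitivity (\esum_(D in [set: bidegree V]) (\sum_(S in sub_sets D')
    (acc D' * (phi D / C) * (balance D' S == D)%:R)%:E))%E.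
  apply: eq_esum => D _; rewrite sumEFin -mulr_sumr ratioE /balance_avg -/C.
  by congr EFin; ring.
rewrite esum_sum; last first.
  by move=> D S _ _; rewrite lee_fin mulr_ge0// (mulr_ge0 (acc_ge0 _))// divr_ge0.
transitivity (\sum_(S in sub_sets D') (acc D' * (phi (balance D' S) / C))%:E)%E.
  apply: eq_bigr => S _; apply: (@esum_point _ (fun D => acc D' * (phi D / C))).
  by rewrite (mulr_ge0 (acc_ge0 _))// divr_ge0.
by rewrite sumEFin -mulr_sumr -mulr_suml.
Qed.

Lemma balanced_event (P P' : pred (bidegree V)) :
  (forall D' (S : {set V}), #|S| = k D' -> P (balance D' S) -> P' D') ->
  (\esum_(D in [set: bidegree V]) (bal D * (P D)%:R)%:E <=
   \esum_(D in [set: bidegree V]) (acc D * (P' D)%:R)%:E)%E.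
Proof.
move=> PP; rewrite esum_balanced//; apply: le_esum => D _.
rewrite lee_fin ler_wpM2l//.
apply: (@le_trans _ _ ((P' D)%:R * ('C(#|V|, k D)%:R / 'C(#|V|, k D)%:R)));
  last first.
  rewrite ler_piMr//; have [->|C0] := eqVneq 'C(#|V|, k D)%:R (0 : R).
    by rewrite invr0 mulr0.
  by rewrite divff.
rewrite /balance_avg mulrA ler_wpM2r ?invr_ge0//.
rewrite -card_draws mulrC mulr_natl -sumr_const; apply: ler_sum => S.
rewrite inE => /eqP Sk; case: (boolP (P _)) => [/(PP _ _ Sk) ->//|_].
by case: (P' D).
Qed.

Hypothesis t_le : t <= n.

(** No mass is lost because [t_le] gives an accepted imbalance at most [#|V|], so that the binomial
    coefficient is positive. *)
Lemma balanced_pmf_total : (\esum_(D in [set: bidegree V]) (bal D)%:E = 1)%E.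
Proof.
transitivity (\esum_(D in [set: bidegree V]) (bal D * 1)%:E)%E.
  by apply: eq_esum => D _; rewrite mulr1.
rewrite (esum_balanced (phi := fun=> 1))// -accepted_pmf_total.
apply: eq_esum => D _; congr EFin.
have [a|na] := boolP (accepted t D); last first.
  by rewrite accE (negPf na) !mulr0 mul0r.
rewrite /balance_avg sumr_const card_draws divff ?mulr1//.
rewrite pnatr_eq0 -lt0n bin_gt0.
rewrite -(ler_nat R) -/n; apply: le_trans t_le; move: a.
by rewrite /accepted -abszE -pmulrn.
Qed.

Let cm_term (B : pred (digraph V)) D : R :=
  #|[set m in matchings D | B (matched_graph m)]%SET|%:R / #|matchings D|%:R.

Let cm_term_ge0 B D : 0 <= cm_term B D. Proof. exact: divr_ge0. Qed.

Let cm_term_le1 B D : cm_term B D <= 1.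
Proof.
rewrite /cm_term; have [->|C0] := eqVneq #|matchings D|%:R (0 : R).
  by rewrite invr0 mulr0.
rewrite ler_pdivrMr ?mul1r; last by rewrite lt_def C0 ler0n.
rewrite ler_nat subset_leq_card//; apply/fintype.subsetP => m.
by rewrite [in X in X -> _]finset.in_set => /andP[].
Qed.

Let esum_bal_fin (phi : bidegree V -> R) : (forall D, 0 <= phi D <= 1) ->
  (fine (\esum_(D in [set: bidegree V]) (bal D * phi D)%:E))%:E =
  (\esum_(D in [set: bidegree V]) (bal D * phi D)%:E)%E.
Proof.
move=> phi01; rewrite fineK// fin_numElt; apply/andP; split.
  apply: (@lt_le_trans _ _ 0%E) => //; apply: esum_ge0 => D _.
  by rewrite lee_fin mulr_ge0//; case/andP: (phi01 D).
apply: (@le_lt_trans _ _ 1%E); last exact: ltry.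
rewrite -balanced_pmf_total; apply: le_esum => D _; rewrite lee_fin ler_piMr//.
by case/andP: (phi01 D).
Qed.

Lemma cm_probE (B : pred (digraph V)) :
  (cm_prob p q t B)%:E = (\esum_(D in [set: bidegree V]) (bal D * cm_term B
    D)%:E)%E.
Proof.
rewrite -(esum_bal_fin (phi := cm_term B))// => D; apply/andP; split.
  exact: cm_term_ge0.
exact: cm_term_le1.
Qed.

Lemma cm_simple_term D :
  cm_term (@simple V) D = #|simple_matchings D|%:R / #|matchings D|%:R.
Proof.
rewrite /cm_term; congr (_%:R / _); apply: eq_card => m.
by rewrite [in LHS]finset.in_set simple_matchingsE.
Qed.

Lemma cm_simple_sum (h : {set V * V} -> R) : (forall A, 0 <= h A) ->
  ((\sum_A cm_prob p q t (fun H => simple H && (arcs H == A)) * h A)%:E =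
   \esum_(D in [set: bidegree V]) (bal D *
     ((\sum_(m in simple_matchings D) h (arcs (matched_graph m))) /
       #|matchings D|%:R))%:E)%E.
Proof.
move=> h0; rewrite -sumEFin.
have hE A : ((cm_prob p q t (fun H => simple H && (arcs H == A)) * h A)%:E =
    \esum_(D in [set: bidegree V]) (h A * (bal D *
      cm_term (fun H => simple H && (arcs H == A)) D))%:E)%E.
  rewrite EFinM muleC cm_probE -esumZl// => D.
  by rewrite lee_fin (mulr_ge0 (bal_ge0 D) (cm_term_ge0 _ _)).
under eq_bigr do rewrite hE.
rewrite -esum_sum; last first.
  move=> D A _ _; rewrite lee_fin.
  by rewrite (mulr_ge0 (h0 A) (mulr_ge0 (bal_ge0 D) (cm_term_ge0 _ _))).
apply: eq_esum => D _.
rewrite sumEFin; congr EFin.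
rewrite (partition_big (fun m =>
  arcs (matched_graph m)) predT)//= mulr_suml mulr_sumr.
apply: eq_bigr => A _.
rewrite (eq_bigr (fun=> h A)); last by move=> m /andP[_ /eqP ->].
rewrite sumr_const /cm_term.
have -> : #|[set m in matchings D | simple (matched_graph m) && (arcs
  (matched_graph m) == A)]%SET| =
    #|[pred m | (m \in simple_matchings D) && (arcs (matched_graph m) == A)]|.
  by apply: eq_card => m; rewrite [in LHS]finset.in_set andbA -simple_matchingsE.
by rewrite -[h A *+ _]mulr_natl; ring.
Qed.

(** [good0] has probability at least 1/2 and bounds the probability of simplicity below by c0 / 2;
    dividing by it turns the exceptional mass [bta] of [good] into 2 bta / c0. With two separate
    events, [c0] can be fixed before [bta] is chosen. *)
Lemma rcm_sum_le (good0 good : pred (bidegree V)) (c0 eta bta : R)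
    (h : {set V * V} -> R) :
  0 < c0 -> 0 <= eta -> 0 <= bta ->
  (forall A, 0 <= h A <= 1) ->
  (forall D, good0 D -> (0 < #|matchings D|)%N /\
     c0 * #|matchings D|%:R <= #|simple_matchings D|%:R) ->
  (forall D, good D -> \sum_(m in simple_matchings D) h (arcs (matched_graph m)) <=
     eta * #|simple_matchings D|%:R) ->
  (\esum_(D in [set: bidegree V]) (bal D * (~~ good0 D)%:R)%:E <= (2^-1)%:E)%E ->
  (\esum_(D in [set: bidegree V]) (bal D * (~~ good D)%:R)%:E <= bta%:E)%E ->
  \sum_A rcm_pmf p q t A * h A <= eta + 2 * bta / c0.
Proof.
move=> c00 e0 b0 h01 g0 g b0le ble.
have h0 A : 0 <= h A by case/andP: (h01 A).
pose Zs := cm_prob p q t (@simple V).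
have ZsE : (Zs%:E = \esum_(D in [set: bidegree V])
    (bal D * (#|simple_matchings D|%:R / #|matchings D|%:R))%:E)%E.
  by rewrite cm_probE; apply: eq_esum => D _; rewrite cm_simple_term.
have Zs_ge : c0 / 2 <= Zs.
  have H : (c0%:E * (\esum_(D in [set: bidegree V]) (bal D)%:E) <=
     (\esum_(D in [set: bidegree V]) (bal D * (#|simple_matchings D|%:R /
       #|matchings D|%:R))%:E) +
     c0%:E * \esum_(D in [set: bidegree V]) (bal D * (~~ good0 D)%:R)%:E)%E.
    rewrite -!esumZl ?(ltW c00)//; last first.
      by move=> D; rewrite lee_fin mulr_ge0.
    rewrite -esumD; last 2 first.
    - by move=> D _; rewrite lee_fin mulr_ge0// divr_ge0.
    - by move=> D _; rewrite -EFinM lee_fin (mulr_ge0 (ltW c00))// mulr_ge0.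
    apply: le_esum => D _; rewrite -!EFinM -EFinD lee_fin.
    rewrite [leLHS]mulrC [X in _ + X]mulrCA -mulrDr ler_wpM2l//.
    case: (boolP (good0 D)) => [/g0[M0 hM]|_]; last first.
      by rewrite mulr1 lerDr divr_ge0.
    by rewrite mulr0 addr0 ler_pdivlMr ?ltr0n.
  rewrite balanced_pmf_total mule1 in H.
  have : (c0%:E <= Zs%:E + c0%:E * (2^-1)%:E)%E.
    by apply: le_trans H _; rewrite ZsE leeD2l// lee_wpmul2l// lee_fin (ltW c00).
  by rewrite -EFinM -EFinD lee_fin; lra.
have Zs_gt0 : 0 < Zs by apply: lt_le_trans Zs_ge; rewrite divr_gt0.
under eq_bigr do rewrite /rcm_pmf -/Zs mulrAC.
rewrite -mulr_suml ler_pdivrMr//.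
have main : \sum_A cm_prob p q t (fun H => simple H && (arcs H == A)) * h A <=
  eta * Zs + bta.
  rewrite -lee_fin cm_simple_sum// EFinD EFinM ZsE.
  apply: (@le_trans _ _ (eta%:E * (\esum_(D in [set: bidegree V])
    (bal D * (#|simple_matchings D|%:R / #|matchings D|%:R))%:E) +
    \esum_(D in [set: bidegree V]) (bal D * (~~ good D)%:R)%:E))%E;
      last by rewrite leeD2l.
  rewrite -esumZl//; last by move=> D; rewrite lee_fin mulr_ge0// divr_ge0.
  rewrite -esumD; last 2 first.
  - by move=> D _; rewrite -EFinM lee_fin (mulr_ge0 e0)//
    (mulr_ge0 (bal_ge0 D))// divr_ge0.
  - by move=> D _; rewrite lee_fin mulr_ge0.
  apply: le_esum => D _; rewrite -EFinD lee_fin [X in _ <=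
    X + _]mulrCA -mulrDr ler_wpM2l//.
  case: (boolP (good D)) => [/g hg|_];
    first by rewrite addr0 mulrA ler_wpM2r// invr_ge0.
  rewrite -[leLHS]add0r lerD//; first by rewrite mulr_ge0// divr_ge0.
  apply: (@le_trans _ _ (cm_term (@simple V) D)); last exact: cm_term_le1.
  rewrite cm_simple_term ler_wpM2r ?invr_ge0// -sum1_card natr_sum.
  by apply: ler_sum => m _; case/andP: (h01 (arcs (matched_graph m))).
apply: le_trans main _; rewrite mulrDl lerD2l.
rewrite mulrAC ler_pdivlMr//; nra.
Qed.

End RcmLaw.

(** * Tameness before and after balancing *)

Section Balancing.
Local Open Scope ring_scope.
Variables (R : realType) (V : finType).
Implicit Types (D : bidegree V) (S : {set V}).
Let n : R := #|V|%:R.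

Definition raw_tame (C c delta : R) D : bool :=
  [&& c * n <= (\sum_x D.2 x)%:R,
      \sum_x (D.1 x)%:R ^+ 2 <= C * n,
      \sum_x (D.2 x)%:R ^+ 2 <= C * n,
      [forall x, (D.1 x)%:R <= delta * n] &
      [forall x, (D.2 x)%:R <= delta * n]].

Lemma sum_indicator S : (\sum_x (x \in S))%N = #|S|.
Proof. by rewrite -sum1_card [RHS]big_mkcond; apply: eq_bigr => x _; case: ifP. Qed.

Lemma balance_total D S : #|S| = `|imbalance D|%N ->
  (\sum_x (balance D S).1 x = \sum_x (balance D S).2 x)%N.
Proof.
move=> Sk; rewrite /balance; case: ifPn => [h|]; last rewrite -ltNge => h.
  rewrite /=; under [RHS]eq_bigr do rewrite ffunE.
  rewrite big_split/= sum_indicator Sk; move: h; rewrite /imbalance; lia.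
rewrite /=; under [LHS]eq_bigr do rewrite ffunE.
rewrite big_split/= sum_indicator Sk; move: h; rewrite /imbalance; lia.
Qed.

Lemma balance_ge D S x : (D.1 x <= (balance D S).1 x <= D.1 x + 1)%N /\
  (D.2 x <= (balance D S).2 x <= D.2 x + 1)%N.
Proof.
by rewrite /balance; case: ifP => _ /=; rewrite ?ffunE; case: (x \in S); lia.
Qed.

(** Balancing raises each degree by at most 1: squares obey (a + 1)^2 <= 2 a^2 + 2, and half of
    delta n leaves room for the 1. *)
Lemma balance_tame (C c delta : R) D S : #|S| = `|imbalance D|%N ->
  2 <= delta * n -> raw_tame C c (delta / 2) D ->
  tame (2 * C + 2) c delta (balance D S).
Proof.
move=> Sk dn /and5P[hE Q1 Q2 /forallP d1 /forallP d2].
have sq (a b : nat) : (b <= a + 1)%N -> b%:R ^+ 2 <= 2 * a%:R ^+ 2 + 2 :> R.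
  move=> ba; have : b%:R <= a%:R + 1 :> R by rewrite natr1 ler_nat -addn1.
  have : 0 <= b%:R :> R by [].
  have := sqr_ge0 (a%:R - 1 : R); nra.
have sumsq (f g : V -> nat) : (forall x, g x <= f x + 1)%N ->
    \sum_x (f x)%:R ^+ 2 <= C * n -> \sum_x (g x)%:R ^+ 2 <= (2 * C + 2) * n.
  move=> gf Q; apply: (@le_trans _ _ (\sum_x (2 * (f x)%:R ^+ 2 + 2))).
    by apply: ler_sum => x _; exact: sq.
  rewrite big_split/= -mulr_sumr sumr_const -[_ *+ #|_|]mulr_natl -/n; lra.
have bnd (a b : nat) : (b <= a + 1)%N -> a%:R <= delta / 2 * n -> b%:R <= delta * n.
  by move=> ba; have : b%:R <= a%:R + 1 :> R; [rewrite natr1 ler_nat -addn1|lra].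
apply/and5P; split.
- exact/eqP/balance_total.
- apply: le_trans hE _; rewrite ler_nat; apply: leq_sum => x _.
  by have [_ /andP[]] := balance_ge D S x.
- apply: sumsq Q1 => x; by have [/andP[]] := balance_ge D S x.
- apply: sumsq Q2 => x; by have [_ /andP[]] := balance_ge D S x.
- apply/andP; split; apply/forallP => x.
    by apply: bnd (d1 x); have [/andP[]] := balance_ge D S x.
  by apply: bnd (d2 x); have [_ /andP[]] := balance_ge D S x.
Qed.

(** The weights are reciprocals of the thresholds, so each failing condition alone makes one summand
    at least 1: a large sum of squares, one degree whose square exceeds (delta n)^2, or an
    out-degree total at distance more than mu n / 2 from its mean. *)
Lemma not_raw_tame_deviation (mu C delta : R) D :
  0 < mu -> 0 < C -> 0 < delta -> 0 < n ->
  ~~ raw_tame C (mu / 2) delta D ->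
  1 <= deviation mu ((C * n)^-1 + ((delta * n) ^+ 2)^-1) (4 / (mu * n) ^+ 2) D.
Proof.
move=> mu0 C0 d0 n0.
have Cn : 0 < C * n by rewrite mulr_gt0.
have dn : 0 < (delta * n) ^+ 2 by rewrite exprn_gt0// mulr_gt0.
have mn : 0 < (mu * n) ^+ 2 by rewrite exprn_gt0// mulr_gt0.
rewrite /deviation -/n.
set X := \sum_v (D.1 v)%:R ^+ 2; set Y := \sum_v (D.2 v)%:R ^+ 2.
set a := (\sum_v (D.1 v)%:R - _) ^+ 2; set b := (_ - _) ^+ 2.
have X0 : 0 <= X by apply: sumr_ge0 => v _; exact: sqr_ge0.
have Y0 : 0 <= Y by apply: sumr_ge0 => v _; exact: sqr_ge0.
have a0 : 0 <= a by exact: sqr_ge0.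
have b0 : 0 <= b by exact: sqr_ge0.
have Ci : 0 < (C * n)^-1 by rewrite invr_gt0.
have di : 0 < ((delta * n) ^+ 2)^-1 by rewrite invr_gt0.
have mi : 0 < 4 / (mu * n) ^+ 2 by rewrite divr_gt0.
have hX : 0 <= (C * n)^-1 * (X + Y) by rewrite (mulr_ge0 (ltW Ci))// addr_ge0.
have hd : 0 <= ((delta * n) ^+ 2)^-1 * (X +
  Y) by rewrite (mulr_ge0 (ltW di))// addr_ge0.
have hm : 0 <= 4 / (mu * n) ^+ 2 * (a +
  b) by rewrite (mulr_ge0 (ltW mi))// addr_ge0.
have key (i x y : R) : 0 < i -> i^-1 < x -> 0 <= y -> 1 <= i * (x + y).
  move=> i0 ix y0; rewrite -(divff (lt0r_neq0 i0)) ler_pM2l//.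
  by apply: ltW; apply: lt_le_trans ix _; rewrite lerDl.
have big (f : V -> nat) x : ~~ ((f x)%:R <= delta * n) ->
    (delta * n) ^+ 2 < \sum_v (f v)%:R ^+ 2.
  rewrite -ltNge => h; rewrite (bigD1 x)//=;
    apply: (@lt_le_trans _ _ ((f x)%:R ^+ 2)).
    by rewrite ltr_sqr ?nnegrE// mulr_ge0 ?(ltW d0) ?(ltW n0).
  by rewrite lerDl sumr_ge0// => v _; exact: sqr_ge0.
rewrite mulrDl /raw_tame !negb_and => /or4P[h|h|h|/orP[/forallPn[x]|/forallPn[x]]].
- suff : 1 <= 4 / (mu * n) ^+ 2 * (a + b) by lra.
  rewrite addrC; apply: key => //.
  rewrite invf_div ltr_pdivrMr// /b -natr_sum.
  move: h; rewrite -ltNge => h.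
  have : mu * n / 2 < n * mu - (\sum_v D.2 v)%:R by lra.
  set z := (\sum_v D.2 v)%:R; have : 0 < mu * n by rewrite mulr_gt0.
  nra.
- have := key _ X Y Ci; rewrite invrK => /(_ _ Y0); rewrite ltNge h => /(_ isT);
  lra.
- have := key _ Y X Ci; rewrite invrK addrC => /(_ _ X0);
  rewrite ltNge h => /(_ isT); lra.
- move=> /big h; have := key _ X Y di; rewrite invrK => /(_ h Y0); lra.
- move=> /big h; have := key _ Y X di; rewrite invrK addrC => /(_ h X0); lra.
Qed.

End Balancing.

(** * Order of the constants and the limit in n *)

Section Asymptotics.
Local Open Scope ring_scope.
Variable R : realType.

Lemma exists_nat_ge (x : R) : exists N : nat, forall n, (N <= n)%N -> x <= n%:R.
Proof.
exists (Num.truncn x).+1 => n Nn; apply: (@le_trans _ _ (Num.truncn x).+1%:R).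
  by apply: ltW; exact: truncnS_gt.
by rewrite ler_nat.
Qed.

(** Since kappa <= 1/2, the square of the threshold is at least n times n^(2 delta0), which beats
    the variance of order n; since delta0 < kappa, the threshold is at most n. *)
Lemma threshold_bounds (kappa delta0 M : R) : 0 <= M ->
  kappa <= 2^-1 -> 0 < delta0 -> delta0 < kappa ->
  exists N : nat, forall n : nat, (N <= n)%N ->
  let t := n%:R `^ (1 - kappa + delta0) in
  [/\ 0 < t, t <= n%:R & 2 / t ^+ 2 * (n%:R * M) <= 2^-1].
Proof.
move=> M0 k2 d0 dk.
have [N1 H1] := exists_nat_ge 1.
have [N2 H2] := exists_nat_ge ((4 * M + 1) `^ (2 * delta0)^-1).
exists (maxn N1 N2) => n; rewrite geq_max => /andP[/H1 n1 /H2 n2] t.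
have n0 : 0 < n%:R :> R by lra.
have t0 : 0 < t by rewrite powR_gt0.
split=> //; first by rewrite -[leRHS]powRr1 ?(ltW n0)// ler_powR//; lra.
have M1 : 0 < 4 * M + 1 by lra.
have h1 : 4 * M + 1 <= n%:R `^ (2 * delta0).
  have d20 : 0 < 2 * delta0 by rewrite mulr_gt0.
  have := ge0_ler_powR (ltW d20) (powR_ge0 _ _) (ltW n0) n2.
  by rewrite -powRrM mulVf ?gt_eqF// powRr1// ltW.
have h2 : n%:R * n%:R `^ (2 * delta0) <= t ^+ 2.
  rewrite -{1}[n%:R]powRr1 ?(ltW n0)// -powRD; last by rewrite (gt_eqF n0) implybT.
  by rewrite -powR_mulrn ?(ltW t0)// /t -powRrM ler_powR//; lra.
rewrite mulrAC ler_pdivrMr ?exprn_gt0//; nra.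
Qed.

Variables (p q : nat -> R).
Hypotheses (p0 : forall k, 0 <= p k) (q0 : forall k, 0 <= q k)
  (p1 : (\esum_(k in [set: nat]) (p k)%:E = 1)%E)
  (q1 : (\esum_(k in [set: nat]) (q k)%:E = 1)%E).
Variables (mu mp mq : R).
Hypotheses (mu_gt0 : 0 < mu)
  (p_mu : (\esum_(k in [set: nat]) (p k * k%:R)%:E = mu%:E)%E)
  (q_mu : (\esum_(k in [set: nat]) (q k * k%:R)%:E = mu%:E)%E)
  (p_m2 : (\esum_(k in [set: nat]) (p k * k%:R ^+ 2)%:E = mp%:E)%E)
  (q_m2 : (\esum_(k in [set: nat]) (q k * k%:R ^+ 2)%:E = mq%:E)%E).
Variables (kappa delta0 : R).
Hypotheses (kappa_le : kappa <= 2^-1) (delta0_gt0 : 0 < delta0)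
  (delta0_lt : delta0 < kappa).
Let M := mp + mq.
Let t (n : nat) : R := n%:R `^ (1 - kappa + delta0).
Variables (V : nat -> finType).
Hypothesis card_V : forall n, #|V n| = n.

Let M_ge0 : 0 <= M.
Proof.
have m0 (r : nat -> R) m : (forall k, 0 <= r k) ->
    (\esum_(k in [set: nat]) (r k * k%:R ^+ 2)%:E = m%:E)%E -> 0 <= m.
  move=> r0 rm; rewrite -lee_fin -rm esum_ge0// => k _.
  by rewrite lee_fin mulr_ge0// sqr_ge0.
by apply: addr_ge0; [exact: (m0 p)|exact: (m0 q)].
Qed.

(** [C] depends on [bta] only and precedes [delta]: the Markov bound for the sums of squares is of
    order 1 / C uniformly in n, while the bounds involving [delta] and [mu] are of order 1 / n. Each
    kind receives half of [bta]. *)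
Lemma not_tame_small (bta : R) : 0 < bta ->
  exists C : R, 0 < C /\ forall delta : R, 0 < delta ->
  exists N : nat, forall n, (N <= n)%N ->
  (\esum_(D in [set: bidegree (V n)]) (balanced_pmf p q (t n) D *
     (~~ tame C (mu / 2) delta D)%:R)%:E <= bta%:E)%E.
Proof.
move=> b0; pose C' := 4 * M / bta + 1.
have C'0 : 0 < C' by rewrite ltr_wpDl// divr_ge0 ?mulr_ge0// ltW.
have C'M : 2 * M / C' <= bta / 2.
  rewrite ler_pdivrMr// /C' [leRHS]mulrDr mulr1.
  have -> : bta / 2 * (4 * M / bta) = 2 * M by field; rewrite gt_eqF.
  by rewrite lerDl divr_ge0// ltW.
exists (2 * C' + 2); split; first by lra.
move=> delta d0.
pose K := 2 * M * (4 / delta ^+ 2 + 4 / mu ^+ 2).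
have [N1 H1] := threshold_bounds M_ge0 kappa_le delta0_gt0 delta0_lt.
have [N2 H2] := exists_nat_ge (2 / delta).
have [N3 H3] := exists_nat_ge (2 * K / bta).
exists (maxn N1 (maxn N2 (maxn N3 1))) => n.
rewrite !geq_max => /and4P[/H1[t0 tn tM] /H2 n2 /H3 n3 n1].
have n0 : 0 < n%:R :> R by rewrite ltr0n.
have Vn : #|V n|%:R = n%:R :> R by rewrite card_V.
have Z_ge := accepted_total_ge (V n) p0 q0 p1 q1 p_mu q_mu p_m2 q_m2 t0.
rewrite Vn in Z_ge; have {}Z_ge := le_trans _ Z_ge.
have {}Z_ge := Z_ge 2^-1 _; have {}Z_ge := Z_ge ltac:(rewrite -/M; lra).
apply: le_trans (balanced_event p0 q0 p1 q1 Z_ge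
  (P' := fun D => ~~ raw_tame C' (mu / 2) (delta / 2) D) _) _.
  move=> D S Sk; apply: contra; apply: balance_tame => //.
  by rewrite Vn mulrC -ler_pdivrMr.
have V0 : 0 < #|V n|%:R :> R by rewrite Vn.
have d20 : 0 < delta / 2 by rewrite divr_gt0.
apply: le_trans (accepted_event p0 q0 p1 q1 p_mu q_mu p_m2 q_m2 Z_ge _ _
  (fun D => not_raw_tame_deviation mu_gt0 C'0 d20 V0 (D := D))) _.
- by rewrite Vn addr_ge0// invr_ge0 ?sqr_ge0// mulr_ge0 ?ltW.
- by rewrite divr_ge0// sqr_ge0.
rewrite Vn lee_fin -/M.
have -> : 2 * (((C' * n%:R)^-1 + ((delta / 2 * n%:R) ^+ 2)^-1 +
  4 / (mu * n%:R) ^+ 2) *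
  (n%:R * M)) = 2 * M / C' + K / n%:R.
  by rewrite /K; field; rewrite !gt_eqF.
have : K / n%:R <= bta / 2.
  by rewrite ler_pdivrMr//; move: n3; rewrite ler_pdivrMr//; lra.
lra.
Qed.

Lemma rcm_vanishing (h : forall n, {set V n * V n} -> R) :
  (forall n A, 0 <= h n A <= 1) ->
  (forall C c eta : R, 0 < C -> 0 < c -> 0 < eta ->
     exists delta : R, exists N : nat, 0 < delta /\
     forall n (D : bidegree (V n)), (N <= n)%N -> tame C c delta D ->
     \sum_(m in simple_matchings D) h n (arcs (matched_graph m)) <=
     eta * #|simple_matchings D|%:R) ->
  forall eps : R, 0 < eps -> exists N : nat, forall n, (N <= n)%N ->
  \sum_A rcm_pmf p q (t n) A * h n A <= eps.
Proof.
move=> h01 htame eps e0.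
have c0 : 0 < mu / 2 by rewrite divr_gt0.
have [C0 [C00 HC0]] := @not_tame_small 2^-1 ltac:(rewrite invr_gt0//).
have [l [d [Ns [l0 d0 Hs]]]] := tame_simple C00 c0.
have [N0 HN0] := HC0 d d0.
(* With this choice the exceptional term 2 bta / l of [rcm_sum_le] equals eps / 2. *)
pose bta := eps * l / 4.
have b0 : 0 < bta by rewrite divr_gt0// mulr_gt0.
have [C [CC HC]] := not_tame_small b0.
have e20 : 0 < eps / 2 by rewrite divr_gt0.
have [d' [N' [d'0 Hh]]] := htame C (mu / 2) (eps / 2) CC c0 e20.
have [N1 HN1] := HC d' d'0.
have [N2 H2] := threshold_bounds M_ge0 kappa_le delta0_gt0 delta0_lt.
exists (maxn Ns (maxn N0 (maxn N' (maxn N1 N2)))) => n.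
rewrite !geq_max => /and5P[nNs nN0 nN' nN1 /H2[t0 tn tM]].
have Vn : #|V n|%:R = n%:R :> R by rewrite card_V.
have Z_ge := accepted_total_ge (V n) p0 q0 p1 q1 p_mu q_mu p_m2 q_m2 t0.
rewrite Vn in Z_ge; have {}Z_ge := le_trans _ Z_ge.
have {}Z_ge := Z_ge 2^-1 _; have {}Z_ge := Z_ge ltac:(rewrite -/M; lra).
have tV : t n <= #|V n|%:R by rewrite Vn.
have -> : eps = eps / 2 + 2 * bta / l by rewrite /bta; field; rewrite gt_eqF.
apply: (rcm_sum_le p0 q0 p1 q1 Z_ge tV (good0 := tame C0 (mu / 2) d)
  (good := tame C (mu / 2) d') l0 (ltW e20) (ltW b0) (h01 n)).
- move=> D tD; split; last by apply: Hs => //; rewrite card_V.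
  by apply: card_matchings_gt0; case/and5P: tD => /eqP.
- by move=> D tD; exact: Hh.
- exact: HN0.
- exact: HN1.
Qed.

End Asymptotics.

(** * Moments of an integer-valued random variable as discrete sums *)

Section NatMoments.
Local Open Scope ring_scope.
Variables (R : realType) (d : measure_display) (T : measurableType d)
  (P : probability T R) (X : {RV P >-> nat}).

Let measurable_level (A : set nat) : measurable (X @^-1` A).
Proof. by rewrite -[_ @^-1` _]setTI; exact: (measurable_funPT X). Qed.

Lemma pmf_nat_ge0 k : 0 <= pmf_nat X k.
Proof. by rewrite fine_ge0. Qed.

Lemma pmf_natE k : ((pmf_nat X k)%:E = P (X @^-1` [set k]))%E.
Proof. by rewrite fineK// fin_num_measure. Qed.

Lemma integral_nat_RV (f : nat -> R) : (forall k, 0 <= f k) ->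
  (\int[P]_w (f (X w))%:E = \esum_(k in [set: nat]) (pmf_nat X k * f k)%:E)%E.
Proof.
move=> f0.
have cover : \bigcup_k (X @^-1` [set k]) = [set: T].
  by apply/seteqP; split=> // w _; exists (X w).
have mf : @measurable_fun _ _ T (\bar R) [set: T] (fun w => (f (X w))%:E).
  by move=> _ Y _; rewrite setTI; exact: (measurable_level [set k | Y (f k)%:E]).
rewrite -nneseries_esumT; last first.
  by move=> k; rewrite lee_fin mulr_ge0// pmf_nat_ge0.
rewrite -cover ge0_integral_bigcup//=.
- apply: eq_eseriesr => k _.
  rewrite (eq_integral (fun=> (f k)%:E)); last by move=> w /set_mem /= ->.
  by rewrite integral_cst// EFinM pmf_natE muleC.
- by rewrite cover.
- by move=> w _; rewrite lee_fin.
- by move=> i j _ _ [w [/= -> ->]].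
Qed.

Lemma pmf_nat_total : (\esum_(k in [set: nat]) (pmf_nat X k)%:E = 1)%E.
Proof.
have := integral_nat_RV (f := fun=> 1) (fun=> ler01).
rewrite integral_cst// mul1e => h; rewrite -(probability_setT P) h.
by apply: eq_esum => k _; rewrite mulr1.
Qed.

Lemma pmf_nat_moment (f : nat -> R) : (forall k, 0 <= f k) ->
  (\esum_(k in [set: nat]) (pmf_nat X k * f k)%:E = 'E_P[fun w => f (X w)])%E.
Proof. by move=> f0; rewrite unlock integral_nat_RV. Qed.

End NatMoments.

(** * Uniform marks *)

Section CellAverages.
Local Open Scope ring_scope.
Variables (R : realType) (N : nat).
Let M : R := N.+1%:R.
Let M_gt0 : 0 < M. Proof. by rewrite ltr0n. Qed.

(** Expectation over independent uniform cell indices, one for each element of [I]. *)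
Definition cell_avg (I : finType) (F : {ffun I -> 'I_N.+1} -> R) : R :=
  (\sum_c F c) / M ^+ #|I|.

Lemma le_cell_avg (I : finType) (F F' : {ffun I -> 'I_N.+1} -> R) :
  (forall c, F c <= F' c) -> cell_avg F <= cell_avg F'.
Proof.
move=> FF; rewrite /cell_avg ler_wpM2r ?invr_ge0 ?exprn_ge0 ?(ltW M_gt0)//.
by apply: ler_sum => c _; exact: FF.
Qed.

Lemma cell_avgD (I : finType) (F F' : {ffun I -> 'I_N.+1} -> R) :
  cell_avg (fun c => F c + F' c) = cell_avg F + cell_avg F'.
Proof. by rewrite /cell_avg big_split/= mulrDl. Qed.

Lemma cell_avg_sum (I J : finType) (P : pred J) (F :
  J -> {ffun I -> 'I_N.+1} -> R) :
  \sum_(j | P j) cell_avg (F j) = cell_avg (fun c => \sum_(j | P j) F j c).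
Proof. by rewrite /cell_avg -mulr_suml exchange_big. Qed.

Lemma cell_avg_const (I : finType) (x : R) :
  cell_avg (fun _ : {ffun I -> 'I_N.+1} => x) = x.
Proof.
rewrite /cell_avg sumr_const card_ffun card_ord -[_ *+ _]mulr_natl natrX.
by rewrite mulrAC divff ?mul1r// expf_neq0// gt_eqF.
Qed.

Section Restriction.
Variables (I S : finType) (phi : S -> I).
Hypothesis phi_inj : injective phi.

(** The indicator factors over [I]: a coordinate in the image of [phi] contributes 1 to the sum and
    every other coordinate the full M. *)
Lemma cell_avg_prescribed (g : S -> 'I_N.+1) :
  cell_avg (fun c : {ffun I -> 'I_N.+1} => [forall s, c (phi s) == g s]%:R) =
  M^-1 ^+ #|S|.
Proof.
pose w i (k : 'I_N.+1) : R := if [pick s | phi s == i] is Some s then (k == g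
  s)%:R else 1.
have wE s k : w (phi s) k = (k == g s)%:R.
  rewrite /w; case: pickP => [s' /eqP/phi_inj ->//|/(_ s)].
  by rewrite eqxx.
have ind (c : {ffun I -> 'I_N.+1}) :
  [forall s, c (phi s) == g s]%:R = \prod_i w i (c i).
  have [/forallP H|/forallPn[s H]] := boolP [forall s, c (phi s) == g s].
    rewrite big1// => i _; rewrite /w; case: pickP => // s /eqP <-.
    by rewrite H.
  by rewrite (bigD1 (phi s))//= wE (negPf H) mul0r.
rewrite /cell_avg; under eq_bigr do rewrite ind.
rewrite -(bigA_distr_bigA w).
have sw i : \sum_k w i k = M * (if i \in codom phi then M^-1 else 1).
  case: ifPn => [/codomP[s ->]|iN].
    under eq_bigr do rewrite wE.
    rewrite (bigD1 (g s))//= eqxx big1 ?addr0 ?mulfV ?gt_eqF//.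
    by move=> k /negPf ->.
  rewrite (eq_bigr (fun=> 1)) ?sumr_const ?card_ord ?mulr1// => k _.
  rewrite /w; case: pickP => // s /eqP si.
  by rewrite -si codom_f in iN.
under eq_bigr do rewrite sw.
rewrite big_split/= prodr_const -big_mkcond/= prodr_const.
rewrite mulrAC divff ?mul1r; last by rewrite expf_neq0// gt_eqF.
by rewrite card_codom.
Qed.

(** Independent uniform indices pulled back along an injection are again independent and uniform. *)
Lemma cell_avg_restrict (F : {ffun S -> 'I_N.+1} -> R) :
  cell_avg (fun c : {ffun I -> 'I_N.+1} => F [ffun s => c (phi s)]) = cell_avg F.
Proof.
have FE (c : {ffun I -> 'I_N.+1}) : F [ffun s => c (phi s)] =
    \sum_g F g * [forall s, c (phi s) == g s]%:R.
  rewrite (bigD1 [ffun s => c (phi s)])//= big1 ?addr0.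
    rewrite (_ : [forall s, _]) ?mulr1//.
    by apply/forallP => s; rewrite ffunE.
  move=> g gc; rewrite (_ : [forall s, _] = false) ?mulr0//.
  apply: contraNF gc => /forallP h; apply/eqP/ffunP => s.
  by rewrite ffunE (eqP (h s)).
transitivity (cell_avg (fun c : {ffun I -> 'I_N.+1} =>
    \sum_g F g * [forall s, c (phi s) == g s]%:R)).
  by rewrite /cell_avg; under eq_bigr do rewrite FE.
rewrite -cell_avg_sum {2}/cell_avg mulr_suml; apply: eq_bigr => g _.
rewrite -exprVn -(cell_avg_prescribed g) /cell_avg -mulr_sumr mulrA.
by [].
Qed.

End Restriction.

(** Union bound over ordered pairs, each of which collides with probability 1 / M. *)
Lemma cell_avg_not_injective (I : finType) :
  cell_avg (fun c : {ffun I -> 'I_N.+1} => (~~ injectiveb c)%:R) <=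
    #|I|%:R ^+ 2 / M.
Proof.
have pr (i j : I) : i != j -> cell_avg (fun c :
  {ffun I -> 'I_N.+1} => (c i == c j)%:R) = M^-1.
  (* Two distinct indices are an injection from the booleans, so a collision is a disjoint union of
     prescribed values. *)
  move=> ij; pose phi b := if b then i else j.
  have phi_inj : injective phi.
    by move=> [] []//= e; rewrite e eqxx in ij.
  transitivity (cell_avg (fun c : {ffun I -> 'I_N.+1} =>
      \sum_(k : 'I_N.+1) [forall b, c (phi b) == k]%:R)).
    rewrite /cell_avg; congr (_ / _); apply: eq_bigr => c _.
    rewrite (bigD1 (c i))//= big1 ?addr0.
      congr (nat_of_bool _)%:R; apply/eqP/forallP =>
        [e [] /=|/(_ false)/eqP/= ->//].
        by rewrite eqxx.
      by rewrite e.
    move=> k ki; rewrite (_ : [forall b, _] = false)//.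
    by apply: contraNF ki => /forallP/(_ true)/= /eqP ->.
  rewrite -cell_avg_sum; under eq_bigr do rewrite (cell_avg_prescribed phi_inj
    (fun=> _)).
  rewrite sumr_const card_ord card_bool -[_ *+ _]mulr_natl -/M expr2 mulrA divff
    ?mul1r//.
  by rewrite gt_eqF.
apply: (@le_trans _ _ (cell_avg (fun c : {ffun I -> 'I_N.+1} =>
    \sum_(p : I * I | p.1 != p.2) (c p.1 == c p.2)%:R))).
  apply: le_cell_avg => c; case: (boolP (injectiveb c)) => //= h;
    first exact: sumr_ge0.
  case/injectivePn: h => i [j ij cij]; rewrite (bigD1 (i, j))//= cij eqxx.
  by rewrite lerDl sumr_ge0.
rewrite -cell_avg_sum (eq_bigr (fun=> M^-1)); last by move=> p /pr.
rewrite sumr_const -[_ *+ _]mulr_natl ler_wpM2r ?invr_ge0 ?(ltW M_gt0)//.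
rewrite -natrX ler_nat -mulnn -card_prod max_card//.
Qed.

End CellAverages.

Section FinitePartition.
Local Open Scope ring_scope.
Variables (R : realType) (d : measure_display) (T : measurableType d)
  (P : probability T R).

(** The events [F k] need not cover the space, only carry total mass 1; this suits marks that lie in
    [0, 1) merely almost surely. *)
Lemma prob_partition_le (K : finType) (F : K -> set T) (g : K -> R) (Q : pred K)
    (B : set T) :
  (forall k, measurable (F k)) -> trivIset setT F ->
  (forall k, P (F k) = (g k)%:E) -> \sum_k g k = 1 -> measurable B ->
  (forall k w, Q k -> F k w -> ~ B w) ->
  (P B <= (\sum_k g k * (~~ Q k)%:R)%:E)%E.
Proof.
move=> mF tF PF g1 mB QB.
pose U := \bigcup_(k in [set k | Q k]) F k.
have finQ (D : set K) : finite_set D by exact: finite_finset.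
have mU : measurable U by apply: fin_bigcup_measurable => // k _; exact: mF.
have PU : P U = (\sum_(k | Q k) g k)%:E.
  rewrite /U measure_fin_bigcup//; last exact: sub_trivIset tF.
  have -> : [set k | Q k] = [set` enum Q].
    by apply/seteqP; split=> k /=; rewrite mem_enum.
  rewrite -fsbig_seq ?enum_uniq//= big_enum/= -sumEFin.
  by apply: eq_bigr => k _; rewrite PF.
have BU : B `<=` ~` U by move=> w Bw [k /= Qk Fk]; exact: (QB k w).
apply: (@le_trans _ _ (P (~` U))).
  exact: (le_measure P (mem_set mB) (mem_set (measurableC mU)) BU).
rewrite (probability_setC P mU) PU -EFinB lee_fin -[X in X - _]g1 (bigID Q)/=
  [leLHS]addrC addKr.
rewrite big_mkcond/= ler_sum// => k _.
by case: (Q k); rewrite /= ?mulr0 ?mulr1.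
Qed.

Variables (X : finType) (G : T -> X) (f : X -> R).
Hypothesis Gf : has_pmf P G f.

Let mG x : measurable (G @^-1` [set x]). Proof. by case: (Gf x). Qed.
Let PG x : P (G @^-1` [set x]) = (f x)%:E. Proof. by case: (Gf x). Qed.
Let tG : trivIset setT (fun x => G @^-1` [set x]).
Proof. by move=> x y _ _ [w [/= -> ->]]. Qed.

Lemma has_pmf_total : \sum_x f x = 1.
Proof.
have := probability_setT P.
have -> : [set: T] = \bigcup_(x in [set` enum X]) (G @^-1` [set x]).
  by apply/seteqP; split=> // w _; exists (G w) => //=; rewrite mem_enum.
rewrite measure_fin_bigcup//; last exact: sub_trivIset tG.
rewrite -fsbig_seq ?enum_uniq//= big_enum/=.
by under eq_bigr do rewrite PG; rewrite sumEFin => -[].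
Qed.

Lemma measurable_fin_preimage (Y : X -> set T) : (forall x, measurable (Y x)) ->
  measurable [set w | Y (G w) w].
Proof.
move=> mY.
have -> : [set w | Y (G w) w] = \bigcup_(x in [set: X]) (G @^-1` [set x] `&` Y x).
  by apply/seteqP; split=> w /= => [Yw|[x _ [/= -> //]]]; exists (G w).
apply: fin_bigcup_measurable => [|x _]; first exact: finite_finset.
exact: measurableI.
Qed.

Lemma prob_pred_le (p : pred X) :
  (P [set w | p (G w)] <= (\sum_x f x * (p x)%:R)%:E)%E.
Proof.
have mp : measurable [set w | p (G w)].
  apply: (@measurable_fin_preimage (fun x => [set w | p x])) => x.
  by case: (p x); [rewrite set_true|rewrite set_false].
have -> : \sum_x f x * (p x)%:R = \sum_x f x * (~~ ~~ p x)%:R.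
  by apply: eq_bigr => x _; rewrite negbK.
apply: (prob_partition_le (Q := fun x => ~~ p x) mG tG PG has_pmf_total mp).
by move=> x w /negP px /= Gx; rewrite Gx.
Qed.

End FinitePartition.

Section Cells.
Local Open Scope ring_scope.
Variables (R : realType) (N : nat).
Let M : R := N.+1%:R.
Let M_gt0 : 0 < M. Proof. by rewrite ltr0n. Qed.

Definition cell (k : 'I_N.+1) : set R := [set` `[k%:R / M, k.+1%:R / M[%R].

Lemma cell_sub k : cell k `<=` `[0%R, 1%R[%classic.
Proof.
move=> x; rewrite /cell /= !in_itv/= => /andP[h1 h2]; apply/andP; split.
  by apply: le_trans h1; rewrite divr_ge0 ?(ltW M_gt0).
by apply: lt_le_trans h2 _; rewrite ler_pdivrMr// mul1r ler_nat.
Qed.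

Lemma lebesgue_measure_cell k :
  lebesgue_measure (cell k `&` `[0%R, 1%R[%classic) = (M^-1)%:E.
Proof.
rewrite (setIidl (@cell_sub k)) /cell lebesgue_measure_itv/= lte_fin.
rewrite ltr_pM2r ?invr_gt0// ltr_nat ltnSn -EFinB -mulrBl -natr1.
by rewrite addrC addKr mul1r.
Qed.

Lemma cell_inj k k' x : cell k x -> cell k' x -> k = k'.
Proof.
rewrite /cell /= !in_itv/= => /andP[h1 h2] /andP[h3 h4].
have := le_lt_trans h1 h4; have := le_lt_trans h3 h2.
rewrite !ltr_pM2r ?invr_gt0// !ltr_nat !ltnS => k1 k2.
by apply/val_inj/eqP; rewrite eqn_leq k1 k2.
Qed.

(** Marks below 1 cannot overturn a strict order of degrees. At equal degrees the order of the cells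
    decides, and a shared cell is allowed only for equal marks. *)
Lemma cell_compare (a b : nat) k k' x y : cell k x -> cell k' y ->
  (k = k' -> x = y) ->
  (a%:R + x <= b%:R + y) = (a%:R + k%:R / M <= b%:R + k'%:R / M).
Proof.
move=> kx ky kk.
have := cell_sub kx; have := cell_sub ky; rewrite /= !in_itv/=.
move=> /andP[y0 y1] /andP[x0 x1].
have r0 (j : 'I_N.+1) : 0 <= j%:R / M by rewrite divr_ge0 ?(ltW M_gt0).
have r1 (j : 'I_N.+1) : j%:R / M < 1 by rewrite ltr_pdivrMr// mul1r ltr_nat.
move: kx ky; rewrite /cell /= !in_itv/= => /andP[h1 h2] /andP[h3 h4].
have p0 := r0 k; have q0 := r0 k'; have p1 := r1 k; have q1 := r1 k'.
have mono (i j : 'I_N.+1) : (i < j)%N -> i.+1%:R / M <= j%:R / M.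
  by move=> ij; rewrite ler_pM2r ?invr_gt0// ler_nat.
move: h1 h2 h3 h4 p0 q0 p1 q1.
set p := k%:R / M; set q := k'%:R / M => h1 h2 h3 h4 p0 q0 p1 q1.
have both (z z' : bool) : z -> z' -> z = z' by move=> -> ->.
have none (z z' : bool) : ~~ z -> ~~ z' -> z = z' by case: z; case: z'.
have [ab|ba|ab] := ltngtP a b.
- have : a%:R + 1 <= b%:R :> R by rewrite natr1 ler_nat.
  by move=> h; apply: both; lra.
- have : b%:R + 1 <= a%:R :> R by rewrite natr1 ler_nat.
  by move=> h; apply: none; rewrite -ltNge; lra.
rewrite ab !lerD2l; have [kk'|kk'|kk'] := ltngtP (k : nat) k'.
- have h := lt_le_trans h2 (mono _ _ kk').
  apply: both; first by rewrite ltW// (lt_le_trans h).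
  by rewrite ltW// (le_lt_trans h1).
- have h := lt_le_trans h4 (mono _ _ kk').
  apply: none; rewrite -ltNge; first by rewrite (lt_le_trans h).
  by rewrite (le_lt_trans h3).
- by move/val_inj: kk' => kk'; rewrite (kk kk') /p /q kk' !lexx.
Qed.

(** Degrees are integers and left end points lie in [0, 1), so distinct cells admit no ties; this
    supplies the injectivity assumed in [tame_spearman]. *)
Lemma cell_shift_inj (a b : nat) (k k' : 'I_N.+1) :
  a%:R + k%:R / M = b%:R + k'%:R / M -> k = k'.
Proof.
have r0 (j : 'I_N.+1) : 0 <= j%:R / M by rewrite divr_ge0 ?(ltW M_gt0).
have r1 (j : 'I_N.+1) : j%:R / M < 1 by rewrite ltr_pdivrMr// mul1r ltr_nat.
have := r0 k; have := r0 k'; have := r1 k; have := r1 k'.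
have [ab|ba|->] := ltngtP a b.
- have : a%:R + 1 <= b%:R :> R by rewrite natr1 ler_nat.
  by move: (k%:R / M) (k'%:R / M) => p q h h1 h2 h3 h4 h5; exfalso; lra.
- have : b%:R + 1 <= a%:R :> R by rewrite natr1 ler_nat.
  by move: (k%:R / M) (k'%:R / M) => p q h h1 h2 h3 h4 h5; exfalso; lra.
move=> _ _ _ _ /addrI /(divIf (lt0r_neq0 M_gt0))/eqP.
by rewrite eqr_nat => /eqP/val_inj.
Qed.

End Cells.

(** * Reduction of Spearman's rho with random marks to cell averages *)

Section SpearmanEvent.
Local Open Scope ring_scope.
Variables (R : realType) (V : finType) (alpha beta : dir).

Definition spearman_on (A : {set V * V}) (U W : V * V -> R) : R :=
  spearman (H := digraph_of A) alpha beta (fun e => U (val e)) (fun e => W (val e)).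

Variable N : nat.
Let M : R := N.+1%:R.
Notation cells := {ffun V * V -> 'I_N.+1}.

Definition cell_point (c : cells) (i : V * V) : R := (c i)%:R / M.

(* The marks matter only through comparisons, so when they fall in distinct cells
   they can be replaced by the left end points of their cells.  All averages over
   the marks thereby become finite sums. *)
Lemma spearman_cells (A : {set V * V}) (c c' : cells) (U W : V * V -> R) :
  injective c -> injective c' ->
  (forall i, @cell R _ (c i) (U i)) -> (forall i, @cell R _ (c' i) (W i)) ->
  spearman_on A U W = spearman_on A (cell_point c) (cell_point c').
Proof.
move=> ic ic' cU cW; rewrite /spearman_on /spearman; congr ((12 * _ - _) / _).
apply: eq_bigr => e _; rewrite /tie_rank; congr (_ * _); apply: eq_bigr => g _.
  by rewrite (cell_compare _ _ (cU _) (cU _))// => /ic ->.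
by rewrite (cell_compare _ _ (cW _) (cW _))// => /ic' ->.
Qed.

(** Colliding cells are counted as exceedances, because the left end points do not then determine
    the ranks of the true marks. *)
Definition cell_exceed (eps : R) (A : {set V * V}) : R :=
  cell_avg (fun c : cells => cell_avg (fun c' : cells =>
    (~~ [&& `|spearman_on A (cell_point c) (cell_point c')| <= eps,
        injectiveb c & injectiveb c'])%:R)).

Variables (d : measure_display) (T : measurableType d) (P : probability T R).
Variables (G : T -> {set V * V}) (f : {set V * V} -> R)
  (U W : V * V -> {RV P >-> R}).
Hypotheses (Gf : has_pmf P G f) (UW : iid_uniform_indep U W G).

Let event (k : {set V * V} * (cells * cells)) : set T :=
  G @^-1` [set k.1] `&`
  [set w | forall i, @cell R _ (k.2.1 i) (U i w) /\ @cell R _ (k.2.2 i) (W i w)].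

Let measurable_cell k : measurable (@cell R N k).
Proof. exact: measurable_itv. Qed.

Let measurable_event k : measurable (event k).
Proof.
apply: measurableI; first by case: (Gf k.1).
have -> : [set w | forall i, @cell R _ (k.2.1 i) (U i w) /\ @cell R _ (k.2.2 i)
  (W i w)] =
    \bigcap_(i in [set: V * V]) ((U i @^-1` @cell R _ (k.2.1 i)) `&` (W i @^-1`
      @cell R _ (k.2.2 i))).
  by apply/seteqP; split=> w /= h i; [move=> _|]; apply: h.
apply: fin_bigcap_measurable => [|i _]; first exact: finite_finset.
by apply: measurableI; rewrite -[_ @^-1` _]setTI; apply: measurable_funPT.
Qed.

Let event_trivIset : trivIset setT event.
Proof.
move=> [A [c1 c2]] [B [e1 e2]] _ _ [w [[/= GA h] [/= GB h']]].
congr (_, (_, _)); first by rewrite -GA -GB.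
  by apply/ffunP => i; have [x _] := h i; have [y _] := h' i; exact: cell_inj x y.
by apply/ffunP => i; have [_ x] := h i; have [_ y] := h' i; exact: cell_inj x y.
Qed.

Let prob_event k : P (event k) =
  (f k.1 * (M ^+ #|{: V * V}|)^-1 * (M ^+ #|{: V * V}|)^-1)%:E.
Proof.
rewrite /event (UW k.1 (fun i => measurable_cell (k.2.1 i)) (fun i =>
  measurable_cell (k.2.2 i))).
have [_ ->] := Gf k.1.
under eq_bigr do rewrite lebesgue_measure_cell.
under [X in (_ * (_ * X))%E]eq_bigr do rewrite lebesgue_measure_cell.
by rewrite !prodEFin !prodr_const -!EFinM mulrA !exprVn.
Qed.

Let measurable_spearman_on A : measurable_fun [set: T]
  (fun w => spearman_on A (fun i => U i w) (fun i => W i w)).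
Proof.
have mX (X : V * V -> {RV P >-> R}) (dg : {e : V * V | e \in A} -> nat) e :
    measurable_fun [set: T] (fun w => tie_rank (H :=
      digraph_of A) dg (fun e => X (val e) w) e).
  apply: measurable_sum => g.
  apply: (measurableT_comp (f := fun b : bool => b%:R : R)) => //.
  apply: measurable_fun_ler; apply: measurable_funD => //.
rewrite /spearman_on /spearman.
apply: measurable_funM => //; apply: measurable_funB => //.
apply: measurable_funM => //; apply: measurable_sum => e.
by apply: measurable_funM; exact: mX.
Qed.

(** The atoms fix the graph and the cells of all marks, and their probabilities are given by the
    joint independence. When no two marks of one family share a cell, the statistic is constant on
    the atom. *)
Lemma prob_spearman_le (eps : R) :
  (P [set w | (eps < `|spearman_on (G w) (fun i => U i w) (fun i => W i w)|)%R] <=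
   (\sum_A f A * cell_exceed eps A)%:E)%E.
Proof.
pose g (k : {set V * V} * (cells * cells)) : R :=
  f k.1 * (M ^+ #|{: V * V}|)^-1 * (M ^+ #|{: V * V}|)^-1.
have sum_g (F : {set V * V} -> cells -> cells -> R) :
    \sum_k g k * F k.1 k.2.1 k.2.2 =
    \sum_A f A * cell_avg (fun c => cell_avg (fun c' => F A c c')).
  rewrite -(pair_bigA _ (fun A cc => g (A, cc) * F A cc.1 cc.2))/=.
  apply: eq_bigr => A _.
  rewrite -(pair_bigA _ (fun c c' => g (A, (c, c')) * F A c c'))/=.
  rewrite /cell_avg -mulr_suml !mulr_suml mulr_sumr; apply: eq_bigr => c _.
  by rewrite !mulr_suml mulr_sumr; apply: eq_bigr => c' _; rewrite /g/=; ring.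
have g1 : \sum_k g k = 1.
  rewrite -[RHS](has_pmf_total Gf); under eq_bigr do rewrite -[g _]mulr1.
  rewrite (sum_g (fun _ _ _ => 1)); apply: eq_bigr => A _.
  by rewrite !cell_avg_const mulr1.
pose Q (k : {set V * V} * (cells * cells)) :=
  [&& `|spearman_on k.1 (cell_point k.2.1) (cell_point k.2.2)| <= eps,
    injectiveb k.2.1 & injectiveb k.2.2].
rewrite -(sum_g (fun A c c' => (~~ [&& `|spearman_on A (cell_point c) (cell_point
  c')| <= eps,
        injectiveb c & injectiveb c'])%:R)).
apply: (@prob_partition_le _ _ _ P _ event g Q) => //.
  apply: (measurable_fin_preimage Gf (Y := fun A =>
    [set w | eps < `|spearman_on A (fun i => U i w) (fun i => W i w)|])) => A.
  rewrite -[[set _ | _]]setTI.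
  apply: (@measurable_fun_ltr _ _ _ setT (cst eps)
    (fun w => `|spearman_on A (fun i => U i w) (fun i => W i w)|) _ _ measurableT
     [set true]) => //.
  by apply: measurableT_comp => //.
move=> [A [c c']] w /and3P[/= le /injectiveP ic /injectiveP ic'] [/= -> h].
apply/negP; rewrite -leNgt.
by rewrite (spearman_cells A ic ic' (fun i => (h i).1) (fun i => (h i).2)).
Qed.

End SpearmanEvent.

Section CellTransfer.
Local Open Scope ring_scope.
Variables (R : realType) (V : finType) (D : bidegree V) (alpha beta : dir) (N :
  nat).
Let M : R := N.+1%:R.
Notation S := (out_stub D).
Notation T := (in_stub D).

Let exceeds (eps : R) (m : {ffun S -> T}) (g : {ffun S -> 'I_N.+1})
    (g' : {ffun T -> 'I_N.+1}) : bool :=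
  [&& eps < `|spearman (H := matched_graph m) alpha beta
        (fun s => (g s)%:R / M : R) ((fun t => (g' t)%:R / M) \o m)|,
      injectiveb g & injectiveb g'].

(* The marks of the arcs of a simple graph may be attached to the outbound and
   to the inbound stubs instead, which makes them independent of the matching. *)
Lemma cell_exceed_arcs (eps : R) (m : {ffun S -> T}) : m \in simple_matchings D ->
  cell_exceed alpha beta N eps (arcs (matched_graph m)) <=
  cell_avg (fun g => cell_avg (fun g' => (exceeds eps m g g')%:R)) +
    2 * (#|{: V * V}|%:R ^+ 2 / M).
Proof.
move=> mS; have [mb _] := simple_onP _ _ _ _ mS.
have mi := bijections_inj mb.
have ct t : t \in codom m by move: mb; rewrite inE => /andP[_ /forallP].
pose phi (s : S) : V * V := @endpoints V (matched_graph m) s.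
(* The arc through the inbound stub [t]: composed with [m] it is [phi], so target marks can be read
   at inbound stubs. *)
pose psi (t : T) : V * V := phi (iinv (ct t)).
have phi_inj : injective phi by exact: endpoints_inj mS.
have psi_inj : injective psi.
  by move=> t t' /phi_inj e; rewrite -(f_iinv (ct t)) -(f_iinv (ct t')) e.
have psi_m s : psi (m s) = phi s.
  by congr phi; apply: mi; rewrite f_iinv.
have noninj := cell_avg_not_injective R N {: V * V}.
apply: (@le_trans _ _ (cell_avg (fun c : {ffun V * V -> 'I_N.+1} =>
  cell_avg (fun c' : {ffun V * V -> 'I_N.+1} =>
    (exceeds eps m [ffun s => c (phi s)] [ffun t => c' (psi t)])%:R +
    ((~~ injectiveb c)%:R + (~~ injectiveb c')%:R) : R)))).
  apply: le_cell_avg => c; apply: le_cell_avg => c'.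
  case: (boolP (injectiveb c)) => [/injectiveP ic|_]; last first.
    by rewrite !andbF /= addrCA lerDl addr_ge0.
  case: (boolP (injectiveb c')) => [/injectiveP ic'|_]; last first.
    by rewrite !andbF /= addrA lerDr addr_ge0.
  rewrite !andbT /= !addr0 -ltNge /spearman_on spearman_arcs//.
  have -> : (fun s => cell_point R c (@endpoints V (matched_graph m) s)) =
      (fun s => ([ffun s => c (phi s)] s)%:R / M).
    by apply/funext => s; rewrite ffunE.
  have -> : (fun s => cell_point R c' (@endpoints V (matched_graph m) s)) =
      (fun t => ([ffun t => c' (psi t)] t)%:R / M) \o m.
    by apply/funext => s; rewrite /= ffunE psi_m.
  rewrite /exceeds.
  have ig : injectiveb [ffun s => c (phi s)].
    by apply/injectiveP => s s'; rewrite !ffunE => /ic/phi_inj.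
  have ig' : injectiveb [ffun t => c' (psi t)].
    by apply/injectiveP => t t'; rewrite !ffunE => /ic'/psi_inj.
  by rewrite ig ig' !andbT.
have -> : cell_avg (fun g => cell_avg (fun g' => (exceeds eps m g g')%:R)) =
    cell_avg (fun c : {ffun V * V -> 'I_N.+1} => cell_avg (fun c' :
      {ffun V * V -> 'I_N.+1} =>
      (exceeds eps m [ffun s => c (phi s)] [ffun t => c' (psi t)])%:R : R)).
  rewrite -(cell_avg_restrict phi_inj); congr cell_avg; apply/funext => c.
  exact/esym/(cell_avg_restrict psi_inj (fun g' =>
    (exceeds eps m [ffun s => c (phi s)] g')%:R)).
under eq_fun do rewrite !cell_avgD cell_avg_const.
rewrite !cell_avgD cell_avg_const mulrDl mul1r.
by rewrite lerD// lerD.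
Qed.

(** With marks on stubs, the average over cells can be taken outside the sum over matchings, and the
    hypothesis applies to each fixed choice of distinct cells. *)
Lemma sum_cell_exceed_le (eps eta : R) :
  (forall (U : S -> R) (W : T -> R),
    injective (fun s => (stub_deg D alpha (tag s))%:R + U s) ->
    injective (fun t => (stub_deg D beta (tag t))%:R + W t) ->
    \sum_(m in simple_matchings D)
       (eps < `|spearman (H := matched_graph m) alpha beta U (W \o m)|)%R%:R <=
    eta * #|simple_matchings D|%:R) -> 0 <= eta ->
  \sum_(m in simple_matchings D)
     cell_exceed alpha beta N eps (arcs (matched_graph m)) <=
  (eta + 2 * (#|{: V * V}|%:R ^+ 2 / M)) * #|simple_matchings D|%:R.
Proof.
move=> H eta0.
apply: le_trans (ler_sum _ (fun m mS => cell_exceed_arcs eps mS)) _.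
rewrite big_split/= sumr_const [leRHS]mulrDl lerD//;
  last by rewrite -[leLHS]mulr_natr.
rewrite cell_avg_sum.
under eq_fun do rewrite cell_avg_sum.
rewrite -[leRHS](cell_avg_const N S); apply: le_cell_avg => g.
rewrite -[leRHS](cell_avg_const N T); apply: le_cell_avg => g'.
have [/andP[/injectiveP ig /injectiveP ig']|ninj] :=
  boolP (injectiveb g && injectiveb g').
  have h1 : injective (fun s => (stub_deg D alpha (tag s))%:R + (g s)%:R / M).
    by move=> s s' /cell_shift_inj/ig.
  have h2 : injective (fun t => (stub_deg D beta (tag t))%:R + (g' t)%:R / M).
    by move=> t t' /cell_shift_inj/ig'.
  apply: le_trans (H _ _ h1 h2); apply: ler_sum => m _.
  by rewrite ler_nat /exceeds; case: (eps < _) => //=; exact: leq_b1.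
rewrite big1 ?mulr_ge0// => m _.
by rewrite /exceeds (negPf ninj) andbF.
Qed.

End CellTransfer.

Lemma tame_cell_exceed (R : realType) (V : nat -> finType) (alpha beta : dir)
    (C c eta eps : R) : (forall n, #|V n| = n) ->
  0 < C -> 0 < c -> 0 < eta -> 0 < eps ->
  exists delta : R, exists N : nat, 0 < delta /\
  forall n (D : bidegree (V n)), (N <= n)%N -> tame C c delta D ->
  \sum_(m in simple_matchings D)
     cell_exceed alpha beta (n ^ 5) eps (arcs (matched_graph m)) <=
  eta * #|simple_matchings D|%:R.
Proof.
move=> cV C0 c0 e0 p0.
have e2 : 0 < eta / 2 by rewrite divr_gt0.
have [delta [N [d0 H]]] := tame_spearman alpha beta C0 c0 e2 p0.
have [N1 H1] := exists_nat_ge (4 / eta).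
exists delta, (maxn 1 (maxn N N1)); split=> // n D.
rewrite !geq_max => /and3P[n0 nN /H1 nN1] tD.
have {}H := H (V n) D _ tD.
apply: le_trans (sum_cell_exceed_le _ (H _) (ltW e2)) _; first by rewrite cV.
rewrite ler_wpM2r// card_prod cV.
have n1 : 0 < n%:R :> R by rewrite ltr0n.
(* There are n^2 possible arcs, so the collision bound is n^4 over the number of cells; the exponent
   5 makes it vanish. *)
have h1 : (n * n)%:R ^+ 2 / (n ^ 5).+1%:R <= n%:R^-1 :> R.
  rewrite ler_pdivrMr ?ltr0n// mulrC ler_pdivlMr//.
  by rewrite -natrX -natrM ler_nat; lia.
have h2 : n%:R^-1 <= eta / 4.
  by rewrite -[eta / 4]invf_div lef_pV2// posrE divr_gt0.
apply: (@le_trans _ _ (eta / 2 + 2 * (eta / 4))); last lra.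
by rewrite lerD2l ler_pM2l// (le_trans h1).
Qed.

(** * Convergence in probability *)

Lemma tends_to_0_le (R : realType) (d : nat -> measure_display)
    (T : forall n, measurableType (d n)) (P : forall n, probability (T n) R)
    (X : forall n, T n -> R) :
  (forall eps eta : R, 0 < eps -> 0 < eta -> \forall n \near \oo,
     (P n [set w | (eps < `|X n w|)%R] <= eta%:E)%E) ->
  tends_to_0_in_probability P X.
Proof.
move=> H eps e0; apply/fine_cvgP; split.
  have [N _ HN] := H _ _ e0 (@ltr01 R).
  exists N => // n Nn; rewrite fin_numElt (le_lt_trans (HN n Nn)) ?ltry// andbT.
  exact: lt_le_trans (measure_ge0 _ _).
apply/cvgrPdist_le => eta eta0; have [N _ HN] := H _ _ e0 eta0.
exists N => // n Nn /=; rewrite sub0r normrN ger0_norm ?fine_ge0//.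
by rewrite -lee_fin fineK ?(HN n Nn)// fin_numElt (le_lt_trans (HN n Nn)) ?ltry//
  andbT;
  exact: lt_le_trans (measure_ge0 _ _).
Qed.

Theorem theorem5p7 (R : realType)
  (d0 : measure_display) (T0 : measurableType d0) (P0 : probability T0 R)
  (gamma xi : {RV P0 >-> nat})
  (mean_gt0 : (0 < 'E_P0[fun w => (gamma w)%:R])%E)
  (mean_eq : ('E_P0[fun w => (gamma w)%:R] = 'E_P0[fun w => (xi w)%:R])%E)
  (mean_fin : ('E_P0[fun w => (gamma w)%:R] < +oo)%E)
  (a b : R) (a_gt1 : 1 < a) (b_gt1 : 1 < b)
  (Lm Lp : R -> R) (Lm_sv : slowly_varying Lm) (Lp_sv : slowly_varying Lp)
  (gamma_tail : forall x : R, 0 < x ->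
     (P0 [set w | (x < (gamma w)%:R)%R] <= (x `^ (- a) * Lm x)%:E)%E)
  (xi_tail : forall x : R, 0 < x ->
     (P0 [set w | (x < (xi w)%:R)%R] <= (x `^ (- b) * Lp x)%:E)%E)
  (kappa delta0 : R)
  (kappaE : kappa = Num.min (1 - a^-1) (Num.min (1 - b^-1) 2^-1))
  (delta0_gt0 : 0 < delta0) (delta0_lt : delta0 < kappa)
  (gamma_L2 : ('E_P0[fun w => ((gamma w)%:R ^+ 2)%R] < +oo)%E)
  (xi_L2 : ('E_P0[fun w => ((xi w)%:R ^+ 2)%R] < +oo)%E)
  (V : nat -> finType) (card_V : forall n, #|V n| = n)
  (d : nat -> measure_display) (T : forall n, measurableType (d n))
  (P : forall n, probability (T n) R)
  (G : forall n, T n -> {set V n * V n})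
  (G_rcm : \forall n \near \oo,
     has_pmf (P n) (G n)
       (@rcm_pmf R (V n) (pmf_nat gamma) (pmf_nat xi)
          (n%:R `^ (1 - kappa + delta0))))
  (alpha beta : dir) :
  [/\ forall U W : forall n, V n * V n -> {RV (P n) >-> R},
        (\forall n \near \oo, iid_uniform_indep (U n) (W n) (G n)) ->
        tends_to_0_in_probability P (fun n w =>
          spearman (H := digraph_of (G n w)) alpha beta
            (fun e => U n (val e) w) (fun e => W n (val e) w)),
      tends_to_0_in_probability P (fun n w =>
        spearman_avg R (digraph_of (G n w)) alpha beta) &
      tends_to_0_in_probability P (fun n w =>
        kendall R (digraph_of (G n w)) alpha beta)].
Proof.
pose mu := fine 'E_P0[fun w => (gamma w)%:R : R].
have fin_E (f : T0 -> R) : (forall w, 0 <= f w) -> ('E_P0[f] < +oo)%E ->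
    ('E_P0[f] = (fine 'E_P0[f])%:E)%E.
  move=> f0 foo; rewrite fineK// fin_numElt foo andbT.
  by apply: lt_le_trans (expectation_ge0 P0 f0).
have muE := fin_E _ (fun w => ler0n R (gamma w)) mean_fin.
have mu_gt0 : 0 < mu by rewrite -lte_fin /mu -muE.
have gmu := pmf_nat_moment gamma (f := fun k => k%:R) (fun k => ler0n R k).
have xmu := pmf_nat_moment xi (f := fun k => k%:R) (fun k => ler0n R k).
have gm2 := pmf_nat_moment gamma (f := fun k => k%:R ^+ 2) (fun k => sqr_ge0 _).
have xm2 := pmf_nat_moment xi (f := fun k => k%:R ^+ 2) (fun k => sqr_ge0 _).
rewrite muE in gmu; rewrite -mean_eq muE in xmu.
rewrite (fin_E _ (fun w => sqr_ge0 _) gamma_L2) in gm2.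
rewrite (fin_E _ (fun w => sqr_ge0 _) xi_L2) in xm2.
have kappa_le : kappa <= 2^-1 by rewrite kappaE !ge_min lexx !orbT.
have vanish := rcm_vanishing (pmf_nat_ge0 gamma) (pmf_nat_ge0 xi)
  (pmf_nat_total gamma) (pmf_nat_total xi) mu_gt0 gmu xmu gm2 xm2
  kappa_le delta0_gt0 delta0_lt card_V.
have bool01 (b' : bool) : 0 <= (b'%:R : R) <= 1 by case: b'; rewrite ?lexx ?ler01.
(* Covers the statistics that are functions of the graph alone, for which the bounded function in
   [vanish] is an indicator. *)
have deterministic (stat : forall n, {set V n * V n} -> R) :
    (forall C c eta eps : R, 0 < C -> 0 < c -> 0 < eta -> 0 < eps ->
      exists delta : R, exists N : nat, 0 < delta /\
      forall (n : nat) (D : bidegree (V n)), (N <= #|V n|)%N -> tame C c delta D ->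
      \sum_(m in simple_matchings D)
        (eps < `|stat n (arcs (matched_graph m))|)%R%:R <=
      eta * #|simple_matchings D|%:R) ->
    tends_to_0_in_probability P (fun n w => stat n (G n w)).
  move=> H; apply: tends_to_0_le => eps eta e0 eta0.
  have [] := vanish (fun n A => (eps < `|stat n A|)%R%:R) _ _ eta eta0.
  - by move=> n A.
  - move=> C c h C0 c0 h0; have [delta [N [dl0 HN]]] := H C c h eps C0 c0 h0 e0.
    by exists delta, N; split=> // n D nN; apply: HN; rewrite card_V.
  move=> N HN; near=> n.
  have Gn : has_pmf (P n) (G n) (rcm_pmf (pmf_nat gamma) (pmf_nat xi)
    (n%:R `^ (1 - kappa + delta0))) by near: n.
  apply: le_trans (prob_pred_le Gn (fun A => eps < `|stat n A|)) _.
  by rewrite lee_fin; apply: HN; near: n; exact: nbhs_infty_ge.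
split.
- move=> U W UW; apply: tends_to_0_le => eps eta e0 eta0.
  (* With random marks, the averaged exceedance, a number between 0 and 1, takes the place of the
     indicator. *)
  have [] := vanish (fun n => cell_exceed alpha beta (n ^ 5) eps) _ _ eta eta0.
  - move=> n A; apply/andP; split.
      rewrite -(cell_avg_const (n ^ 5) (V n * V n)%type (0 : R));
        apply: le_cell_avg => c.
      by rewrite -(cell_avg_const (n ^ 5) (V n * V n)%type (0 : R));
        apply: le_cell_avg.
    rewrite -[leRHS](cell_avg_const (n ^ 5) (V n * V n)%type (1 : R));
      apply: le_cell_avg => c.
    rewrite -[leRHS](cell_avg_const (n ^ 5) (V n * V n)%type (1 : R));
      apply: le_cell_avg => c'.
    by case/andP: (bool01 (~~ [&& `|spearman_on alpha beta A (cell_point R c)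
      (cell_point R c')| <= eps,
        injectiveb c & injectiveb c'])).
  - by move=> C c h C0 c0 h0; exact: tame_cell_exceed.
  move=> N HN; near=> n.
  have Gn : has_pmf (P n) (G n) (rcm_pmf (pmf_nat gamma) (pmf_nat xi)
    (n%:R `^ (1 - kappa + delta0))) by near: n.
  have UWn : iid_uniform_indep (U n) (W n) (G n) by near: n.
  apply: le_trans (prob_spearman_le alpha beta (n ^ 5) Gn UWn eps) _.
  by rewrite lee_fin; apply: HN; near: n; exact: nbhs_infty_ge.
- apply: (deterministic (fun n A => spearman_avg R (digraph_of A) alpha beta)).
  move=> C c h eps C0 c0 h0 e0.
  have [delta [N [dl0 HN]]] := tame_spearman_avg alpha beta C0 c0 h0 e0.
  exists delta, N; split=> // n D nN tD; apply: le_trans (HN _ D nN tD).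
  by apply: ler_sum => m mS; rewrite spearman_avg_arcs.
- apply: (deterministic (fun n A => kendall R (digraph_of A) alpha beta)).
  move=> C c h eps C0 c0 h0 e0.
  have [delta [N [dl0 HN]]] := tame_kendall alpha beta C0 c0 h0 e0.
  exists delta, N; split=> // n D nN tD; apply: le_trans (HN _ D nN tD).
  by apply: ler_sum => m mS; rewrite kendall_arcs.
Unshelve. all: by end_near. Qed.
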